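(* Let $m=m(x,x^* )$ be an order function on $E\times E^*$. Let $J\subset E$ be a lattice and let $\chi\in\mathcal S(E)$ satisfy $\sum_{j\in J}\chi_j=1$, where $\chi_j(x)=\chi(x-j)$. Then $$\widetilde S(m)=\{a\in\mathcal S'(E):\ \exists C>0 \text{ such that } |\widehat{\chi_j a}(x^* )|\le C\,m(j,x^* )\ \text{ for all } j\in J,\ x^*\in E^*\}.$$
   Context: $E$ is a real vector space of finite dimension $d$, $E^*$ its dual; the hat denotes the Fourier transform. An order function on a finite dimensional real vector space $V$ is a function $m:V\to]0,\infty[$ for which there are $C_0>0$, $N_0\ge1$ with $m(\rho)\le C_0\langle\rho-\mu\rangle^{N_0}m(\mu)$ for all $\rho,\mu\in V$, where $\langle\rho\rangle=(1+|\rho|^2)^{1/2}$ for some norm $|\cdot|$. A lattice in $V$ is the set of integer combinations of a basis of $V$. Weyl quantization of a symbol $b$ on $E\times E^*$: $b^wu(x)=(2\pi)^{-d}\iint e^{i(x-y)\cdot\theta}b(\frac{x+y}2,\theta)u(y)\,dy\,d\theta$. Definition of $\widetilde S(m)$: fix a lattice $\Gamma\subset E\times E^*$ and $\Xi\in\mathcal S(E\times E^* )$ with $\sum_{\gamma\in\Gamma}\Xi_\gamma=1$, $\Xi_\gamma(\rho)=\Xi(\rho-\gamma)$. Then $a\in\mathcal S'(E)$ belongs to $\widetilde S(m)$ iff there is $C>0$ with $\|\Xi_\gamma^wa\|_{L^2(E)}\le C\,m(\gamma)$ for all $\gamma\in\Gamma$ (the space does not depend on the choice of $\Gamma,\Xi$).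 *)

(* Defs.v *)
From HB Require Import structures.
From mathcomp Require Import all_boot all_order all_algebra finmap.
From mathcomp Require Import complex.
From mathcomp Require Import all_classical all_reals all_analysis.
Import Order.TTheory GRing.Theory Num.Theory.
Import numFieldNormedType.Exports.

Set Implicit Arguments.
Unset Strict Implicit.
Unset Printing Implicit Defensive.

Local Open Scope classical_set_scope.
Local Open Scope ring_scope.

Notation normc := ComplexField.Normc.normc.

Section VectorSpace.
Context {R : realType} {V : vectType R}.
Implicit Types (f g : V -> R[i]) (x y v : V).

Local Notation d := (\dim {:V}).

Definition ebasis : d.-tuple V := vbasis {:V}.

Definition lattice (J : set V) : Prop :=
  exists2 b : d.-tuple V, basis_of {:V} b &
    J = [set x | exists z : 'I_d -> int, x = \sum_(i < d) b`_i *~ z i].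

Definition is_norm (N : V -> R) : Prop :=
  [/\ forall x, N x = 0 -> x = 0,
      forall (c : R) x, N (c *: x) = `|c| * N x
    & forall x y, N (x + y) <= N x + N y].

Definition japanese (N : V -> R) (x : V) : R := Num.sqrt (1 + N x ^+ 2).

Definition order_function (m : V -> R) : Prop :=
  (forall x, 0 < m x) /\
  exists N : V -> R, is_norm N /\
  exists C0 N0 : R, [/\ 0 < C0, 1 <= N0 &
    forall x y, m x <= C0 * japanese N (x - y) `^ N0 * m y].

Definition dderive v f x : R[i] :=
  Complex (derive1 (fun t : R => complex.Re (f (x + t *: v))) 0)
          (derive1 (fun t : R => complex.Im (f (x + t *: v))) 0).

Definition dderivable v f x : Prop :=
  derivable (fun t : R => complex.Re (f (x + t *: v))) 0 1 /\
  derivable (fun t : R => complex.Im (f (x + t *: v))) 0 1.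

(* Multi-indices are lists of coordinate indices: [:: i; j] encodes
   x_i x_j in [monomial] and d_i d_j in [pderive]. *)
Definition pderive (beta : seq 'I_d) f : V -> R[i] :=
  foldr (fun (i : 'I_d) g => dderive ebasis`_i g) f beta.

Definition monomial (alpha : seq 'I_d) x : R :=
  \prod_(i <- alpha) coord ebasis i x.

(* sup |x^alpha d^beta f| <= M *)
Definition seminorm_le (alpha beta : seq 'I_d) f (M : R) : Prop :=
  forall x, `|monomial alpha x| * normc (pderive beta f x) <= M.

(* Existence of all iterated partial derivatives together with the bounds
   gives C^oo: each iterated derivative has bounded first partials, hence is
   Lipschitz. *)
Definition schwartz : set (V -> R[i]) := [set f |
  (forall beta (i : 'I_d) x, dderivable ebasis`_i (pderive beta f) x) /\
  (forall alpha beta, exists M, seminorm_le alpha beta f M)].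

(* A tempered distribution is a functional on S(V), extended by 0 to all
   functions so that equality of distributions is plain equality. *)
Definition tempered : set ((V -> R[i]) -> R[i]) := [set T |
  [/\ forall (c : R[i]) f g, schwartz f -> schwartz g ->
        T (fun x => c * f x + g x) = c * T f + T g,
      exists (C : R) (k : nat), forall f M, schwartz f ->
        (forall alpha beta, (size alpha <= k)%N -> (size beta <= k)%N ->
           seminorm_le alpha beta f M) ->
        normc (T f) <= C * M
    & forall f, ~ schwartz f -> T f = 0]].

Definition translate v f : V -> R[i] := fun x => f (x - v).

Definition mul_distr f (T : (V -> R[i]) -> R[i]) : (V -> R[i]) -> R[i] :=
  patch (fun=> 0) schwartz (fun g => T (fun x => f x * g x)).

Definition fcontinuous f : Prop :=
  forall x (e : R), 0 < e -> exists2 delta : R, 0 < delta &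
    forall y, (forall i, `|coord ebasis i (y - x)| < delta) ->
      normc (f y - f x) < e.

Definition has_sum (J : set V) f (s : R[i]) : Prop :=
  forall e : R, 0 < e -> exists A : {fset V}, [set` A] `<=` J /\
    forall B : {fset V}, [set` A] `<=` [set` B] -> [set` B] `<=` J ->
      normc (\sum_(j <- enum_fset B) f j - s) < e.

Definition partition_of_unity (J : set V) f : Prop :=
  forall x, has_sum J (fun j => translate j f x) 1.

(* Iterated Lebesgue integral of t |-> f (x + t_1 b_1 + ... + t_n b_n) for
   b = [:: b_1; ...; b_n]. For b a basis and x = 0 this is, by Fubini and
   Tonelli, the integral over V for the Lebesgue measure giving mass 1 to the
   parallelotope spanned by b. *)
Fixpoint iterint (b : seq V) (f : V -> \bar R) x : \bar R :=
  if b is v :: b' then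
    (\int[@lebesgue_measure R]_(t in setT) iterint b' f (x + t *: v))%E
  else f x.

Definition integralC (b : seq V) f : R[i] :=
  Complex (fine (iterint b (fun x => (complex.Re (f x))%:E) 0))
          (fine (iterint b (fun x => (complex.Im (f x))%:E) 0)).

Definition L2norm (b : seq V) f : \bar R :=
  (iterint b (fun x => (normc (f x) ^+ 2)%:E) 0 `^ (2^-1))%E.

End VectorSpace.

Section PhaseSpace.
Context {R : realType}.

Definition dual (E : vectType R) : vectType R := 'Hom(E, R^o).

Context {E : vectType R}.

Definition pairing (x : E) (xi : dual E) : R := xi x.

(* The basis of E^* dual to [ebasis]. E and E^* carry the Lebesgue measures
   attached to these two bases, so that Fourier inversion holds with the
   constant (2 pi)^-d. *)
Definition dual_basis : seq (dual E) :=
  [seq linfun (coord ebasis i : E -> R^o) | i <- enum 'I_(\dim {:E})].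

Definition cis (t : R) : R[i] := Complex (cos t) (sin t).

(* Fourier transform S(E^* ) -> S(E). *)
Definition fourier_dual (psi : dual E -> R[i]) (x : E) : R[i] :=
  integralC dual_basis (fun xi => cis (- pairing x xi) * psi xi).

(* Fourier transform S'(E) -> S'(E^* ), by duality. *)
Definition fourier_distr (u : (E -> R[i]) -> R[i]) :
    (dual E -> R[i]) -> R[i] :=
  patch (fun=> 0) schwartz (fun psi => u (fourier_dual psi)).

Definition distr_of_fun (F : dual E -> R[i]) : (dual E -> R[i]) -> R[i] :=
  patch (fun=> 0) schwartz
    (fun psi => integralC dual_basis (fun xi => F xi * psi xi)).

(* The distribution u on E^* is the continuous function F (which u determines);
   u(xi) then means F xi. *)
Definition is_function (u : (dual E -> R[i]) -> R[i]) (F : dual E -> R[i]) :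
    Prop :=
  fcontinuous F /\ u = distr_of_fun F.

Definition weyl_kernel (b : E * dual E -> R[i]) (x y : E) : R[i] :=
  real_complex R ((2 * pi) ^- \dim {:E}) *
  integralC dual_basis (fun theta =>
    cis (pairing (x - y) theta) * b (2^-1 *: (x + y), theta)).

(* b^w u for b in S(E x E^* ) and u in S'(E): the y-integral in
   (2 pi)^-d \iint e^{i(x-y).theta} b((x+y)/2, theta) u(y) dy dtheta
   is the pairing of u with the Schwartz function [weyl_kernel b x]. *)
Definition weyl (b : E * dual E -> R[i]) (u : (E -> R[i]) -> R[i]) :
    E -> R[i] :=
  fun x => u (weyl_kernel b x).

Definition Stilde (Gamma : set (E * dual E)%type) (Xi : E * dual E -> R[i])
    (m : E * dual E -> R) : set ((E -> R[i]) -> R[i]) :=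
  [set a | tempered a /\ exists2 C : R, 0 < C &
    forall gamma, Gamma gamma ->
      (L2norm ebasis (weyl (translate gamma Xi) a) <= (C * m gamma)%:E)%E].

End PhaseSpace.

(* Main.v *)
Require Import Defs.
From HB Require Import structures.
From mathcomp Require Import all_boot all_order all_algebra finmap.
From mathcomp Require Import complex.
From mathcomp Require Import all_classical all_reals all_analysis.
From mathcomp Require Import measurable_realfun zify ring lra.
Import Order.TTheory GRing.Theory Num.Theory.
Import numFieldNormedType.Exports.

(** Both descriptions of [Stilde Gamma Xi m] are equivalent to a third one,
  [microlocal_bound], in which neither [chi] nor [Xi] occurs: [normc (a f)] is at
  most a constant times [m z * M] whenever [recenter z f], which is [f] with the
  phase space point [z] moved to the origin, has size [M] in a fixed Schwartz
  seminorm. In other words, testing [a] against a wave packet at [z] costs [m z].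

  This bound implies the other two by a choice of test functions. The Fourier
  transform of [translate j chi * a] at [xi] is [a] applied to a wave packet at
  [(j, xi)] of shape [chi] ([microlocal_local_hat]). The value at [x] of the Weyl
  operator with symbol [translate g Xi] applied to [a] is [a] applied to a row of
  its kernel, a wave packet at [g] of size rapidly decreasing in [x - g.1]; so it is
  square integrable with the right norm ([microlocal_weyl]).

  Conversely, decompose a test function [f], either as the sum of the
  [translate j chi * f], or, up to a nonzero constant, as the sum of the images of
  [f] under the transposes of the Weyl operators with symbols [translate g Xi].
  The hypothesis bounds [a] on each piece: by Fourier inversion in the first case
  ([chi_near]), by duality and the Cauchy-Schwarz inequality in the second
  ([weylT_near]). These bounds lose a power of the distance between the centre of
  the piece and [z], which is harmless for the pieces near [z]. The far pieces are
  rapidly decreasing wave packets at their own centres ([chi_far], [weylT_far]), and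
  to them one applies the bound being proved: a constant [B] improves to
  [S + B / 2], hence to [2 * S] ([absorption]). A finite [B] to begin with exists
  for the weight [m + e * jb ^+ N'], because [a] is tempered; [S] does not depend on
  [e], which then tends to 0.

  The analysis behind this is kept elementary. A derivative is obtained from a
  quadratic Taylor remainder ([isD_quad]). Integrals of functions with a common
  rate of decay and Lipschitz constant are approximated by one and the same finite
  sum ([IC_quad]), so that they commute with tempered distributions
  ([tempered_IC]) and with each other ([IC_Fubini]). Fourier inversion is needed
  only up to a nonzero constant ([inversion], [cF_neq0]). The decompositions of [f]
  converge with summable seminorms, and a pointwise limit is then enough
  ([tempered_has_sum]); the pointwise limit takes an argument for the Weyl
  operators, whose symbols sum to 1 without the sum being a Schwartz function
  ([weylT_has_sum]). *)

Set Implicit Arguments.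
Unset Strict Implicit.
Unset Printing Implicit Defensive.

Local Open Scope classical_set_scope.
Local Open Scope ring_scope.

(** * The modulus of a complex number *)

Section ComplexNorm.
Context {R : realType}.
Implicit Types z w : R[i].

Lemma normc_ge0 z : 0 <= normc z.
Proof. by case: z => a b; exact: sqrtr_ge0. Qed.

Lemma normcM z w : normc (z * w) = normc z * normc w.
Proof. exact: ComplexField.Normc.normcM. Qed.

Lemma normcD z w : normc (z + w) <= normc z + normc w.
Proof. exact: le_normcD. Qed.

Lemma normcN z : normc (- z) = normc z.
Proof. by case: z => a b; rewrite /= !sqrrN. Qed.

Lemma normcB z w : normc (z - w) <= normc z + normc w.
Proof. by rewrite -(normcN w) normcD. Qed.

Lemma normc_distC z w : normc (z - w) = normc (w - z).
Proof. by rewrite -normcN opprB. Qed.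

Lemma normc0 : normc (0 : R[i]) = 0.
Proof. exact: ComplexField.Normc.normc0. Qed.

Lemma normc1 : normc (1 : R[i]) = 1.
Proof. exact: ComplexField.Normc.normc1. Qed.

Lemma normc_eq0 z : normc z = 0 -> z = 0.
Proof. exact: ComplexField.Normc.eq0_normc. Qed.

Lemma sqr_normc_ReIm z : normc z ^+ 2 = complex.Re z ^+ 2 + complex.Im z ^+ 2.
Proof. by case: z => a b /=; rewrite sqr_sqrtr ?addr_ge0 ?sqr_ge0. Qed.

Lemma ler_Re_normc z : `|complex.Re z| <= normc z.
Proof.
rewrite -(@ler_pXn2r _ 2) ?nnegrE ?normc_ge0// sqr_normc_ReIm real_normK ?num_real//.
by rewrite lerDl sqr_ge0.
Qed.

Lemma ler_Im_normc z : `|complex.Im z| <= normc z.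
Proof.
rewrite -(@ler_pXn2r _ 2) ?nnegrE ?normc_ge0// sqr_normc_ReIm real_normK ?num_real//.
by rewrite lerDr sqr_ge0.
Qed.

Lemma ler_normc_ReIm z : normc z <= `|complex.Re z| + `|complex.Im z|.
Proof.
rewrite -(@ler_pXn2r _ 2) ?nnegrE ?normc_ge0 ?addr_ge0// sqr_normc_ReIm.
rewrite -(real_normK (num_real (complex.Re z))) -(real_normK (num_real (complex.Im z))).
by have := normr_ge0 (complex.Re z); have := normr_ge0 (complex.Im z); nra.
Qed.

Lemma normc_real (c : R) : normc (real_complex R c) = `|c|.
Proof. by rewrite /= expr0n addr0 sqrtr_sqr. Qed.

Lemma normc_cis t : normc (@cis R t) = 1.
Proof. by rewrite /= cos2Dsin2 sqrtr1. Qed.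

Lemma normc_sum (I : Type) (r : seq I) (P : pred I) (F : I -> R[i]) :
  normc (\sum_(i <- r | P i) F i) <= \sum_(i <- r | P i) normc (F i).
Proof.
elim/big_ind2 : _ => [|x a y b xa yb|//]; first by rewrite normc0.
by rewrite (le_trans (normcD _ _))// lerD.
Qed.

Lemma cisD (s t : R) : cis (s + t) = cis s * cis t.
Proof. by rewrite /cis cosD sinD; apply/eqP; rewrite eq_complex/= eqxx/= addrC. Qed.

Lemma cis0 : cis (0 : R) = 1.
Proof. by rewrite /cis cos0 sin0. Qed.

Lemma ReD z w : complex.Re (z + w) = complex.Re z + complex.Re w.
Proof. by case: z; case: w. Qed.

Lemma ImD z w : complex.Im (z + w) = complex.Im z + complex.Im w.
Proof. by case: z; case: w. Qed.

Lemma ReM z w : complex.Re (z * w) =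
  complex.Re z * complex.Re w - complex.Im z * complex.Im w.
Proof. by case: z; case: w. Qed.

Lemma ImM z w : complex.Im (z * w) =
  complex.Re z * complex.Im w + complex.Im z * complex.Re w.
Proof. by case: z; case: w. Qed.

Lemma ReN z : complex.Re (- z) = - complex.Re z.
Proof. by case: z. Qed.

Lemma ImN z : complex.Im (- z) = - complex.Im z.
Proof. by case: z. Qed.

Lemma ReJ z : complex.Re (z^*)%C = complex.Re z.
Proof. by case: z. Qed.

Lemma ImJ z : complex.Im (z^*)%C = - complex.Im z.
Proof. by case: z. Qed.

Lemma complexE z w : complex.Re z = complex.Re w -> complex.Im z = complex.Im w -> z = w.
Proof. by case: z => a b; case: w => c d /= -> ->. Qed.

End ComplexNorm.

(** * Linear maps, coordinates and weights *)

Section LinearMaps.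
Context {R : realType} {V W : lmodType R} (L : V -> W) (lL : linear L).

Lemma lin0 : L 0 = 0.
Proof.
have := lL 1 0 0; rewrite !scale1r addr0 => /(congr1 (fun u => u - L 0)).
by rewrite addrK subrr => <-.
Qed.

Lemma linD x y : L (x + y) = L x + L y.
Proof. by have := lL 1 x y; rewrite !scale1r. Qed.

Lemma linZ c x : L (c *: x) = c *: L x.
Proof. by have := lL c x 0; rewrite !addr0 lin0 addr0. Qed.

Lemma lin_shift (x : V) (t : R) (v : V) : L (x + t *: v) = L x + t *: L v.
Proof. by rewrite linD linZ. Qed.

End LinearMaps.

Lemma form_shift {R : realType} (V : lmodType R) (l : V -> R) (x : V) (t : R) (v : V) :
  linear (l : V -> R^o) -> l (x + t *: v) = l x + t * l v.
Proof. by move=> ll; exact: (lin_shift ll). Qed.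

Section Coordinates.
Context {R : realType}.
Implicit Types V W : vectType R.

Definition nrm {V} (x : V) : R := \sum_(i < \dim {:V}) `|coord ebasis i x|.

(** The Japanese bracket up to constants. This form is exactly submultiplicative
  under addition of vectors, and needs no square root. *)
Definition jb {V} (x : V) : R := 1 + nrm x.

Lemma nrm_ge0 V (x : V) : 0 <= nrm x.
Proof. exact: sumr_ge0. Qed.

Lemma nrm0 V : nrm (0 : V) = 0.
Proof. by rewrite /nrm big1// => i _; rewrite linear0 normr0. Qed.

Lemma nrmD V (x y : V) : nrm (x + y) <= nrm x + nrm y.
Proof. by rewrite /nrm -big_split; apply: ler_sum => i _; rewrite linearD ler_normD. Qed.

Lemma nrmZ V (c : R) (x : V) : nrm (c *: x) = `|c| * nrm x.
Proof. by rewrite /nrm mulr_sumr; apply: eq_bigr => i _; rewrite linearZ normrM. Qed.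

Lemma nrmN V (x : V) : nrm (- x) = nrm x.
Proof. by rewrite -scaleN1r nrmZ normrN1 mul1r. Qed.

Lemma nrm_distC V (x y : V) : nrm (x - y) = nrm (y - x).
Proof. by rewrite -nrmN opprB. Qed.

Lemma coord_le_nrm V (x : V) i : `|coord ebasis i x| <= nrm x.
Proof. by rewrite /nrm (bigD1 i)//= lerDl sumr_ge0. Qed.

Lemma nrm_sum V (I : Type) (r : seq I) (P : pred I) (F : I -> V) :
  nrm (\sum_(i <- r | P i) F i) <= \sum_(i <- r | P i) nrm (F i).
Proof.
elim/big_ind2 : _ => [|x a y b xa yb|//]; first by rewrite nrm0.
by rewrite (le_trans (nrmD _ _))// lerD.
Qed.

Lemma ebasis_sum V (x : V) : x = \sum_(i < \dim {:V}) coord ebasis i x *: ebasis`_i.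
Proof. by apply: coord_vbasis; rewrite memvf. Qed.

Lemma jb_ge1 V (x : V) : 1 <= jb x.
Proof. by rewrite lerDl nrm_ge0. Qed.

Lemma jb_gt0 V (x : V) : 0 < jb x.
Proof. by rewrite (lt_le_trans ltr01)// jb_ge1. Qed.

Lemma jb_ge0 V (x : V) : 0 <= jb x.
Proof. exact: ltW (jb_gt0 x). Qed.

Lemma jb_neq0 V (x : V) : jb x != 0.
Proof. exact: lt0r_neq0 (jb_gt0 x). Qed.

Lemma jbD V (x y : V) : jb (x + y) <= jb x * jb y.
Proof.
rewrite /jb; have := nrmD x y; have := nrm_ge0 x; have := nrm_ge0 y.
by nra.
Qed.

Lemma jbN V (x : V) : jb (- x) = jb x.
Proof. by rewrite /jb nrmN. Qed.

Lemma jbB V (x y : V) : jb (x - y) <= jb x * jb y.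
Proof. by rewrite -(jbN y) jbD. Qed.

Lemma jb_distC V (x y : V) : jb (x - y) = jb (y - x).
Proof. by rewrite /jb nrm_distC. Qed.

Lemma jbX_ge1 V (x : V) k : 1 <= jb x ^+ k.
Proof. exact: exprn_ege1 (jb_ge1 x). Qed.

Lemma jbX_ge0 V (x : V) k : 0 <= jb x ^+ k.
Proof. by rewrite exprn_ge0// jb_ge0. Qed.

Lemma jbX_gt0 V (x : V) k : 0 < jb x ^+ k.
Proof. by rewrite exprn_gt0// jb_gt0. Qed.

Lemma jbX_le V (x : V) k l : (k <= l)%N -> jb x ^+ k <= jb x ^+ l.
Proof. by move=> kl; rewrite ler_weXn2l// jb_ge1. Qed.

(** Any triangle-inequality bound on a vector only needs the basis vectors;
  this covers linear maps and arbitrary norms at once. *)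
Lemma sublinear_nrm V (N : V -> R) : N 0 = 0 ->
  (forall x y, N (x + y) <= N x + N y) ->
  (forall c x, N (c *: x) <= `|c| * N x) ->
  exists2 C, 0 <= C & forall x, N x <= C * nrm x.
Proof.
move=> N0 ND NZ; exists (\sum_(i < \dim {:V}) `|N ebasis`_i|).
  exact: sumr_ge0.
move=> x; rewrite {1}(ebasis_sum x) /nrm mulr_sumr.
apply: (@le_trans _ _ (\sum_i N (coord ebasis i x *: ebasis`_i))).
  by elim/big_ind2 : _ => [|u a w b ua wb|//]; [rewrite N0|rewrite (le_trans (ND _ _))// lerD].
apply: ler_sum => i _; rewrite (le_trans (NZ _ _))// mulrC ler_wpM2r//.
by rewrite (le_trans (ler_norm _))// (bigD1 i)//= lerDl sumr_ge0.
Qed.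

Lemma linear_nrm V W (L : V -> W) : linear L ->
  exists2 C, 0 <= C & forall x, nrm (L x) <= C * nrm x.
Proof.
move=> lL; apply: (sublinear_nrm (N := fun x => nrm (L x))) => [|x y|c x].
- by rewrite (lin0 lL) nrm0.
- by rewrite (linD lL) nrmD.
- by rewrite (linZ lL) nrmZ.
Qed.

Lemma linear_form_nrm V (l : V -> R) : linear (l : V -> R^o) ->
  exists2 C, 0 <= C & forall x, `|l x| <= C * nrm x.
Proof.
move=> ll; apply: (sublinear_nrm (N := fun x => `|l x|)) => [|x y|c x].
- by rewrite (lin0 ll) normr0.
- by rewrite (linD ll) ler_normD.
- by rewrite (linZ ll) normrM.
Qed.

Lemma jb_le V W (x : V) (y : W) (C : R) : 0 <= C -> nrm x <= C * nrm y ->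
  jb x <= (1 + C) * jb y.
Proof. by move=> C0 xy; rewrite /jb; have := nrm_ge0 y; nra. Qed.

End Coordinates.

(** * Directional derivatives *)

Section DirectionalDerivative.
Context {R : realType} {V : vectType R}.
Implicit Types (f g : V -> R[i]) (v x : V).

(** As a relation, so that existence and value of the derivative travel together
  and no smoothness has to be assumed before it is proved. *)
Definition isD v f g := forall x,
  is_derive (0 : R) (1 : R) (fun t : R => complex.Re (f (x + t *: v))) (complex.Re (g x)) /\
  is_derive (0 : R) (1 : R) (fun t : R => complex.Im (f (x + t *: v))) (complex.Im (g x)).

Lemma isD_dderive v f g : isD v f g -> dderive v f = g.
Proof.
move=> fg; apply/funext => x; have [fr fi] := fg x.
by apply: complexE; rewrite /= derive1E derive_val.
Qed.

Lemma isD_dderivable v f g x : isD v f g -> dderivable v f x.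
Proof. by move=> fg; have [fr fi] := fg x; split; exact: ex_derive. Qed.

Lemma isD_uniq v f g h : isD v f g -> isD v f h -> g = h.
Proof. by move=> /isD_dderive <- /isD_dderive <-. Qed.

Lemma dderivable_isD v f : (forall x, dderivable v f x) -> isD v f (dderive v f).
Proof. by move=> df x; have [fr fi] := df x; split; rewrite /= derive1E; exact: derivableP. Qed.

Lemma eq_is_derive (h k : R -> R) (t a b : R) : h = k -> a = b -> is_derive t 1 h a -> is_derive t 1 k b.
Proof. by move=> -> ->. Qed.

Lemma isDC v (c : R[i]) : isD v (fun=> c) (fun=> 0).
Proof. by move=> x; split; exact: is_derive_cst. Qed.

Lemma isDD v f f' g g' : isD v f f' -> isD v g g' ->
  isD v (fun x => f x + g x) (fun x => f' x + g' x).
Proof.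
move=> ff gg x; have [fr fi] := ff x; have [gr gi] := gg x; split.
- by apply: eq_is_derive (is_deriveD fr gr); rewrite ?ReD//; apply/funext => t /=; rewrite ReD.
- by apply: eq_is_derive (is_deriveD fi gi); rewrite ?ImD//; apply/funext => t /=; rewrite ImD.
Qed.

Lemma isDM v f f' g g' : isD v f f' -> isD v g g' ->
  isD v (fun x => f x * g x) (fun x => f' x * g x + f x * g' x).
Proof.
move=> ff gg x; have [fr fi] := ff x; have [gr gi] := gg x; split.
- apply: eq_is_derive (is_deriveB (is_deriveM fr gr) (is_deriveM fi gi)).
    by apply/funext => t /=; rewrite ReM.
  by rewrite !scale0r !addr0 !ReD !ReM /GRing.scale/=; ring.
- apply: eq_is_derive (is_deriveD (is_deriveM fr gi) (is_deriveM fi gr)).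
    by apply/funext => t /=; rewrite ImM.
  by rewrite !scale0r !addr0 !ImD !ImM /GRing.scale/=; ring.
Qed.

Lemma isDZ v (c : R[i]) f f' : isD v f f' -> isD v (fun x => c * f x) (fun x => c * f' x).
Proof.
move=> ff; have := isDM (isDC v c) ff.
by congr isD; apply/funext => x; rewrite mul0r add0r.
Qed.

Lemma isDN v f f' : isD v f f' -> isD v (fun x => - f x) (fun x => - f' x).
Proof.
move=> /(@isDZ _ (-1)); congr isD; apply/funext => x; by rewrite mulN1r.
Qed.

Lemma isDB v f f' g g' : isD v f f' -> isD v g g' ->
  isD v (fun x => f x - g x) (fun x => f' x - g' x).
Proof. by move=> ff gg; exact: isDD ff (isDN gg). Qed.

Lemma isD_sum v (I : Type) (r : seq I) (F G : I -> V -> R[i]) :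
  (forall i, isD v (F i) (G i)) ->
  isD v (fun x => \sum_(i <- r) F i x) (fun x => \sum_(i <- r) G i x).
Proof.
move=> FG; elim: r => [|i r IH].
  by have := isDC v 0; congr isD; apply/funext => x; rewrite big_nil.
by have := isDD (FG i) IH; congr isD; apply/funext => x; rewrite big_cons.
Qed.

Lemma isD_conj v f g : isD v f g -> isD v (fun x => (f x)^*)%C (fun x => (g x)^*)%C.
Proof.
move=> fg x; have [fr fi] := fg x; split.
  by apply: eq_is_derive fr; [apply/funext => t|]; rewrite ReJ.
by apply: eq_is_derive (is_deriveN fi); [apply/funext => t|]; rewrite /= ImJ.
Qed.

(** The mean value theorem needs the derivative at every point of a line. *)
Lemma isD_line v f g x (t : R) : isD v f g ->
  is_derive t 1 (fun s : R => complex.Re (f (x + s *: v))) (complex.Re (g (x + t *: v))) /\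
  is_derive t 1 (fun s : R => complex.Im (f (x + s *: v))) (complex.Im (g (x + t *: v))).
Proof.
move=> /(_ (x + t *: v))[fr fi].
have H (h : V -> R) d : is_derive (0:R) (1:R) (fun s : R => h (x + t *: v + s *: v)) d ->
    is_derive t (1:R) (fun s : R => h (x + s *: v)) d.
  move=> hd; have sh : is_derive t (1 : R) (fun s : R => s - t) 1.
    by apply: eq_is_derive (is_deriveB (is_derive_id t 1) (is_derive_cst t t 1)); rewrite ?subr0.
  have hd' : is_derive (t - t) (1:R) (fun s : R => h (x + t *: v + s *: v)) d by rewrite subrr.
  have := @is_derive1_comp _ _ (fun s : R => s - t) t d 1 hd' sh.
  rewrite mulr1; apply: eq_is_derive => //.
  by apply/funext => s /=; rewrite -addrA -scalerDl [t + _]addrC subrK.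
by split; [exact: (H (fun y => complex.Re (f y)) _ fr)|exact: (H (fun y => complex.Im (f y)) _ fi)].
Qed.

(** Mean value inequality; comparing with the constant slope [c] makes it serve
  both for increments and for first order Taylor expansions. *)
Lemma isD_slope v f g x (h B : R) (c : R[i]) : isD v f g ->
  (forall s, `|s| <= `|h| -> normc (g (x + s *: v) - c) <= B) ->
  normc (f (x + h *: v) - f x - real_complex R h * c) <= 2 * B * `|h|.
Proof.
move=> fg gB.
have key (p q : R -> R) (d : R) : (forall t : R, is_derive t (1:R) p (q t)) ->
    (forall s, `|s| <= `|h| -> `|q s - d| <= B) -> `|p h - p 0 - h * d| <= B * `|h|.
  move=> pq qB; pose P t := p t - t * d.
  have PQ (t : R) : is_derive t (1:R) P (q t - d).
    by apply: eq_is_derive (is_deriveB (pq t) (is_deriveM (is_derive_id t 1) (is_derive_cst d t 1)));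
      rewrite // scaler0 add0r /GRing.scale/= mulr1.
  have cp (a b : R) : {within `[a, b], continuous P}.
    apply: continuous_subspaceT => t; apply/differentiable_continuous/derivable1_diffP.
    by have [] := PQ t.
  have -> : p h - p 0 - h * d = P h - P 0 by rewrite /P mul0r subr0 addrAC.
  have [h0|h0] := leP 0 h.
    have [e] := @MVT_segment _ P (fun t => q t - d) 0 h h0 (fun t _ => PQ t) (cp _ _).
    rewrite in_itv/= => /andP[e0 eh] ->.
    by rewrite subr0 normrM ler_wpM2r// qB// (ger0_norm e0) (ger0_norm h0).
  have [e] := @MVT_segment _ P (fun t => q t - d) h 0 (ltW h0) (fun t _ => PQ t) (cp _ _).
  rewrite in_itv/= => /andP[eh e0] E.
  rewrite distrC E sub0r normrM normrN ler_wpM2r// qB//.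
  by rewrite (ler0_norm e0) (ltr0_norm h0) lerN2.
have e0 : f x = f (x + (0 : R) *: v) by rewrite scale0r addr0.
rewrite e0 (le_trans (ler_normc_ReIm _))// !(ReD, ImD, ReN, ImN, ReM, ImM)/=.
rewrite !mul0r subr0 addr0.
have -> : 2 * B * `|h| = B * `|h| + B * `|h| by ring.
apply: lerD.
  apply: (key (fun s : R => complex.Re (f (x + s *: v))) (fun t : R => complex.Re (g (x + t *: v)))).
    by move=> t; exact: (isD_line x t fg).1.
  by move=> s sh; rewrite -ReN -ReD (le_trans (ler_Re_normc _))// gB.
apply: (key (fun s : R => complex.Im (f (x + s *: v))) (fun t : R => complex.Im (g (x + t *: v)))).
  by move=> t; exact: (isD_line x t fg).2.
by move=> s sh; rewrite -ImN -ImD (le_trans (ler_Im_normc _))// gB.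
Qed.

Lemma isD_incr v f g x (h B : R) : isD v f g ->
  (forall s, `|s| <= `|h| -> normc (g (x + s *: v)) <= B) ->
  normc (f (x + h *: v) - f x) <= 2 * B * `|h|.
Proof.
move=> fg gB; have := @isD_slope v f g x h B 0 fg; rewrite mulr0 subr0; apply.
by move=> s sh; rewrite subr0 gB.
Qed.

Lemma isD_taylor v f g g2 x (h B : R) : isD v f g -> isD v g g2 ->
  (forall s, `|s| <= `|h| -> normc (g2 (x + s *: v)) <= B) ->
  normc (f (x + h *: v) - f x - real_complex R h * g x) <= 4 * B * h ^+ 2.
Proof.
move=> fg gg2 gB; have B0 : 0 <= B.
  by rewrite (le_trans (normc_ge0 _) (gB 0 _))// normr0.
have -> : 4 * B * h ^+ 2 = 2 * (2 * B * `|h|) * `|h|.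
  by rewrite -(real_normK (num_real h)); ring.
apply: isD_slope fg _ => s sh; apply: (le_trans (isD_incr gg2 (h := s) (B := B) _)).
  by move=> t ts; rewrite gB// (le_trans ts).
by rewrite ler_wpM2l// mulr_ge0.
Qed.

Lemma is_derive_quad (p : R -> R) (d C : R) :
  (forall h : R, `|h| <= 1 -> `|p h - p 0 - h * d| <= C * h ^+ 2) ->
  is_derive (0:R) (1:R) p d.
Proof.
move=> pd.
  have cv : (fun h : R => h^-1 *: ((p \o shift 0) (h *: (1 : R)) - p 0)) @ (0 : R)^' --> d.
    apply/cvgrPdist_le => e e0.
    have C1 : 0 < `|C| + 1 by rewrite ltr_wpDl.
    near=> h.
    have h0 : h != 0 by near: h; exact: nbhs_dnbhs_neq.
    have h1 : `|h| <= 1 by near: h; apply: dnbhs0_le.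
    have he : `|h| <= e / (`|C| + 1) by near: h; apply: dnbhs0_le; rewrite divr_gt0.
    rewrite /= addr0 /GRing.scale/= mulr1 distrC.
    have -> : h^-1 * (p h - p 0) - d = h^-1 * (p h - p 0 - h * d) by field.
    rewrite normrM normfV ler_pdivrMl ?normr_gt0// (le_trans (pd _ h1))//.
    rewrite -(real_normK (num_real h)) expr2 mulrCA ler_wpM2l//.
    rewrite (@le_trans _ _ ((`|C| + 1) * `|h|))//.
      by rewrite ler_wpM2r// (le_trans (ler_norm _))// lerDl.
    by rewrite -ler_pdivlMl// mulrC.
  apply: DeriveDef; first by apply/cvg_ex; exists d.
  by apply: cvg_lim.
Unshelve. all: by end_near. Qed.

(** Derivatives of integrals, of limits and of combinations of partial
  derivatives are obtained from a remainder estimate, which passes through all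
  these operations, rather than from convergence of quotients. *)
Lemma isD_quad v f g :
  (forall x, exists C : R, forall h : R, `|h| <= 1 ->
     normc (f (x + h *: v) - f x - real_complex R h * g x) <= C * h ^+ 2) ->
  isD v f g.
Proof.
move=> H x; have [C HC] := H x.
split; apply: (is_derive_quad (C := C)) => h h1; rewrite scale0r addr0; have := HC h h1; apply: le_trans.
  by apply: le_trans (ler_Re_normc _); rewrite !(ReD, ReN, ReM)/= mul0r subr0.
by apply: le_trans (ler_Im_normc _); rewrite !(ImD, ImN, ImM)/= mul0r addr0.
Qed.

Lemma isD_cis (Q Q1 Q2 : V -> R) v :
  (forall x (t : R), Q (x + t *: v) = Q x + t * Q1 x + t ^+ 2 * Q2 x) ->
  isD v (fun x => cis (Q x)) (fun x => Complex 0 (Q1 x) * cis (Q x)).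
Proof.
move=> HQ x.
have dQ : is_derive (0:R) (1:R) (fun t : R => Q (x + t *: v)) (Q1 x).
  apply: (is_derive_quad (C := `|Q2 x|)) => h _; rewrite scale0r addr0 HQ.
  have -> : Q x + h * Q1 x + h ^+ 2 * Q2 x - Q x - h * Q1 x = h ^+ 2 * Q2 x by ring.
  by rewrite normrM (ger0_norm (sqr_ge0 _)) mulrC.
have E : Q (x + (0 : R) *: v) = Q x by rewrite scale0r addr0.
have dc : is_derive (Q (x + (0 : R) *: v)) (1:R) (@cos R) (- sin (Q x)).
  by rewrite E; exact: is_derive_cos.
have ds : is_derive (Q (x + (0 : R) *: v)) (1:R) (@sin R) (cos (Q x)).
  by rewrite E; exact: is_derive_sin.
split.
  apply: eq_is_derive (@is_derive1_comp _ (@cos R) (fun t : R => Q (x + t *: v)) 0 _ _ dc dQ) => //.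
  by rewrite ReM/=; ring.
apply: eq_is_derive (@is_derive1_comp _ (@sin R) (fun t : R => Q (x + t *: v)) 0 _ _ ds dQ) => //.
by rewrite ImM/=; ring.
Qed.

Lemma isD_form (l : V -> R) v : linear (l : V -> R^o) ->
  isD v (fun x => real_complex R (l x)) (fun=> real_complex R (l v)).
Proof.
move=> ll; apply: isD_quad => x; exists 0 => h _.
have -> : l (x + h *: v) = l x + h * l v by exact: (lin_shift ll).
have -> : real_complex R (l x + h * l v) - real_complex R (l x) - real_complex R h * real_complex R (l v) = 0.
  by rewrite rmorphD rmorphM; ring.
by rewrite normc0 mul0r.
Qed.

End DirectionalDerivative.

Lemma isD_comp_affine {R : realType} (V W : vectType R) (L : W -> V) (c : V) (w : W) (f g : V -> R[i]) :
  linear L -> isD (L w) f g ->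
  isD w (fun y => f (L y + c)) (fun y => g (L y + c)).
Proof.
move=> lL fg y; have [fr fi] := fg (L y + c).
have e (t : R) : L (y + t *: w) + c = L y + c + t *: L w.
  by rewrite (lin_shift lL) addrAC.
by split; [apply: eq_is_derive fr|apply: eq_is_derive fi] => //; apply/funext => t; rewrite e.
Qed.

(** * Symbol bounds, Schwartz functions and their multipliers *)

Section SymbolBounds.
Context {R : realType} {V : vectType R}.
Implicit Types (f g : V -> R[i]) (w : V -> R) (s : seq V).

(** Existence and size of the derivatives are asserted together. The induction on
  the order keeps the list [s] of directions fixed, and the weight is a function
  rather than a power of [jb] so that products and pullbacks stay exact. *)
Fixpoint Sb (s : seq V) (n : nat) (w : V -> R) (M : R) (f : V -> R[i]) : Prop :=
  (forall x, w x * normc (f x) <= M) /\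
  (if n is n'.+1 then forall v, v \in s -> exists g, isD v f g /\ Sb s n' w M g
   else True).

Lemma Sb_bd s n w M f : Sb s n w M f -> forall x, w x * normc (f x) <= M.
Proof. by case: n => [|n] []. Qed.

Lemma Sb_D s n w M f v : Sb s n.+1 w M f -> v \in s ->
  exists g, isD v f g /\ Sb s n w M g.
Proof. by case=> _; exact. Qed.

Lemma Sb_weaken s n w M f s' n' w' M' (c : R) : {subset s' <= s} -> (n' <= n)%N ->
  0 <= c -> (forall x, w' x <= c * w x) -> c * M <= M' ->
  Sb s n w M f -> Sb s' n' w' M' f.
Proof.
move=> ss nn c0 ww MM.
have bd h : (forall x, w x * normc (h x) <= M) -> forall x, w' x * normc (h x) <= M'.
  move=> hM x; apply: le_trans MM; apply: (@le_trans _ _ (c * w x * normc (h x))).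
    by rewrite ler_wpM2r// normc_ge0.
  by rewrite -mulrA ler_wpM2l.
elim: n' n nn f => [|n' IH] [|n]// nn f; first by case=> /bd.
- by case=> /bd.
- move=> [/bd fM fD]; split=> // v /ss /fD [g [fg gS]].
  by exists g; split=> //; exact: (IH n).
Qed.

Lemma Sb_mono s n w M f n' M' : (n' <= n)%N -> M <= M' -> Sb s n w M f -> Sb s n' w M' f.
Proof.
move=> nn MM; apply: (@Sb_weaken s n w M f s n' w M' 1) => // [x|].
  by rewrite mul1r.
by rewrite mul1r.
Qed.

Lemma Sb_const s n (c : R[i]) : Sb s n (fun=> 1) (normc c) (fun=> c).
Proof.
have H m : Sb s m (fun=> 1) (normc c) (fun=> 0 : R[i]).
  elim: m => [|m IH]; [split=> // x|split=> [x|v _]]; rewrite ?normc0 ?mulr0 ?normc_ge0//.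
  by exists (fun=> 0); split=> //; exact: isDC.
case: n => [|n]; [split=> // x|split=> [x|v _]]; rewrite ?mul1r//.
by exists (fun=> 0); split=> //; exact: isDC.
Qed.

Lemma Sb_0 s n w M : 0 <= M -> Sb s n w M (fun=> 0 : R[i]).
Proof.
move=> M0; elim: n => [|n IH]; [split=> // x|split=> [x|v _]]; rewrite ?normc0 ?mulr0//.
by exists (fun=> 0); split=> //; exact: isDC.
Qed.

Lemma Sb_add s n w M1 M2 f g : (forall x, 0 <= w x) -> Sb s n w M1 f -> Sb s n w M2 g ->
  Sb s n w (M1 + M2) (fun x => f x + g x).
Proof.
move=> w0; elim: n f g => [|n IH] f g [fM fD] [gM gD].
  split=> // x; rewrite (le_trans _ (lerD (fM x) (gM x)))// -mulrDr ler_wpM2l//.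
  exact: normcD.
split=> [x|v vs].
  rewrite (le_trans _ (lerD (fM x) (gM x)))// -mulrDr ler_wpM2l//.
  exact: normcD.
have [f' [ff fS]] := fD v vs; have [g' [gg gS]] := gD v vs.
by exists (fun x => f' x + g' x); split; [exact: isDD|exact: IH].
Qed.

Lemma Sb_scale s n w M f (c : R[i]) : Sb s n w M f ->
  Sb s n w (normc c * M) (fun x => c * f x).
Proof.
elim: n f => [|n IH] f [fM fD].
  by split=> // x; rewrite normcM mulrCA ler_wpM2l// normc_ge0.
split=> [x|v vs]; first by rewrite normcM mulrCA ler_wpM2l// normc_ge0.
have [f' [ff fS]] := fD v vs.
by exists (fun x => c * f' x); split; [exact: isDZ|exact: IH].
Qed.

Lemma Sb_sum s n w (I : Type) (r : seq I) (F : I -> V -> R[i]) (M : I -> R) :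
  (forall x, 0 <= w x) -> (forall i, Sb s n w (M i) (F i)) ->
  Sb s n w (\sum_(i <- r) M i) (fun x => \sum_(i <- r) F i x).
Proof.
move=> w0 FM; elim: r => [|i r IH].
  rewrite big_nil; have -> : (fun x => \sum_(i <- [::]) F i x) = fun=> 0.
    by apply/funext => x; rewrite big_nil.
  exact: Sb_0.
rewrite big_cons; have -> : (fun x => \sum_(i <- i :: r) F i x) =
    (fun x => F i x + \sum_(i <- r) F i x).
  by apply/funext => x; rewrite big_cons.
exact: Sb_add.
Qed.

(** Each differentiation doubles the number of terms in the Leibniz rule. *)
Lemma Sb_mul s n w1 w2 M1 M2 f g : (forall x, 0 <= w1 x) -> (forall x, 0 <= w2 x) ->
  Sb s n w1 M1 f -> Sb s n w2 M2 g ->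
  Sb s n (fun x => w1 x * w2 x) (2 ^+ n * (M1 * M2)) (fun x => f x * g x).
Proof.
move=> w10 w20.
have bd f1 g1 : (forall x, w1 x * normc (f1 x) <= M1) -> (forall x, w2 x * normc (g1 x) <= M2) ->
    forall x, w1 x * w2 x * normc (f1 x * g1 x) <= M1 * M2.
  move=> fM gM x; rewrite normcM mulrACA ler_pM// mulr_ge0// normc_ge0//.
have M1ge f1 : (forall x, w1 x * normc (f1 x) <= M1) -> 0 <= M1.
  by move=> /(_ 0); apply: le_trans; rewrite mulr_ge0// normc_ge0.
have M2ge g1 : (forall x, w2 x * normc (g1 x) <= M2) -> 0 <= M2.
  by move=> /(_ 0); apply: le_trans; rewrite mulr_ge0// normc_ge0.
elim: n f g => [|n IH] f g [fM fD] [gM gD].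
  by rewrite expr0 mul1r; split=> //; exact: bd.
have MM : 0 <= M1 * M2 by rewrite mulr_ge0 ?(M1ge f) ?(M2ge g).
split=> [x|v vs].
  rewrite (le_trans (bd _ _ fM gM x))// ler_peMl// exprn_ege1// (ler1n _ 2)//.
have [f' [ff fS]] := fD v vs; have [g' [gg gS]] := gD v vs.
exists (fun x => f' x * g x + f x * g' x); split; first exact: isDM.
rewrite exprS mulrDl mul1r mulrDl; apply: Sb_add.
- by move=> x; rewrite mulr_ge0.
- by apply: IH => //; apply: (@Sb_mono _ n.+1 _ M2 _ n M2).
- by apply: IH => //; apply: (@Sb_mono _ n.+1 _ M1 _ n M1).
Qed.

Lemma Sb_conj s n w M f : Sb s n w M f -> Sb s n w M (fun x => (f x)^*)%C.
Proof.
have nJ (z : R[i]) : normc (z^*)%C = normc z by case: z => a b; rewrite /= sqrrN.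
elim: n f => [|n IH] f [fM fD]; first by split=> // x; rewrite nJ.
split=> [x|v vs]; first by rewrite nJ.
have [f' [ff fS]] := fD v vs.
by exists (fun x => (f' x)^*)%C; split; [exact: isD_conj|exact: IH].
Qed.

Lemma linear_formP (l : V -> R) : linear (l : V -> R^o) ->
  forall s n, exists M, Sb s n (fun x => jb x ^- 1) M (fun x => real_complex R (l x)).
Proof.
move=> ll s n; have [C C0 lC] := linear_form_nrm ll.
have bd x : jb x ^- 1 * normc (real_complex R (l x)) <= C.
  rewrite normc_real expr1 ler_pdivrMl ?jb_gt0// mulrC (le_trans (lC x))//.
  by rewrite ler_wpM2l// /jb lerDr.
have [M [M0 CM HM]] : exists M, [/\ 0 <= M, C <= M & forall v, v \in s -> `|l v| <= M].
  elim: s => [|v r [M [M0 CM HM]]]; first by exists C.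
  exists (M + `|l v|); split; rewrite ?addr_ge0// ?(le_trans CM)// ?lerDl// => u.
  rewrite inE => /predU1P[->|/HM]; first by rewrite lerDr.
  by move=> /le_trans; apply; rewrite lerDl.
exists M; case: n => [|n]; [split=> // x|split=> [x|v vs]]; rewrite ?(le_trans (bd x))//.
exists (fun=> real_complex R (l v)); split; first exact: isD_form.
apply: (Sb_weaken (c := 1)) (Sb_const s n (real_complex R (l v))) => // [x|].
  by rewrite mulr1 expr1 invf_le1 ?jb_gt0// jb_ge1.
by rewrite mul1r normc_real HM.
Qed.

End SymbolBounds.

Section Pullback.
Context {R : realType}.

Lemma Sb_pull (V W : vectType R) (L : V -> W) (c : W) s n w M f : linear L ->
  Sb (map L s) n w M f -> Sb s n (fun y => w (L y + c)) M (fun y => f (L y + c)).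
Proof.
move=> lL; elim: n f => [|n IH] f [fM fD]; first by split.
split=> // v vs; have [g [fg gS]] := fD _ (map_f L vs).
by exists (fun y => g (L y + c)); split; [exact: isD_comp_affine|exact: IH].
Qed.

Variable V : vectType R.
Implicit Types f g : V -> R[i].

Lemma Sb_shift (c : V) s n w M f : Sb s n w M f ->
  Sb s n (fun x => w (x + c)) M (fun x => f (x + c)).
Proof.
move=> fM; have lid : linear (fun x : V => x) by [].
by apply: (Sb_pull c lid); rewrite map_id.
Qed.

(** The Schwartz space, with arbitrary finite lists of directions in place of a
  basis: linear changes of variables and products need no adjustment. *)
Definition Sch f := forall s n k, exists M, Sb s n (fun x => jb x ^+ k) M f.

(** The multipliers of the Schwartz space. *)
Definition Mod f := forall s n, exists k M, Sb s n (fun x => jb x ^- k) M f.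

Lemma Sch_bd f k : Sch f -> exists M, forall x, jb x ^+ k * normc (f x) <= M.
Proof. by move=> /(_ [::] 0 k)[M [fM _]]; exists M. Qed.

Lemma Sch_D f v : Sch f -> exists g, isD v f g /\ Sch g.
Proof.
move=> fS; have [M /Sb_D/(_ (mem_head v [::]))[g [fg _]]] := fS [:: v] 1%N 0%N.
exists g; split=> // s n k; have [N HN] := fS (v :: s) n.+1 k.
have [h [fh hS]] := Sb_D HN (mem_head v s); rewrite (isD_uniq fg fh).
exists N; move: hS; apply: (Sb_weaken (c := 1)) => // [x xs|x|]; last 2 first.
- by rewrite mul1r.
- by rewrite mul1r.
by rewrite inE xs orbT.
Qed.

Lemma Sch_Mod f : Sch f -> Mod f.
Proof.
move=> fS s n; have [M HM] := fS s n 0%N; exists 0%N, M.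
by move: HM; apply: (Sb_weaken (c := 1)) => // [x|]; rewrite ?mul1r// !expr0 invr1.
Qed.

Lemma Sch_add f g : Sch f -> Sch g -> Sch (fun x => f x + g x).
Proof.
move=> fS gS s n k; have [M HM] := fS s n k; have [N HN] := gS s n k.
by exists (M + N); apply: Sb_add => // x; exact: jbX_ge0.
Qed.

Lemma Sch_scale f c : Sch f -> Sch (fun x => c * f x).
Proof.
by move=> fS s n k; have [M HM] := fS s n k; exists (normc c * M); exact: Sb_scale.
Qed.

Lemma Sch_opp f : Sch f -> Sch (fun x => - f x).
Proof.
move=> /(@Sch_scale _ (-1)); congr Sch; apply/funext => x; by rewrite mulN1r.
Qed.

Lemma Sch_sub f g : Sch f -> Sch g -> Sch (fun x => f x - g x).
Proof. by move=> fS gS; apply: Sch_add => //; exact: Sch_opp. Qed.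

Lemma Sch_0 : Sch (fun=> 0).
Proof. by move=> s n k; exists 0; exact: Sb_0. Qed.

Lemma Sch_sum (I : Type) (r : seq I) (F : I -> V -> R[i]) :
  (forall i, Sch (F i)) -> Sch (fun x => \sum_(i <- r) F i x).
Proof.
move=> FS; elim: r => [|i r IH].
  by have := Sch_0; congr Sch; apply/funext => x; rewrite big_nil.
by have := Sch_add (FS i) IH; congr Sch; apply/funext => x; rewrite big_cons.
Qed.

Lemma Sch_conj f : Sch f -> Sch (fun x => (f x)^*)%C.
Proof. by move=> fS s n k; have [M HM] := fS s n k; exists M; exact: Sb_conj. Qed.

Lemma Mod_mul f g : Mod f -> Mod g -> Mod (fun x => f x * g x).
Proof.
move=> fS gS s n; have [k [M HM]] := fS s n; have [l [N HN]] := gS s n.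
exists (k + l)%N, (2 ^+ n * (M * N)).
have w0 j (x : V) : 0 <= jb x ^- j by rewrite invr_ge0 jbX_ge0.
have := Sb_mul (w0 k) (w0 l) HM HN.
by congr Sb; apply/funext => x; rewrite exprD invfM.
Qed.

Lemma Mod_add f g : Mod f -> Mod g -> Mod (fun x => f x + g x).
Proof.
move=> fS gS s n; have [k [M HM]] := fS s n; have [l [N HN]] := gS s n.
exists (maxn k l), (M + N); apply: Sb_add.
- by move=> x; rewrite invr_ge0 jbX_ge0.
- move: HM; apply: (Sb_weaken (c := 1)) => // [x|]; rewrite mul1r// lef_pV2 ?posrE ?jbX_gt0//.
  by rewrite jbX_le// leq_maxl.
- move: HN; apply: (Sb_weaken (c := 1)) => // [x|]; rewrite mul1r// lef_pV2 ?posrE ?jbX_gt0//.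
  by rewrite jbX_le// leq_maxr.
Qed.

Lemma Mod_const c : Mod (fun=> c).
Proof.
move=> s n; exists 0%N, (normc c); have := Sb_const s n c.
by congr Sb; apply/funext => x; rewrite expr0 invr1.
Qed.

Lemma Mod_form (l : V -> R) : linear (l : V -> R^o) -> Mod (fun x => real_complex R (l x)).
Proof. by move=> ll s n; exists 1%N; exact: linear_formP. Qed.

Lemma Sch_mul_Mod f g : Sch f -> Mod g -> Sch (fun x => f x * g x).
Proof.
move=> fS gS s n k; have [l [N HN]] := gS s n; have [M HM] := fS s n (k + l)%N.
exists (2 ^+ n * (M * N)).
have w0 j (x : V) : 0 <= jb x ^- j by rewrite invr_ge0 jbX_ge0.
have := Sb_mul (fun x => jbX_ge0 x (k + l)) (w0 l) HM HN.
by congr Sb; apply/funext => x; rewrite exprD mulfK// expf_neq0// jb_neq0.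
Qed.

Lemma Sch_mul f g : Sch f -> Sch g -> Sch (fun x => f x * g x).
Proof. by move=> fS /Sch_Mod; exact: Sch_mul_Mod. Qed.

(** Oscillating factors [cis (Q x)] with [Q] quadratic: each derivative brings
  down one affine factor. *)
Lemma Mod_cis (Q : V -> R) (Q1 : V -> V -> R) (Q2 c : V -> R) :
  (forall x v (t : R), Q (x + t *: v) = Q x + t * (Q1 v x + c v) + t ^+ 2 * Q2 v) ->
  (forall v, linear (Q1 v : V -> R^o)) ->
  Mod (fun x => cis (Q x)).
Proof.
move=> HQ lQ s n; exists n.
have [A HA] : exists A, forall v, v \in s ->
    Sb s n (fun x => jb x ^- 1) A (fun x => Complex 0 (Q1 v x + c v)).
  have H1 s' v : exists A, 0 <= A /\ Sb s' n (fun x => jb x ^- 1) A (fun x => Complex 0 (Q1 v x + c v)).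
    have [M HM] := linear_formP (lQ v) s' n.
    have HC := Sb_const s' n (real_complex R (c v)).
    have w0 (x : V) : 0 <= jb x ^- 1 by rewrite invr_ge0 jbX_ge0.
    have HC' : Sb s' n (fun x => jb x ^- 1) (normc (real_complex R (c v))) (fun=> real_complex R (c v)).
      move: HC; apply: (Sb_weaken (c := 1)) => // [x|]; rewrite mul1r// expr1.
      by rewrite invf_le1 ?jb_gt0// jb_ge1.
    have := Sb_scale (Complex 0 1) (Sb_add w0 HM HC') => H.
    exists (normc (Complex (0:R) 1) * (M + normc (real_complex R (c v)))); split.
      apply: mulr_ge0; rewrite ?normc_ge0// addr_ge0 ?normc_ge0//.
      by rewrite (le_trans _ (Sb_bd HM 0))// mulr_ge0// normc_ge0.
    move: H; congr Sb; apply/funext => x; apply: complexE; rewrite !(ReM, ImM)/=; ring.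
  have gen s' (r : seq V) : exists A, forall v, v \in r ->
      Sb s' n (fun x => jb x ^- 1) A (fun x => Complex 0 (Q1 v x + c v)); last exact: gen.
  elim: r => [|v r [A HA]]; first by exists 0.
  have [B [B0 HB]] := H1 s' v.
  exists (`|A| + B) => u; rewrite inE => /predU1P[->|/HA].
    apply: (Sb_weaken (c := 1)) HB => // [x|]; rewrite mul1r//; by rewrite lerDr.
  apply: (Sb_weaken (c := 1)) => // [x|]; rewrite mul1r//.
  by rewrite (le_trans (ler_norm _))// lerDl.
elim: n HA => [|n IH] HA.
  by exists 1; split=> // x; rewrite normc_cis expr0 invr1 mulr1.
have [M HM] : exists M, Sb s n (fun x => jb x ^- n) M (fun x => cis (Q x)).
  by apply: IH => v vs; apply: Sb_mono (HA v vs).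
exists (1 + 2 ^+ n * (`|A| * `|M|)); split.
  move=> x; rewrite normc_cis mulr1 (@le_trans _ _ 1)//.
    by rewrite invf_le1 ?jbX_gt0// jbX_ge1.
  by rewrite lerDl !mulr_ge0// exprn_ge0.
move=> v vs; exists (fun x => Complex 0 (Q1 v x + c v) * cis (Q x)); split.
  by apply: (isD_cis (Q2 := fun=> Q2 v)) => x t; exact: HQ.
have w0 j (x : V) : 0 <= jb x ^- j by rewrite invr_ge0 jbX_ge0.
have HA' : Sb s n (fun x => jb x ^- 1) `|A| (fun x => Complex 0 (Q1 v x + c v)).
  by apply: Sb_mono (HA v vs) => //; exact: ler_norm.
have HM' := Sb_mono (leqnn n) (ler_norm M) HM.
have := Sb_mul (w0 1%N) (w0 n) HA' HM'.
apply: (Sb_weaken (c := 1)) => // [x|]; rewrite mul1r.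
  by rewrite -invfM -exprS.
by rewrite lerDr.
Qed.

End Pullback.

Section Pullback2.
Context {R : realType}.
Implicit Types U V W : vectType R.

Lemma affine_jb U V (L : U -> V) (c : V) : linear L ->
  exists2 C, 0 < C & forall u, jb (L u + c) <= C * jb u.
Proof.
move=> lL; have [C C0 HC] := linear_nrm lL; exists ((1 + C) * jb c).
  by rewrite mulr_gt0 ?jb_gt0// ltr_wpDr.
move=> u; rewrite (le_trans (jbD _ _))// mulrAC ler_wpM2r ?jb_ge0//.
exact: jb_le.
Qed.

Lemma Mod_pull U V (L : U -> V) c f : linear L -> Mod f -> Mod (fun u => f (L u + c)).
Proof.
move=> lL fM s n; have [k [M HM]] := fM (map L s) n.
have [C C0 HC] := affine_jb c lL.
exists k, (C ^+ k * M); move: (Sb_pull c lL HM).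
apply: (Sb_weaken (c := C ^+ k)) => // [|u]; first by rewrite exprn_ge0// ltW.
rewrite -ler_pdivrMl ?exprn_gt0// -invfM -exprMn lef_pV2 ?posrE ?exprn_gt0 ?mulr_gt0 ?jb_gt0//.
by rewrite lerXn2r// ?nnegrE ?mulr_ge0 ?jb_ge0// ltW.
Qed.

(** Each factor may be constant in some directions of [u]; together they decay in
  all of them. *)
Lemma Sch_mul2 U V W (L : U -> V) (c : V) (K : U -> W) (d : W) f g (C : R) :
  linear L -> linear K -> (forall u, jb u <= C * (jb (L u + c) * jb (K u + d))) ->
  Sch f -> Sch g -> Sch (fun u => f (L u + c) * g (K u + d)).
Proof.
move=> lL lK HC fS gS s n k.
have [M HM] := fS (map L s) n k; have [N HN] := gS (map K s) n k.
have C0 : 0 <= C.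
  have := HC 0; have := jb_gt0 (0 : U).
  move=> a /(lt_le_trans a); rewrite pmulr_lgt0 ?mulr_gt0 ?jb_gt0//; exact: ltW.
exists (C ^+ k * (2 ^+ n * (M * N))).
have := Sb_mul (fun u => jbX_ge0 (L u + c) k) (fun u => jbX_ge0 (K u + d) k)
  (Sb_pull c lL HM) (Sb_pull d lK HN).
apply: (Sb_weaken (c := C ^+ k)) => // [|u]; first by rewrite exprn_ge0.
by rewrite -!exprMn lerXn2r// ?nnegrE ?mulr_ge0 ?jb_ge0.
Qed.

Lemma Sch_pull U V (L : U -> V) (c : V) f (C : R) :
  linear L -> (forall u, jb u <= C * jb (L u + c)) ->
  Sch f -> Sch (fun u => f (L u + c)).
Proof.
move=> lL HC fS s n k.
have [M HM] := fS (map L s) n k.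
have C0 : 0 <= C.
  have := HC 0; have := jb_gt0 (0 : U).
  move=> a /(lt_le_trans a); rewrite pmulr_lgt0 ?jb_gt0//; exact: ltW.
exists (C ^+ k * M); move: (Sb_pull c lL HM).
apply: (Sb_weaken (c := C ^+ k)) => // [|u]; first by rewrite exprn_ge0.
by rewrite -!exprMn lerXn2r// ?nnegrE ?mulr_ge0 ?jb_ge0.
Qed.

Lemma Sch_shift V (c : V) f : Sch f -> Sch (fun x => f (x + c)).
Proof.
apply: (@Sch_pull V V id c f (jb c)) => // u.
by rewrite mulrC -{1}(addrK c u) jbB.
Qed.

End Pullback2.

(** * Schwartz seminorms and tempered distributions *)

Section Bridge.
Context {R : realType} {V : vectType R}.
Implicit Types (f g : V -> R[i]) (x v : V).
Local Notation d := (\dim {:V}).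
Local Notation es := (ebasis : seq V).

Lemma mem_ebasis (i : 'I_d) : (ebasis : d.-tuple V)`_i \in es.
Proof. by apply: mem_nth; rewrite size_tuple. Qed.

Lemma ebasisP v : v \in es -> exists i : 'I_d, v = es`_i.
Proof.
move=> /(nthP 0)[k]; rewrite size_tuple => kd <-; by exists (Ordinal kd).
Qed.

Lemma SbS s n (w : V -> R) f : (forall x, 0 <= w x) -> (exists M, forall x, w x * normc (f x) <= M) ->
  (forall v, v \in s -> exists g M, isD v f g /\ Sb s n w M g) ->
  exists M, Sb s n.+1 w M f.
Proof.
move=> w0 [M fM] H.
have [N [MN HN]] : exists N, M <= N /\ forall v, v \in s -> exists g, isD v f g /\ Sb s n w N g.
  have gen (r : seq V) : {subset r <= s} ->
      exists N, M <= N /\ forall v, v \in r -> exists g, isD v f g /\ Sb s n w N g.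
    elim: r => [_|v r IH rs]; first by exists M.
    have [|N [MN HN]] := IH; first by move=> u ur; apply: rs; rewrite inE ur orbT.
    have [g [K [fg gK]]] := H v (rs _ (mem_head _ _)).
    exists (Num.max N K); split; first by rewrite le_max MN.
    move=> u; rewrite inE => /predU1P[->|/HN[g' [fg' gN]]].
      by exists g; split=> //; apply: Sb_mono gK => //; rewrite le_max lexx orbT.
    by exists g'; split=> //; apply: Sb_mono gN => //; rewrite le_max lexx.
  exact: gen.
by exists N; split=> // x; rewrite (le_trans (fM x)).
Qed.

Lemma lip_comb (g : V -> R[i]) (G : 'I_d -> V -> R[i]) (B : R) (c : 'I_d -> R) :
  (forall i : 'I_d, isD es`_i g (G i)) -> (forall i x, normc (G i x) <= B) ->
  forall (r : seq 'I_d) x,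
  normc (g (x + \sum_(i <- r) c i *: es`_i) - g x) <= 2 * B * \sum_(i <- r) `|c i|.
Proof.
move=> gG GB; elim=> [|i r IH] x; first by rewrite !big_nil addr0 subrr normc0 mulr0.
rewrite !big_cons (addrC (c i *: _)) addrA.
set y := x + _; rewrite -(subrK (g y) (g _)) -addrA mulrDr.
rewrite (le_trans (normcD _ _))// lerD ?IH//.
by apply: isD_incr (gG i) _ => s _; exact: GB.
Qed.

(** Only derivatives along a basis are given. Moving along [v] one basis vector
  at a time, the second derivatives bound both the Taylor remainder of each move
  and the change of the slope between moves. *)
Lemma isD_comb (g : V -> R[i]) (G : 'I_d -> V -> R[i]) (H : 'I_d -> 'I_d -> V -> R[i]) (B : R) v :
  (forall i : 'I_d, isD es`_i g (G i)) -> (forall i j : 'I_d, isD es`_j (G i) (H i j)) ->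
  (forall i j x, normc (H i j x) <= B) ->
  isD v g (fun x => \sum_(i < d) real_complex R (coord ebasis i v) * G i x).
Proof.
move=> gG GH HB; pose c i : R := coord ebasis i v.
have key (r : seq 'I_d) : exists C, forall x (h : R),
    normc (g (x + h *: \sum_(i <- r) c i *: es`_i) - g x -
      real_complex R h * \sum_(i <- r) real_complex R (c i) * G i x) <= C * h ^+ 2.
  elim: r => [|i r [C IH]].
    by exists 0 => x h; rewrite !big_nil scaler0 addr0 subrr mulr0 subr0 normc0 mul0r.
  exists (C + 4 * B * c i ^+ 2 + `|c i| * (2 * B * \sum_(j <- r) `|c j|)) => x h.
  rewrite !big_cons scalerDr scalerA [h * c i]mulrC (addrC (_ *: es`_i)) addrA.
  set y := x + h *: _.
  have -> : g (y + (c i * h) *: es`_i) - g x - real_complex R h *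
      (real_complex R (c i) * G i x + \sum_(j <- r) real_complex R (c j) * G j x) =
    (g y - g x - real_complex R h * \sum_(j <- r) real_complex R (c j) * G j x) +
    (g (y + (c i * h) *: es`_i) - g y - real_complex R (c i * h) * G i y) +
    real_complex R (c i * h) * (G i y - G i x).
    by rewrite rmorphM; ring.
  rewrite (le_trans (normcD _ _))// mulrDl lerD//.
    rewrite (le_trans (normcD _ _))// mulrDl lerD//.
      exact: IH.
    have -> : 4 * B * c i ^+ 2 * h ^+ 2 = 4 * B * (c i * h) ^+ 2 by ring.
    apply: (isD_taylor (gG i) (GH i i)) => s _; exact: HB.
  rewrite normcM normc_real normrM.
  have -> : `|c i| * (2 * B * (\sum_(j <- r) `|c j|)) * h ^+ 2 =
     `|c i| * `|h| * (2 * B * \sum_(j <- r) `|h * c j|).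
    under [in RHS]eq_bigr do rewrite normrM.
    by rewrite -mulr_sumr -(real_normK (num_real h)); ring.
  apply: ler_wpM2l; first by rewrite mulr_ge0.
  rewrite /y scaler_sumr; under eq_bigr do rewrite scalerA.
  exact: lip_comb (GH i) (HB i) _ _.
have [C HC] := key (index_enum 'I_d).
apply: isD_quad => x; exists C => h _; rewrite {1}(ebasis_sum v); exact: HC.
Qed.

Lemma pderive_isD f (beta : seq 'I_d) (i : 'I_d) : schwartz f ->
  isD es`_i (pderive beta f) (pderive (i :: beta) f).
Proof. by move=> [fd _]; apply: dderivable_isD => x; exact: fd. Qed.

Lemma schwartz_bd f k (beta : seq 'I_d) : schwartz f ->
  exists M, forall x, jb x ^+ k * normc (pderive beta f x) <= M.
Proof.
move=> [_ fb].
have gen (alpha : seq 'I_d) : exists M, forall x, jb x ^+ k * (`|monomial alpha x| * normc (pderive beta f x)) <= M.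
  elim: k alpha => [|k IH] alpha.
    by have [M HM] := fb alpha beta; exists M => x; rewrite expr0 mul1r; exact: HM.
  have [M HM] := IH alpha.
  have [N HN] := choice (fun i : 'I_d => IH (i :: alpha)).
  exists (M + \sum_i N i) => x.
  rewrite exprS /jb -/(jb x) [_ * jb x ^+ k]mulrDl mul1r mulrDl lerD//.
  rewrite /nrm !mulr_suml; apply: ler_sum => i _.
  apply: le_trans (HN i x).
  rewrite /monomial big_cons normrM [X in X * _]mulrC -mulrA.
  by rewrite ler_wpM2l ?jbX_ge0// mulrA.
have [M HM] := gen [::]; exists M => x; have := HM x.
by rewrite /monomial big_nil normr1 mul1r.
Qed.

Lemma schwartz_Sch f : schwartz f -> Sch f.
Proof.
move=> fS; have gen n s k beta : exists M, Sb s n (fun x => jb x ^+ k) M (pderive beta f).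
  elim: n beta => [|n IH] beta; first by have [M HM] := schwartz_bd k beta fS; exists M.
  apply: SbS; [by move=> x; exact: jbX_ge0|exact: schwartz_bd|move=> v vs].
  have [M HM] := choice (fun i : 'I_d => IH (i :: beta)).
  have [B HB] : exists B, forall (i j : 'I_d) x, normc (pderive [:: j, i & beta] f x) <= B.
    have H (i j : 'I_d) := schwartz_bd 0 [:: j, i & beta] fS.
    have [N HN] := choice (fun ij : 'I_d * 'I_d => H ij.1 ij.2).
    exists (\sum_ij `|N ij|) => i j x; have := HN (i, j) x; rewrite expr0 mul1r => /le_trans; apply.
    by rewrite (le_trans (ler_norm _))// (bigD1 (i, j))//= lerDl sumr_ge0.
  exists (fun x => \sum_(i < d) real_complex R (coord ebasis i v) * pderive (i :: beta) f x).
  exists (\sum_(i < d) normc (real_complex R (coord ebasis i v)) * M i); split.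
    apply: (@isD_comb _ (fun i => pderive (i :: beta) f)
      (fun i j => pderive [:: j, i & beta] f) B).
    - by move=> i; exact: (pderive_isD beta i fS).
    - by move=> i j; exact: (pderive_isD (i :: beta) j fS).
    - exact: HB.
  apply: Sb_sum => [x|i]; first exact: jbX_ge0.
  exact: Sb_scale.
by move=> s n k; exact: (gen n s k [::]).
Qed.

Lemma monomial_jb (alpha : seq 'I_d) x k : (size alpha <= k)%N -> `|monomial alpha x| <= jb x ^+ k.
Proof.
move=> ak; rewrite (le_trans _ (jbX_le x ak))//.
elim: alpha {ak} => [|i a IH]; first by rewrite /monomial big_nil normr1.
rewrite /monomial big_cons normrM exprS ler_pM//.
by rewrite (le_trans (coord_le_nrm x i))// lerDr.
Qed.

Lemma Sb_pderive s n w M f (beta : seq 'I_d) : {subset es <= s} ->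
  Sb s (n + size beta) w M f -> Sb s n w M (pderive beta f).
Proof.
move=> ss; elim: beta n => [|i beta IH] n /=; first by rewrite addn0.
rewrite addnS -addSn => /IH /Sb_D/(_ (ss _ (mem_ebasis i)))[g [fg gS]].
by rewrite (isD_dderive fg).
Qed.

Lemma Sb_seminorm k M f (alpha beta : seq 'I_d) :
  Sb es k (fun x => jb x ^+ k) M f -> (size alpha <= k)%N -> (size beta <= k)%N ->
  seminorm_le alpha beta f M.
Proof.
move=> fS ak bk x.
have /Sb_pderive H : Sb es (0 + size beta) (fun x => jb x ^+ k) M f by apply: Sb_mono fS.
rewrite (le_trans _ (Sb_bd (H (fun _ => id)) x))//.
by rewrite ler_wpM2r ?normc_ge0// monomial_jb.
Qed.

Lemma Sch_pderive f (beta : seq 'I_d) : Sch f -> Sch (pderive beta f).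
Proof.
move=> fS; elim: beta => [|i beta IH] //=.
by have [g [fg gS]] := Sch_D es`_i IH; rewrite (isD_dderive fg).
Qed.

(** Together with [schwartz_Sch]: the seminorms built from monomials and basis
  derivatives define the same space as the symbol bounds. *)
Lemma Sch_schwartz f : Sch f -> schwartz f.
Proof.
move=> fS; split=> [beta i x|alpha beta].
  by have [g [fg _]] := Sch_D es`_i (Sch_pderive beta fS); exact: isD_dderivable fg.
pose k := maxn (size alpha) (size beta).
have [M HM] := fS es k k; exists M; apply: Sb_seminorm HM _ _; rewrite /k.
  exact: leq_maxl.
exact: leq_maxr.
Qed.

(** The ball of radius [M] of the [k]-th Schwartz seminorm. *)
Definition qb k (M : R) f := Sb es k (fun x => jb x ^+ k) M f.

Lemma qb_ge0 k M f : qb k M f -> 0 <= M.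
Proof. by move=> /Sb_bd/(_ 0); apply: le_trans; rewrite mulr_ge0 ?jbX_ge0 ?normc_ge0. Qed.

Section Tempered.
Variable T : (V -> R[i]) -> R[i].
Hypothesis hT : tempered T.

Lemma tempered_lin (c : R[i]) f g : Sch f -> Sch g ->
  T (fun x => c * f x + g x) = c * T f + T g.
Proof. by case: hT => lT _ _ /Sch_schwartz fS /Sch_schwartz gS; exact: lT. Qed.

Lemma tempered_add f g : Sch f -> Sch g -> T (fun x => f x + g x) = T f + T g.
Proof.
move=> fS gS; rewrite -(mul1r (T f)) -tempered_lin//; congr T.
by apply/funext => x; rewrite mul1r.
Qed.

Lemma tempered0 : T (fun=> 0) = 0.
Proof.
have := tempered_add (@Sch_0 _ V) (@Sch_0 _ V); rewrite addr0 => /(congr1 (fun u => u - T (fun=> 0))).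
by rewrite addrK subrr => <-.
Qed.

Lemma tempered_scale (c : R[i]) f : Sch f -> T (fun x => c * f x) = c * T f.
Proof.
move=> fS; rewrite -[RHS]addr0 -tempered0 -tempered_lin//; last exact: Sch_0.
by congr T; apply/funext => x; rewrite addr0.
Qed.

Lemma tempered_sub f g : Sch f -> Sch g -> T (fun x => f x - g x) = T f - T g.
Proof.
move=> fS gS; rewrite tempered_add//; last exact: Sch_opp.
rewrite -mulN1r -tempered_scale//; congr (_ + T _).
by apply/funext => x; rewrite mulN1r.
Qed.

Lemma tempered_sum (I : Type) (r : seq I) (F : I -> V -> R[i]) : (forall i, Sch (F i)) ->
  T (fun x => \sum_(i <- r) F i x) = \sum_(i <- r) T (F i).
Proof.
move=> FS; elim: r => [|i r IH].
  by rewrite big_nil -[RHS]tempered0; congr T; apply/funext => x; rewrite big_nil.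
rewrite big_cons -IH -tempered_add//; last exact: Sch_sum.
by congr T; apply/funext => x; rewrite big_cons.
Qed.

(** Continuity in the form in which it is used: one seminorm [qb k] controls the
  distribution. *)
Lemma tempered_bd : exists C k, 0 <= C /\
  forall f M, Sch f -> qb k M f -> normc (T f) <= C * M.
Proof.
case: hT => _ [C [k HC]] _; exists `|C|, k; split=> // f M fS fM.
rewrite (@le_trans _ _ (C * M))//.
  apply: HC => [|alpha beta ak bk]; first exact: Sch_schwartz.
  exact: Sb_seminorm fM ak bk.
by rewrite ler_wpM2r ?ler_norm// (qb_ge0 fM).
Qed.

End Tempered.

End Bridge.

(** * Integration over the line *)

Section OneVariable.
Context {R : realType}.
Local Notation mu := (@lebesgue_measure R).
Implicit Types (g h : R -> R) (a c s t C : R).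

(** The model of integrable decay, chosen because its integral over segments is
  explicit. *)
Definition w1 t : R := (1 + t ^+ 2)^-1.

Definition int1 g : R := \int[mu]_(t in [set: R]) g t.

Lemma w1_gt0 t : 0 < w1 t.
Proof. by rewrite invr_gt0 ltr_wpDr// sqr_ge0. Qed.

Lemma w1_ge0 t : 0 <= w1 t.
Proof. exact: ltW (w1_gt0 t). Qed.

Lemma w1_le1 t : w1 t <= 1.
Proof. by rewrite invf_le1 ?lerDl ?sqr_ge0// ltr_wpDr// sqr_ge0. Qed.

Lemma cont_w1 : continuous w1.
Proof. exact: continuous_oneDsqrV. Qed.

Lemma cont_aff c s : continuous (fun t : R => c * t + s).
Proof.
move=> t; apply: cvgD; last exact: cvg_cst.
by apply: cvgM; [exact: cvg_cst|exact: cvg_id].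
Qed.

Lemma cont_comp_aff g c s : continuous g -> continuous (fun t : R => g (c * t + s)).
Proof. by move=> cg t; apply: (@continuous_comp _ _ _ (fun t : R => c * t + s) g); [exact: cont_aff|exact: cg]. Qed.

Lemma cont_shift g s : continuous g -> continuous (fun t : R => g (t + s)).
Proof.
move=> cg t; apply: (@continuous_comp _ _ _ (fun t : R => t + s) g); last exact: cg.
by apply: cvgD; [exact: cvg_id|exact: cvg_cst].
Qed.

Lemma measurable_cont g : continuous g -> measurable_fun [set: R] g.
Proof. exact: continuous_measurable_fun. Qed.

Lemma int_w1 : (\int[mu]_(t in [set: R]) (w1 t)%:E = pi%:E)%E.
Proof.
have mw : measurable_fun [set: R] (fun t : R => (w1 t)%:E).
  by apply/measurable_EFinP; apply: measurable_cont; exact: cont_w1.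
rewrite -(setUv (`[0%R, +oo[)%classic) ge0_integral_setU//=; last 4 first.
- exact: measurableC.
- by rewrite setUv.
- by move=> t _; rewrite lee_fin w1_ge0.
- by apply/disj_setPS; rewrite setICr.
rewrite integral0y_oneDsqr setCitvr.
rewrite (_ : \int[mu]_(x in `]-oo, 0%R[) (w1 x)%:E = (pi / 2)%:E)%E; last first.
  rewrite integral_itv_bndo_bndc; last exact: measurable_funTS.
  rewrite -integral0y_oneDsqr ge0_integration_by_substitution0//.
  by apply: eq_integral => t _; rewrite /w1 /oneDsqr sqrrN.
by rewrite -EFinD; congr EFin; lra.
Qed.

Lemma ge0_int_affine g c s : 0 < c -> continuous g -> (forall t, 0 <= g t) ->
  (\int[mu]_(t in [set: R]) (g t)%:E = c%:E * \int[mu]_(t in [set: R]) (g (c * t + s))%:E)%E.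
Proof.
move=> c0 cg g0; pose F t := c * t + s.
have dF t : is_derive t (1:R) F c.
  have := is_deriveD (is_deriveM (is_derive_cst c t (1:R)) (is_derive_id t (1:R))) (is_derive_cst s t (1:R)).
  by rewrite scaler0 !addr0 /GRing.scale/= mulr1.
have F' : derive1 F = fun=> c by apply/funext => t; rewrite derive1E; have [_ ->] := dF t.
rewrite (@increasing_ge0_integration_by_substitutionT _ F g)//.
- rewrite F' -ge0_integralZl//=; last 3 first.
  + by apply/measurable_EFinP; apply: measurable_cont; exact: cont_comp_aff.
  + by move=> t _; rewrite lee_fin.
  + by rewrite lee_fin ltW.
  by apply: eq_integral => t _; rewrite -EFinM mulrC.
- by move=> x y xy; rewrite /F ltrD2r ltr_pM2l.
- by rewrite F'; move=> t; exact: cvg_cst.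
- by rewrite F'; exact: is_cvg_cst.
- by rewrite F'; exact: is_cvg_cst.
- apply/cvgrNyPle => A; near=> x; rewrite /F -lerBrDr -ler_pdivlMl//.
- apply/cvgryPge => A; near=> x; rewrite /F -lerBlDr -ler_pdivrMl//.
Unshelve. all: by end_near. Qed.

Lemma integrable_w1a a : mu.-integrable [set: R] (EFin \o (fun t => w1 (t + a))).
Proof.
have c1 : continuous (fun t : R => w1 (t + a)).
  exact: cont_shift cont_w1.
apply/integrableP; split.
  by apply/measurable_EFinP; apply: measurable_cont.
rewrite (_ : \int[mu]_(x in [set: R]) _ = \int[mu]_(t in [set: R]) (w1 t)%:E)%E.
  by rewrite int_w1 ltry.
rewrite (@ge0_int_affine w1 1 a)//; last by move=> t; exact: w1_ge0.
  by rewrite mul1e; apply: eq_integral => t _; rewrite /= ger0_norm ?w1_ge0 ?mul1r.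
exact: cont_w1.
Qed.

Lemma integrable_dec g C a : continuous g -> (forall t, `|g t| <= C * w1 (t + a)) ->
  mu.-integrable [set: R] (EFin \o g).
Proof.
move=> cg gC; have iC : mu.-integrable [set: R] (EFin \o (fun t => C * w1 (t + a))).
  rewrite (_ : _ \o _ = fun t => C%:E * (EFin \o (fun t => w1 (t + a))) t)%E.
    by apply: integrableZl => //; exact: integrable_w1a.
  by apply/funext => t; rewrite /= EFinM.
apply: (le_integrable _ _ _ iC) => //=.
  by apply/measurable_EFinP; exact: measurable_cont.
move=> t _; rewrite lee_fin (le_trans (gC t))// ler_norm//.
Qed.

Lemma int1_w1a a : int1 (fun t => w1 (t + a)) = pi.
Proof.
rewrite /int1 /Rintegral; have := @ge0_int_affine w1 1 a ltr01 cont_w1 w1_ge0.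
rewrite int_w1 mul1e => H.
rewrite (_ : (\int[mu]_x (w1 (x + a))%:E = pi%:E)%E)// H.
by apply: eq_integral => t _; rewrite mul1r.
Qed.

Lemma int1_le g h C D a b : continuous g -> continuous h ->
  (forall t, `|g t| <= C * w1 (t + a)) -> (forall t, `|h t| <= D * w1 (t + b)) ->
  (forall t, g t <= h t) -> int1 g <= int1 h.
Proof.
move=> cg ch gC hD gh; apply: le_Rintegral => //.
  exact: integrable_dec cg gC.
exact: integrable_dec ch hD.
Qed.

Lemma int1D g h C D a b : continuous g -> continuous h ->
  (forall t, `|g t| <= C * w1 (t + a)) -> (forall t, `|h t| <= D * w1 (t + b)) ->
  int1 (fun t => g t + h t) = int1 g + int1 h.
Proof.
move=> cg ch gC hD; apply: RintegralD => //.
  exact: integrable_dec cg gC.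
exact: integrable_dec ch hD.
Qed.

Lemma int1Z g k C a : continuous g -> (forall t, `|g t| <= C * w1 (t + a)) ->
  int1 (fun t => k * g t) = k * int1 g.
Proof. by move=> cg gC; apply: RintegralZl => //; exact: integrable_dec cg gC. Qed.

Lemma int1_bd g C a : continuous g -> (forall t, `|g t| <= C * w1 (t + a)) ->
  `|int1 g| <= C * pi.
Proof.
move=> cg gC.
have cw : continuous (fun t : R => w1 (t + a)).
  exact: cont_shift cont_w1.
have C0 : 0 <= C.
  by have := gC 0; have := w1_gt0 (0 + a); have := normr_ge0 (g 0); nra.
have wb t : `|w1 (t + a)| <= 1 * w1 (t + a) by rewrite mul1r ger0_norm// w1_ge0.
have cCw k : continuous (fun t : R => k * w1 (t + a)).
  by move=> t; apply: cvgM; [exact: cvg_cst|exact: cw].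
have Cwb k t : `|k * w1 (t + a)| <= `|k| * w1 (t + a).
  by rewrite normrM (ger0_norm (w1_ge0 _)).
have E k : int1 (fun t => k * w1 (t + a)) = k * pi by rewrite (int1Z k cw wb) int1_w1a.
rewrite ler_norml -mulNr -!E; apply/andP; split.
  apply: (int1_le (cCw _) cg (Cwb _) gC) => t.
    by have := gC t; rewrite ler_norml mulNr => /andP[].
apply: (int1_le cg (cCw _) gC (Cwb _)) => t.
by have := gC t; rewrite ler_norml => /andP[].
Qed.

Lemma w1_affine c b : 0 < c -> forall t, w1 (c * t + b) <= (1 + c ^- 2) * w1 (t + b / c).
Proof.
move=> c0 t; rewrite /w1.
have -> : t + b / c = (c * t + b) / c by field; rewrite gt_eqF.
set y := c * t + b.
have y0 : 0 <= y ^+ 2 by rewrite sqr_ge0.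
have c2 : 0 < c ^- 2 by rewrite invr_gt0 exprn_gt0.
rewrite expr_div_n ler_pdivlMr; last first.
  by rewrite ltr_wpDr// divr_ge0// sqr_ge0.
rewrite mulrC ler_pdivrMr ?ltr_wpDr//.
rewrite mulrDr mulr1 mulrDl mul1r.
have : 0 <= c ^- 2 * y ^+ 2 by rewrite mulr_ge0// ltW.
by lra.
Qed.

Lemma int1_affine g C a c s : 0 < c -> continuous g -> (forall t, `|g t| <= C * w1 (t + a)) ->
  int1 g = c * int1 (fun t => g (c * t + s)).
Proof.
move=> c0 cg gC.
have C0 : 0 <= C.
  by have := gC 0; have := w1_gt0 (0 + a); have := normr_ge0 (g 0); nra.
have cw : continuous (fun t : R => w1 (t + a)) by exact: cont_shift cont_w1.
have dec h D : 0 <= D -> (forall t, `|h t| <= D * w1 (t + a)) ->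
    forall t, `|h (c * t + s)| <= (D * (1 + c ^- 2)) * w1 (t + (s + a) / c).
  move=> D0 hD t; rewrite (le_trans (hD _))// -mulrA ler_wpM2l//.
  by rewrite -addrA; exact: w1_affine.
have key h D : 0 <= D -> (forall t, `|h t| <= D * w1 (t + a)) -> continuous h -> (forall t, 0 <= h t) ->
    int1 h = c * int1 (fun t => h (c * t + s)).
  move=> D0 hD ch h0; rewrite /int1 /Rintegral (ge0_int_affine s c0 ch h0) fineM//.
  apply: integrable_fin_num => //; apply: (integrable_dec _ (dec _ _ D0 hD)).
  exact: cont_comp_aff.
have cCw : continuous (fun t : R => C * w1 (t + a)).
  by move=> t; apply: cvgM; [exact: cvg_cst|exact: cw].
have Cwb t : `|C * w1 (t + a)| <= C * w1 (t + a).
  by rewrite normrM (ger0_norm (w1_ge0 _)) (ger0_norm C0).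
have cgw : continuous (fun t : R => g t + C * w1 (t + a)).
  by move=> t; apply: cvgD; [exact: cg|exact: cCw].
have gwb t : `|g t + C * w1 (t + a)| <= (C + C) * w1 (t + a).
  by rewrite (le_trans (ler_normD _ _))// mulrDl lerD.
have := key _ _ (addr_ge0 C0 C0) gwb cgw _.
rewrite (int1D cg cCw gC Cwb).
rewrite (@int1D (fun t => g (c * t + s)) (fun t => C * w1 (c * t + s + a)) _ _ _ _
  (cont_comp_aff cg) (cont_comp_aff cCw) (dec _ _ C0 gC) (dec _ _ C0 Cwb)).
rewrite mulrDr (key _ _ C0 Cwb cCw) => [H|t]; last by rewrite mulr_ge0// w1_ge0.
apply: (addIr (c * int1 (fun t => C * w1 (c * t + s + a)))); apply: H => t.
by have := gC t; rewrite ler_norml => /andP[]; lra.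
Qed.

Lemma int1_shift g C a s : continuous g -> (forall t, `|g t| <= C * w1 (t + a)) ->
  int1 (fun t => g (t + s)) = int1 g.
Proof.
move=> cg gC; rewrite (int1_affine s ltr01 cg gC) mul1r; congr int1.
by apply/funext => t; rewrite mul1r.
Qed.

Lemma lip_cont g C : (forall t s, `|g (t + s) - g t| <= C * `|s|) -> continuous g.
Proof.
move=> gL t; apply/cvgrPdist_le => e e0.
have C1 : 0 < `|C| + 1 by rewrite ltr_wpDl.
near=> s.
rewrite distrC -(subrK t s) [s - t + t]addrC (le_trans (gL _ _))//.
rewrite (@le_trans _ _ ((`|C| + 1) * `|s - t|))//.
  by rewrite ler_wpM2r// (le_trans (ler_norm _))// lerDl.
rewrite -ler_pdivlMl// distrC mulrC.
near: s; exists (e / (`|C| + 1)) => /=; first by rewrite divr_gt0.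
by move=> y /= /ltW.
Unshelve. all: by end_near. Qed.

Lemma int_itv_cell g C t (h : R) : continuous g -> 0 <= h ->
  (forall t s, `|g (t + s) - g t| <= C * `|s|) ->
  `|\int[mu]_(x in `[t, t + h]) g x - h * g t| <= C * h ^+ 2.
Proof.
move=> cg h0 gL.
have ig (f : R -> R) : continuous f -> mu.-integrable `[t, t + h] (EFin \o f).
  by move=> cf; apply: continuous_compact_integrable; [exact: segment_compact|exact: continuous_subspaceT].
have cc (k : R) : continuous (fun _ : R => k) by move=> x; exact: cvg_cst.
have tE (k : R) : \int[mu]_(x in `[t, t + h]) k = k * h.
  rewrite Rintegral_cst//= lebesgue_measure_itv/= lte_fin.
  have [hp|hn] := ltP t (t + h); first by congr (_ * _); rewrite /=; lra.
  by have -> : h = 0 by lra.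
have C0 : 0 <= C by have := gL t 1; rewrite normr1 mulr1; apply: le_trans.
rewrite [h * _]mulrC -tE -RintegralB//; [|exact: ig|exact: ig].
rewrite (le_trans (le_normr_Rintegral _ _))//.
  have := ig (fun x => g x - g t); apply => x.
  by apply: cvgB; [exact: cg|exact: cvg_cst].
rewrite expr2 mulrA -(tE (C * h)).
apply: le_Rintegral => //.
- apply: (ig (fun x => `|g x - g t|)) => x; apply: cvg_norm.
  by apply: cvgB; [exact: cg|exact: cvg_cst].
- exact: ig.
- move=> x /=; rewrite in_itv/= => /andP[tx xt].
  rewrite -[in g x](subrK t x) [x - t + t]addrC (le_trans (gL _ _))// ler_wpM2l//.
  by rewrite ger0_norm; lra.
Qed.

Lemma int_itv_riemann g C t (h : R) n : continuous g -> 0 <= h ->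
  (forall t s, `|g (t + s) - g t| <= C * `|s|) ->
  `|\int[mu]_(x in `[t, t + h *+ n]) g x - \sum_(i < n) h * g (t + h *+ i)|
    <= C * h ^+ 2 *+ n.
Proof.
move=> cg h0 gL; have ig (a b : R) : mu.-integrable `[a, b] (EFin \o g).
  by apply: continuous_compact_integrable; [exact: segment_compact|exact: continuous_subspaceT].
elim: n => [|n IH].
  by rewrite big_ord0 !mulr0n addr0 set_itv1 Rintegral_set1 subr0 normr0.
rewrite big_ord_recr/= mulrSr.
have le1 : t <= t + h *+ n by rewrite lerDl mulrn_wge0.
have le2 : t + h *+ n <= t + h *+ n.+1 by rewrite lerD2l mulrSr lerDl.
have := @Rintegral_itvB _ g (BLeft t) (BRight (t + h *+ n.+1)) (t + h *+ n) (ig _ _).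
rewrite !bnd_simp => /(_ le1 le2) E.
have := int_itv_cell (t + h *+ n) cg h0 gL.
rewrite -addrA -mulrSr -Rintegral_itv_obnd_cbnd.
  rewrite -E => H; rewrite opprD addrA [C * _ *+ _.+1]mulrSr (le_trans _ (lerD IH H))//.
  rewrite (le_trans _ (ler_normD _ _))//.
  by rewrite le_eqVlt; apply/orP; left; apply/eqP; congr (`|_|); ring.
by apply: integrableS (ig (t + h *+ n) (t + h *+ n.+1)) => //; exact: subset_itv_oc_cc.
Qed.

Lemma ge0_int_itv_le g C a x y : continuous g -> (forall t, `|g t| <= C * w1 (t + a)) ->
  (forall t, 0 <= g t) -> \int[mu]_(t in `[x, y]) g t <= int1 g.
Proof.
move=> cg gC g0.
have mI : measurable (`[x, y]%classic : set R) by exact: measurable_itv.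
have ig := integrable_dec cg gC.
have igI : mu.-integrable `[x, y] (EFin \o g) by apply: integrableS ig.
rewrite /int1 /Rintegral fine_le//; [exact: integrable_fin_num|exact: integrable_fin_num|].
apply: ge0_subset_integral => //.
  by apply/measurable_EFinP; exact: measurable_cont.
by move=> t _; rewrite lee_fin.
Qed.

Lemma int_itv_w1 (T : R) : 0 < T -> \int[mu]_(t in `[- T, T]) w1 t = 2 * atan T.
Proof.
move=> T0; rewrite /Rintegral (@continuous_FTC2 _ _ atan)//.
- by rewrite atanN /= opprK; ring.
- by lra.
- by apply: continuous_subspaceT; exact: cont_w1.
- split.
  + by move=> x _; exact: derivable_atan.
  + by apply: cvg_at_right_filter; exact: continuous_atan.
  + by apply: cvg_at_left_filter; exact: continuous_atan.
- by move=> x x01; rewrite derive1_atan// mul1r.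
Qed.

(** One finite sum serves all functions with a common decay and Lipschitz constant.
  Functionals and other integrals pass through finite sums, hence through the
  integral. *)
Lemma quadrature1 (e : R) : 0 < e -> exists P : seq (R * R), forall g C,
  (forall t, `|g t| <= C * w1 t) -> (forall t s, `|g (t + s) - g t| <= 2 * C * `|s|) ->
  `|int1 g - \sum_(p <- P) p.1 * g p.2| <= e * C.
Proof.
move=> e0.
have [T T0 HT] : exists2 T : R, 0 < T & pi - 2 * atan T <= e / 2.
  have := @cvgy_atan R => /cvgrPdist_le/(_ (e / 4)); rewrite divr_gt0// => /(_ isT).
  move=> [A [_ HA]]; exists (Num.max (A + 1) 1); first by rewrite lt_max ltr01 orbT.
  have := HA (Num.max (A + 1) 1); rewrite lt_max ltrDl ltr01 => /(_ isT).
  move=> /(le_trans (ler_norm _)); lra.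
have [n Hn] : exists n : nat, 16 * T ^+ 2 / e <= n.+1%:R.
  exists (Num.bound (16 * T ^+ 2 / e)); rewrite ltW// (lt_trans (archi_boundP _))//.
    by rewrite divr_ge0 ?mulr_ge0 ?sqr_ge0// ltW.
  by rewrite ltr_nat.
pose h := 2 * T / n.+1%:R.
have n0 : 0 < n.+1%:R :> R by rewrite ltr0n.
have h0 : 0 <= h by rewrite divr_ge0// mulr_ge0// ltW.
exists [seq (h, - T + h *+ i) | i <- iota 0 n.+1] => g C gC gL.
have cg : continuous g by exact: lip_cont gL.
have C0 : 0 <= C.
  by have := gC 0; have := w1_gt0 0; have := normr_ge0 (g 0); nra.
have gC' t : `|g t| <= C * w1 (t + 0) by rewrite addr0.
have := int_itv_riemann (- T) n.+1 cg h0 gL.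
have -> : - T + h *+ n.+1 = T.
  by rewrite -mulr_natr /h divfK ?gt_eqF//; ring.
rewrite big_map -[iota 0 n.+1]/(index_iota 0 n.+1) big_mkord /= => H.
set S := \sum_(i < n.+1) _ in H *.
have H1 : `|int1 g - \int[mu]_(x in `[- T, T]) g x| <= C * (e / 2).
  have iT (f : R -> R) : continuous f -> mu.-integrable `[- T, T] (EFin \o f).
    by move=> cf; apply: continuous_compact_integrable; [exact: segment_compact|exact: continuous_subspaceT].
  have cCw : continuous (fun t : R => C * w1 t).
    by move=> t; apply: cvgM; [exact: cvg_cst|exact: cont_w1].
  have cw (f : R -> R) : continuous f -> continuous (fun t => - f t).
    by move=> cf t; apply: cvgN; exact: cf.
  have Cwb t : `|C * w1 t| <= C * w1 (t + 0).
    by rewrite addr0 normrM (ger0_norm (w1_ge0 _)) (ger0_norm C0).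
  have bnd (f : R -> R) : continuous f -> (forall t, `|f t| <= C * w1 (t + 0)) ->
      int1 f - \int[mu]_(x in `[- T, T]) f x <= C * (e / 2).
    move=> cf fC.
    have fC2 t : `|C * w1 t - f t| <= (C + C) * w1 (t + 0).
      by rewrite (le_trans (ler_normB _ _))// mulrDl lerD.
    have cf2 : continuous (fun t => C * w1 t - f t).
      by move=> t; apply: cvgB; [exact: cCw|exact: cf].
    have := @ge0_int_itv_le _ (C + C) 0 (- T) T cf2 fC2.
    have fCn t : `|- f t| <= C * w1 (t + 0) by rewrite normrN.
    rewrite (@int1D (fun t => C * w1 t) (fun t => - f t) C C 0 0 cCw (cw _ cf) Cwb fCn).
    have -> : int1 (fun t => C * w1 t) = C * pi.
      rewrite (@int1Z w1 C 1 0 cont_w1) => [|t]; last by rewrite mul1r addr0 ger0_norm// w1_ge0.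
      by rewrite -(int1_w1a 0); congr (_ * int1 _); apply/funext => t; rewrite addr0.
    have -> : int1 (fun t => - f t) = - int1 f.
      rewrite -mulN1r -(int1Z _ cf fC); congr int1; apply/funext => t; by rewrite mulN1r.
    rewrite RintegralB//; [|exact: iT|exact: iT].
    rewrite RintegralZl//; last exact: (iT w1 cont_w1).
    rewrite int_itv_w1// => K.
    have {}K : C * (2 * atan T) - \int[mu]_(x in `[- T, T]) f x <= C * pi - int1 f.
      apply: K => t; have := fC t; rewrite addr0 ler_norml => /andP[_]; lra.
    have : C * (pi - 2 * atan T) <= C * (e / 2) by rewrite ler_wpM2l.
    by lra.
  rewrite ler_norml; apply/andP; split.
    have := bnd (fun t => - g t) (cw _ cg).
    have -> : int1 (fun t => - g t) = - int1 g.
      rewrite -mulN1r -(int1Z _ cg gC'); congr int1; apply/funext => t; by rewrite mulN1r.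
    have -> : \int[mu]_(x in `[- T, T]) (- g x) = - \int[mu]_(x in `[- T, T]) g x.
      rewrite -[RHS]mulN1r -RintegralZl//; last exact: iT.
      by apply: eq_Rintegral => x _; rewrite mulN1r.
    rewrite opprK => K; rewrite lerNl opprB addrC; apply: K => t; by rewrite normrN.
  exact: bnd.
have H2 : 2 * C * h ^+ 2 *+ n.+1 <= C * (e / 2).
  rewrite -mulr_natr -mulrA [2 * C]mulrC -mulrA ler_wpM2l//.
  have -> : 2 * (h ^+ 2 * n.+1%:R) = 8 * T ^+ 2 / n.+1%:R by rewrite /h; field; rewrite gt_eqF.
  rewrite ler_pdivrMr//; move: Hn; rewrite ler_pdivrMr//; lra.
have -> : int1 g - S = (int1 g - \int[mu]_(x in `[- T, T]) g x) + (\int[mu]_(x in `[- T, T]) g x - S) by ring.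
rewrite (le_trans (ler_normD _ _))//; lra.
Qed.

(** If [g t] were positive, the Lipschitz bound would keep [g] positive on a
  segment starting at [t]. *)
Lemma int1_eq0 g C a : (forall t, `|g t| <= C * w1 (t + a)) ->
  (forall t s, `|g (t + s) - g t| <= 2 * C * `|s|) -> (forall t, 0 <= g t) ->
  int1 g = 0 -> forall t, g t = 0.
Proof.
move=> gC gL g0 ig0 t; apply/eqP; rewrite eq_le g0 andbT leNgt; apply/negP => gt0.
have cg : continuous g by exact: lip_cont gL.
have C0 : 0 <= C.
  by have := gC 0; have := w1_gt0 (0 + a); have := normr_ge0 (g 0); nra.
pose h := g t / (4 * C + 4).
have h0 : 0 < h by rewrite divr_gt0//; lra.
have := ge0_int_itv_le t (t + h) cg gC g0; rewrite ig0 => H.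
have := int_itv_cell t cg (ltW h0) gL; rewrite ler_norml => /andP[K _].
have : h * g t - 2 * C * h ^+ 2 <= 0 by lra.
apply/negP; rewrite -ltNge.
have -> : h * g t - 2 * C * h ^+ 2 = h * (g t - 2 * C * h) by ring.
rewrite mulr_gt0// subr_gt0 /h mulrA ltr_pdivrMr; last by lra.
by nra.
Qed.

End OneVariable.

Section OneVariableMore.
Context {R : realType}.
Implicit Types (g h : R -> R) (a b c s t C : R).

Lemma w1_shift a b t : w1 (t + b) <= 2 * (1 + (a - b) ^+ 2) * w1 (t + a).
Proof.
rewrite /w1; set x := t + a; have -> : t + b = x - (a - b) by rewrite /x; ring.
set y := a - b.
rewrite ler_pdivlMr; last by rewrite ltr_wpDr// sqr_ge0.
rewrite mulrC ler_pdivrMr; last by rewrite ltr_wpDr// sqr_ge0.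
have := sqr_ge0 (x - y); have := sqr_ge0 y; have := sqr_ge0 (x - 2 * y).
have : 0 <= y ^+ 2 * (x - y) ^+ 2 by rewrite mulr_ge0// sqr_ge0.
by nra.
Qed.

(** The exact constant matters: the two weights are centred at different points,
  and replacing one by a multiple of the other would lose a factor depending on
  their distance. *)
Lemma int1_bd2 g C1 C2 a b : 0 <= C1 -> 0 <= C2 -> continuous g ->
  (forall t, `|g t| <= C1 * w1 (t + a) + C2 * w1 (t + b)) ->
  `|int1 g| <= (C1 + C2) * pi.
Proof.
move=> C10 C20 cg gC.
have cw k c : continuous (fun t : R => k * w1 (t + c)).
  by move=> t; apply: cvgM; [exact: cvg_cst|exact: (cont_shift cont_w1)].
have wb k c t : 0 <= k -> `|k * w1 (t + c)| <= k * w1 (t + c).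
  by move=> k0; rewrite normrM (ger0_norm (w1_ge0 _)) (ger0_norm k0).
pose K := C2 * (2 * (1 + (a - b) ^+ 2)).
have wK t : C2 * w1 (t + b) <= K * w1 (t + a).
  by rewrite /K -mulrA ler_wpM2l// w1_shift.
have gC' t : `|g t| <= (C1 + K) * w1 (t + a).
  by rewrite (le_trans (gC t))// mulrDl lerD.
pose h t := C1 * w1 (t + a) + C2 * w1 (t + b).
have ch : continuous h by move=> t; apply: cvgD; [exact: cw|exact: cw].
have h0 t : 0 <= h t by rewrite addr_ge0// mulr_ge0// w1_ge0.
have hb t : `|h t| <= (C1 + K) * w1 (t + a).
  by rewrite ger0_norm// mulrDl lerD.
have chN : continuous (fun t => - h t) by move=> t; apply: cvgN; exact: ch.
have hbN t : `|- h t| <= (C1 + K) * w1 (t + a) by rewrite normrN.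
have E k c : 0 <= k -> int1 (fun t => k * w1 (t + c)) = k * pi.
  move=> k0; rewrite (@int1Z _ _ k 1 c (@cont_shift _ _ c cont_w1)) ?int1_w1a// => t.
  by rewrite mul1r ger0_norm// w1_ge0.
have Eh : int1 h = (C1 + C2) * pi.
  rewrite (int1D (cw C1 a) (cw C2 b) (fun t => wb C1 a t C10) (fun t => wb C2 b t C20)).
  by rewrite !E// mulrDl.
have EN : int1 (fun t => - h t) = - int1 h.
  rewrite -mulN1r -(int1Z _ ch hb); congr int1; apply/funext => t; by rewrite mulN1r.
rewrite ler_norml -Eh -EN; apply/andP; split.
  apply: (int1_le chN cg hbN gC') => t.
  by have := gC t; rewrite ler_norml => /andP[].
apply: (int1_le cg ch gC' hb) => t.
by have := gC t; rewrite ler_norml => /andP[].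
Qed.

End OneVariableMore.

(** * Iterated real integrals *)

Section Iterated.
Context {R : realType} {V : vectType R}.
Implicit Types (g : V -> R) (U : V -> R) (x v : V) (b D : seq V)
  (bl : seq (V * (V -> R))).

Fixpoint iterR b g x : R :=
  if b is v :: b' then int1 (fun t => iterR b' g (x + t *: v)) else g x.

(** Decay rate [U] and Lipschitz bounds with the same rate along the
  directions of [D]; a class stable under partial integration. *)
Definition nice D U (C : R) g :=
  (forall x, `|g x| <= C * U x) /\
  forall v, v \in D -> forall (s : R) x,
    `|g (x + s *: v) - g x| <= C * `|s| * (U x + U (x + s *: v)).

Definition wb bl x : R := \prod_(p <- bl) w1 (p.2 x).

(** Directions of integration with coordinate functions adapted to them. The tail of
  such a list is such a list, which is what inductions on it need. *)
Fixpoint biorth bl : Prop :=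
  if bl is p :: bl' then
    [/\ linear (p.2 : V -> R^o), p.2 p.1 = 1,
        forall q, q \in unzip1 bl' -> p.2 q = 0,
        forall l, List.In l (unzip2 bl') -> l p.1 = 0 & biorth bl']
  else True.

Definition invar U b := forall v, v \in b -> forall (t : R) x, U (x + t *: v) = U x.

Lemma wb_ge0 bl x : 0 <= wb bl x.
Proof. by apply: prodr_ge0 => p _; exact: w1_ge0. Qed.

Lemma wb_cons p bl x : wb (p :: bl) x = w1 (p.2 x) * wb bl x.
Proof. by rewrite /wb big_cons. Qed.

Lemma nice_line D U0 (l : V -> R) C g v x : linear (l : V -> R^o) -> l v = 1 ->
  (forall x, 0 <= U0 x) -> invar U0 [:: v] -> v \in D ->
  nice D (fun x => U0 x * w1 (l x)) C g ->
  (forall t, `|g (x + t *: v)| <= C * U0 x * w1 (t + l x)) /\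
  (forall t s, `|g (x + (t + s) *: v) - g (x + t *: v)| <= 2 * (C * U0 x) * `|s|).
Proof.
move=> ll lv U00 Ui vD [gC gL].
have lE t : l (x + t *: v) = t + l x.
  by rewrite (form_shift _ _ _ ll) lv mulr1 addrC.
have UE t : U0 (x + t *: v) = U0 x by apply: Ui; rewrite inE.
split=> [t|t s]; first by rewrite -mulrA -lE -(UE t) gC.
have C0 : 0 <= C * U0 x.
  have := gC x; have := w1_gt0 (l x); have := normr_ge0 (g x); have := U00 x.
  by rewrite mulrA; nra.
rewrite scalerDl addrA (le_trans (gL v vD s _))// -addrA -scalerDl !UE !lE.
have := w1_le1 (t + l x); have := w1_le1 (t + s + l x).
have := w1_ge0 (t + l x); have := w1_ge0 (t + s + l x) => h1 h2 h3 h4.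
have -> : C * `|s| * (U0 x * w1 (t + l x) + U0 x * w1 (t + s + l x)) =
  C * U0 x * `|s| * (w1 (t + l x) + w1 (t + s + l x)) by ring.
have : 0 <= C * U0 x * `|s| by rewrite mulr_ge0.
by nra.
Qed.

Lemma nice_cont D U0 (l : V -> R) C g v x : linear (l : V -> R^o) -> l v = 1 ->
  (forall x, 0 <= U0 x) -> invar U0 [:: v] -> v \in D ->
  nice D (fun x => U0 x * w1 (l x)) C g -> continuous (fun t : R => g (x + t *: v)).
Proof.
move=> ll lv U00 Ui vD gn.
have [_ gL] := nice_line x ll lv U00 Ui vD gn.
by apply: (lip_cont (C := 2 * (C * U0 x))) => t s; exact: gL.
Qed.

Lemma nice_step D U0 (l : V -> R) C g v : linear (l : V -> R^o) -> l v = 1 ->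
  (forall x, 0 <= U0 x) -> invar U0 [:: v] -> v \in D -> 0 <= C ->
  nice D (fun x => U0 x * w1 (l x)) C g ->
  nice D U0 (C * pi) (fun x => int1 (fun t => g (x + t *: v))).
Proof.
move=> ll lv U00 Ui vD C0 gn.
have line x := nice_line x ll lv U00 Ui vD gn.
have cont x := @nice_cont D U0 l C g v x ll lv U00 Ui vD gn.
have lE x t : l (x + t *: v) = t + l x.
  by rewrite (form_shift _ _ _ ll) lv mulr1 addrC.
have UE x t : U0 (x + t *: v) = U0 x by apply: Ui; rewrite inE.
split=> [x|u uD s x].
  by rewrite mulrAC (int1_bd (cont x) (line x).1).
have -> : int1 (fun t => g (x + s *: u + t *: v)) - int1 (fun t => g (x + t *: v)) =
    int1 (fun t => g (x + s *: u + t *: v) - g (x + t *: v)).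
  have cN : continuous (fun t : R => - g (x + t *: v)) by move=> t; apply: cvgN; exact: cont.
  have bN (t : R) : `|- g (x + t *: v)| <= C * U0 x * w1 (t + l x) by rewrite normrN; exact: (line x).1.
  rewrite (int1D (cont _) cN (line _).1 bN); congr (_ + _).
  rewrite -mulN1r -(int1Z _ (cont x) (line x).1); congr int1.
  by apply/funext => t; rewrite mulN1r.
have -> : C * pi * `|s| * (U0 x + U0 (x + s *: u)) =
  (C * `|s| * U0 x + C * `|s| * U0 (x + s *: u)) * pi by ring.
apply: (int1_bd2 (a := l x) (b := l (x + s *: u))).
- by rewrite !mulr_ge0.
- by rewrite !mulr_ge0.
- by move=> t; apply: cvgB; exact: cont.
move=> t; have [_ gL] := gn; have := gL u uD s (x + t *: v).
rewrite (addrAC x (t *: v)) => /le_trans; apply.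
by rewrite !lE !UE mulrDr !mulrA.
Qed.

Lemma biorth_cons p bl : biorth (p :: bl) -> [/\ linear (p.2 : V -> R^o), p.2 p.1 = 1,
  forall q, q \in unzip1 bl -> p.2 q = 0,
  forall l, List.In l (unzip2 bl) -> l p.1 = 0 & biorth bl].
Proof. by []. Qed.

Lemma invar_cons U v b : invar U (v :: b) -> invar U [:: v] /\ invar U b.
Proof.
move=> Ui; split=> u ub; apply: Ui; rewrite inE.
  by move: ub; rewrite inE => ->.
by rewrite ub orbT.
Qed.

Lemma invar_w1 U0 p bl : biorth (p :: bl) -> invar U0 (unzip1 bl) ->
  invar (fun x => U0 x * w1 (p.2 x)) (unzip1 bl).
Proof.
move=> [ll _ lq _ _] Ui v vb t x; rewrite Ui//; congr (_ * w1 _).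
by rewrite (form_shift _ _ _ ll) (lq _ vb) mulr0 addr0.
Qed.

(** Integrating along [bl] consumes the weight [wb bl] and leaves [U0], with the
  Lipschitz bounds in all directions of [D]: this is what allows one induction to
  prove everything about iterated integrals. *)
Lemma iter_nice bl D U0 C g : biorth bl -> 0 <= C -> (forall x, 0 <= U0 x) ->
  invar U0 (unzip1 bl) -> {subset unzip1 bl <= D} ->
  nice D (fun x => U0 x * wb bl x) C g ->
  nice D U0 (C * pi ^+ size bl) (iterR (unzip1 bl) g).
Proof.
move=> + C0; elim: bl U0 => [|p bl IH] U0 bo U00 Ui bD gn.
  rewrite expr0 mulr1 /=; move: gn; congr nice; apply/funext => x.
  by rewrite /wb big_nil mulr1.
have [ll lv lq ql bo'] := bo; have [Uv Ub] := invar_cons Ui.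
rewrite exprSr mulrA /=; apply: (nice_step ll) => //.
- by apply: bD; rewrite inE eqxx.
- by rewrite mulr_ge0// exprn_ge0// pi_ge0.
- apply: IH => //.
  + by move=> x; rewrite mulr_ge0// w1_ge0.
  + exact: invar_w1.
  + by move=> u ub; apply: bD; rewrite inE ub orbT.
  + by move: gn; congr nice; apply/funext => x; rewrite wb_cons mulrA.
Qed.

(** The consequences of [iter_nice] for the outermost variable, in the form
  needed by the inductions on the list of directions. *)
Lemma iter_nice_tail p bl D U0 C g : biorth (p :: bl) -> 0 <= C -> (forall x, 0 <= U0 x) ->
  invar U0 (unzip1 (p :: bl)) -> {subset unzip1 (p :: bl) <= D} ->
  nice D (fun x => U0 x * wb (p :: bl) x) C g ->
  [/\ nice D (fun x => U0 x * w1 (p.2 x) * wb bl x) C g,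
      nice D (fun x => U0 x * w1 (p.2 x)) (C * pi ^+ size bl) (iterR (unzip1 bl) g),
      forall x, 0 <= U0 x * w1 (p.2 x),
      invar (fun x => U0 x * w1 (p.2 x)) (unzip1 bl) &
      {subset unzip1 bl <= D}].
Proof.
move=> bo C0 U00 Ui bD gn; have [Uv Ub] := invar_cons Ui.
have gn' : nice D (fun x => U0 x * w1 (p.2 x) * wb bl x) C g.
  by move: gn; congr nice; apply/funext => x; rewrite wb_cons mulrA.
have U0' x : 0 <= U0 x * w1 (p.2 x) by rewrite mulr_ge0// w1_ge0.
have Ui' := invar_w1 bo Ub.
have bD' : {subset unzip1 bl <= D} by move=> u ub; apply: bD; rewrite inE ub orbT.
by split=> //; apply: iter_nice => //; case: bo.
Qed.

Lemma iterint_iterR bl D U0 C g x : biorth bl -> 0 <= C -> (forall x, 0 <= U0 x) ->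
  invar U0 (unzip1 bl) -> {subset unzip1 bl <= D} ->
  nice D (fun x => U0 x * wb bl x) C g ->
  iterint (unzip1 bl) (fun x => (g x)%:E) x = (iterR (unzip1 bl) g x)%:E.
Proof.
move=> + C0; elim: bl U0 x => [|p bl IH] U0 x bo U00 Ui bD gn //=.
have [gn' gI U0' Ui' bD'] := iter_nice_tail bo C0 U00 Ui bD gn.
have [ll lv lq ql bo'] := bo; have [Uv Ub] := invar_cons Ui.
have pD : p.1 \in D by apply: bD; rewrite inE eqxx.
under eq_integral do rewrite (IH _ _ bo' U0' Ui' bD' gn').
rewrite /int1 /Rintegral fineK//; apply: integrable_fin_num => //.
apply: (@integrable_dec _ (fun t => iterR (unzip1 bl) g (x + t *: p.1))).
  exact: (nice_cont ll lv U00 Uv pD gI).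
by have [H _] := nice_line x ll lv U00 Uv pD gI; exact: H.
Qed.

Lemma iterR_shift b g y x : iterR b (fun z => g (z + y)) x = iterR b g (x + y).
Proof.
elim: b x => [|v b IH] x //=; congr int1; apply/funext => t.
by rewrite IH addrAC.
Qed.

Lemma iterR_invar bl D U0 C g : biorth bl -> 0 <= C -> (forall x, 0 <= U0 x) ->
  invar U0 (unzip1 bl) -> {subset unzip1 bl <= D} ->
  nice D (fun x => U0 x * wb bl x) C g ->
  invar (iterR (unzip1 bl) g) (unzip1 bl).
Proof.
move=> + C0; elim: bl U0 => [|p bl IH] U0 bo U00 Ui bD gn //.
have [gn' gI U0' Ui' bD'] := iter_nice_tail bo C0 U00 Ui bD gn.
have [ll lv lq ql bo'] := bo; have [Uv Ub] := invar_cons Ui.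
have pD : p.1 \in D by apply: bD; rewrite inE eqxx.
move=> v; rewrite inE => /predU1P[->|vb] s x /=.
  have [H _] := nice_line x ll lv U00 Uv pD gI.
  rewrite -(int1_shift s (nice_cont (x := x) ll lv U00 Uv pD gI) H).
  by congr int1; apply/funext => t; rewrite -addrA -scalerDl addrC [s + t]addrC addrC.
congr int1; apply/funext => t; rewrite addrAC.
exact: (IH _ bo' U0' Ui' bD' gn').
Qed.

Lemma iterRD bl D U0 C C' g g' x : biorth bl -> 0 <= C -> 0 <= C' -> (forall x, 0 <= U0 x) ->
  invar U0 (unzip1 bl) -> {subset unzip1 bl <= D} ->
  nice D (fun x => U0 x * wb bl x) C g -> nice D (fun x => U0 x * wb bl x) C' g' ->
  iterR (unzip1 bl) (fun x => g x + g' x) x = iterR (unzip1 bl) g x + iterR (unzip1 bl) g' x.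
Proof.
move=> + C0 C0'; elim: bl U0 x => [|p bl IH] U0 x bo U00 Ui bD gn gn' //=.
have [hn hI U0' Ui' bD'] := iter_nice_tail bo C0 U00 Ui bD gn.
have [hn' hI' _ _ _] := iter_nice_tail bo C0' U00 Ui bD gn'.
have [ll lv lq ql bo'] := bo; have [Uv Ub] := invar_cons Ui.
have pD : p.1 \in D by apply: bD; rewrite inE eqxx.
have [H _] := nice_line x ll lv U00 Uv pD hI.
have [H' _] := nice_line x ll lv U00 Uv pD hI'.
rewrite -(int1D (nice_cont (x := x) ll lv U00 Uv pD hI) (nice_cont (x := x) ll lv U00 Uv pD hI') H H').
by congr int1; apply/funext => t; exact: (IH _ _ bo' U0' Ui' bD' hn hn').
Qed.

Lemma iterRZ bl D U0 C k g x : biorth bl -> 0 <= C -> (forall x, 0 <= U0 x) ->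
  invar U0 (unzip1 bl) -> {subset unzip1 bl <= D} ->
  nice D (fun x => U0 x * wb bl x) C g ->
  iterR (unzip1 bl) (fun x => k * g x) x = k * iterR (unzip1 bl) g x.
Proof.
move=> + C0; elim: bl U0 x => [|p bl IH] U0 x bo U00 Ui bD gn //=.
have [hn hI U0' Ui' bD'] := iter_nice_tail bo C0 U00 Ui bD gn.
have [ll lv lq ql bo'] := bo; have [Uv Ub] := invar_cons Ui.
have pD : p.1 \in D by apply: bD; rewrite inE eqxx.
have [H _] := nice_line x ll lv U00 Uv pD hI.
rewrite -(int1Z k (nice_cont (x := x) ll lv U00 Uv pD hI) H).
by congr int1; apply/funext => t; exact: (IH _ _ bo' U0' Ui' bD' hn).
Qed.

Lemma iterR_scale bl D U0 C c g x : 0 < c -> biorth bl -> 0 <= C -> (forall x, 0 <= U0 x) ->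
  invar U0 (unzip1 bl) -> {subset unzip1 bl <= D} ->
  nice D (fun x => U0 x * wb bl x) C g ->
  iterR (unzip1 bl) (fun x => g (c *: x)) x = c ^- size bl * iterR (unzip1 bl) g (c *: x).
Proof.
move=> c0 + C0; elim: bl U0 x => [|p bl IH] U0 x bo U00 Ui bD gn /=.
  by rewrite expr0 invr1 mul1r.
have [hn hI U0' Ui' bD'] := iter_nice_tail bo C0 U00 Ui bD gn.
have [ll lv lq ql bo'] := bo; have [Uv Ub] := invar_cons Ui.
have pD : p.1 \in D by apply: bD; rewrite inE eqxx.
have [H _] := nice_line (c *: x) ll lv U00 Uv pD hI.
have cc := nice_cont (x := c *: x) ll lv U00 Uv pD hI.
have [H1 _] := nice_line (c *: x) ll lv U00 Uv pD hI.
rewrite (int1_affine 0 c0 cc H).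
have -> (X : R) : c ^- (size bl).+1 * (c * X) = c ^- size bl * X.
  by rewrite exprS invfM; field; rewrite expf_neq0 ?gt_eqF.
have := @int1Z _ (fun t => iterR (unzip1 bl) g (c *: x + (c * t + 0) *: p.1)) (c ^- size bl)
  (C * pi ^+ size bl * U0 (c *: x) * (1 + c ^- 2)) ((p.2 (c *: x)) / c) _ _.
move=> <-; first last.
- move=> t; rewrite addr0 (le_trans (H _))// -[leRHS]mulrA ler_wpM2l ?w1_affine//.
  by rewrite !mulr_ge0// exprn_ge0// pi_ge0.
- exact: (cont_comp_aff (c := c) (s := 0) cc).
congr int1; apply/funext => t; rewrite (IH _ _ bo' U0' Ui' bD' hn).
by rewrite scalerDr scalerA addr0.
Qed.

Lemma iterR_ge0 b g x : (forall y, 0 <= g y) -> 0 <= iterR b g x.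
Proof.
by move=> g0; elim: b x => [|v b IH] x //=; apply: Rintegral_ge0 => t _; exact: IH.
Qed.

Lemma iterR_eq0 bl D U0 C g x : biorth bl -> 0 <= C -> (forall x, 0 <= U0 x) ->
  invar U0 (unzip1 bl) -> {subset unzip1 bl <= D} ->
  nice D (fun x => U0 x * wb bl x) C g -> (forall y, 0 <= g y) ->
  iterR (unzip1 bl) g x = 0 -> g x = 0.
Proof.
move=> + C0; elim: bl U0 x => [|p bl IH] U0 x bo U00 Ui bD gn g0 //= ig.
have [hn hI U0' Ui' bD'] := iter_nice_tail bo C0 U00 Ui bD gn.
have [ll lv lq ql bo'] := bo; have [Uv Ub] := invar_cons Ui.
have pD : p.1 \in D by apply: bD; rewrite inE eqxx.
have [H K] := nice_line x ll lv U00 Uv pD hI.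
apply: (IH _ _ bo' U0' Ui' bD' hn g0).
have := int1_eq0 H K (fun t => iterR_ge0 _ _ g0) ig 0.
by rewrite scale0r addr0.
Qed.

(** The size of the integral is governed by the size of the integrand alone, not
  by its Lipschitz constant. *)
Lemma iterR_bd bl D U0 C C' g x : biorth bl -> 0 <= C -> 0 <= C' -> (forall x, 0 <= U0 x) ->
  invar U0 (unzip1 bl) -> {subset unzip1 bl <= D} ->
  nice D (fun x => U0 x * wb bl x) C g -> (forall x, `|g x| <= C' * (U0 x * wb bl x)) ->
  `|iterR (unzip1 bl) g x| <= C' * pi ^+ size bl * U0 x.
Proof.
move=> + C0 C0'; elim: bl U0 x => [|p bl IH] U0 x bo U00 Ui bD gn gC /=.
  by have := gC x; rewrite expr0 mulr1 /wb big_nil mulr1.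
have [hn hI U0' Ui' bD'] := iter_nice_tail bo C0 U00 Ui bD gn.
have [ll lv lq ql bo'] := bo; have [Uv Ub] := invar_cons Ui.
have pD : p.1 \in D by apply: bD; rewrite inE eqxx.
have gC' y : `|g y| <= C' * (U0 y * w1 (p.2 y) * wb bl y).
  by rewrite (le_trans (gC y))// wb_cons !mulrA.
rewrite exprSr mulrA mulrAC; apply: (int1_bd (a := p.2 x)).
  exact: (nice_cont (x := x) ll lv U00 Uv pD hI).
move=> t; rewrite (le_trans (IH _ _ bo' U0' Ui' bD' hn gC'))//.
rewrite (Uv p.1 (mem_head _ _)) (form_shift _ _ _ ll) lv mulr1 addrC.
by rewrite mulrA.
Qed.

(** Product quadrature: the rule in the outer variable is exact enough for the
  integrated function, the rule for the inner integral is then chosen with an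
  error small compared with the total weight of the outer rule. *)
Lemma iterR_quad bl D (e : R) : biorth bl -> {subset unzip1 bl <= D} -> 0 < e ->
  exists P : seq (R * V), forall U0 C g x, 0 <= C -> (forall x, 0 <= U0 x) ->
  invar U0 (unzip1 bl) -> (forall l, List.In l (unzip2 bl) -> l x = 0) ->
  nice D (fun x => U0 x * wb bl x) C g ->
  `|iterR (unzip1 bl) g x - \sum_(p <- P) p.1 * g (x + p.2)| <= e * C * U0 x.
Proof.
elim: bl e => [|p bl IH] e bo bD e0.
  exists [:: (1, 0)] => U0 C g x C0 U00 Ui lx gn.
  by rewrite big_seq1 /= mul1r addr0 subrr normr0 !mulr_ge0// ltW.
have [ll lv lq ql bo'] := bo.
have bD' : {subset unzip1 bl <= D} by move=> u ub; apply: bD; rewrite inE ub orbT.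
have pn0 : 0 < pi ^+ size bl + 1 :> R by rewrite ltr_wpDl// exprn_ge0// pi_ge0.
have e1 : 0 < e / 2 / (pi ^+ size bl + 1) by rewrite !divr_gt0.
have [P1 HP1] := quadrature1 e1.
have S0 : 0 < \sum_(q <- P1) `|q.1| + 1 by rewrite ltr_wpDl// sumr_ge0.
have e2 : 0 < e / 2 / (\sum_(q <- P1) `|q.1| + 1) by rewrite !divr_gt0.
have [P2 HP2] := IH _ bo' bD' e2.
exists [seq (q.1 * r.1, q.2 *: p.1 + r.2) | q <- P1, r <- P2] => U0 C g x C0 U00 Ui lx gn.
have [hn hI U0' Ui' _] := iter_nice_tail bo C0 U00 Ui bD gn.
have [Uv Ub] := invar_cons Ui.
have pD : p.1 \in D by apply: bD; rewrite inE eqxx.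
have [H K] := nice_line x ll lv U00 Uv pD hI.
have px : p.2 x = 0 by apply: lx; left.
set G := iterR (unzip1 bl) g in H K hI *.
rewrite big_allpairs_dep /=.
have A1 : `|int1 (fun t => G (x + t *: p.1)) - \sum_(q <- P1) q.1 * G (x + q.2 *: p.1)| <= e / 2 * C * U0 x.
  rewrite (le_trans (HP1 _ (C * pi ^+ size bl * U0 x) _ _))//.
  - by move=> t; have := H t; rewrite px addr0.
  - have -> : e / 2 / (pi ^+ size bl + 1) * (C * pi ^+ size bl * U0 x) =
      e / 2 * C * U0 x * (pi ^+ size bl / (pi ^+ size bl + 1)) by field; rewrite gt_eqF.
    rewrite ler_piMr//; first by rewrite !mulr_ge0// ltW.
    by rewrite ler_pdivrMr// mul1r lerDl.
have A2 : `|\sum_(q <- P1) q.1 * G (x + q.2 *: p.1) -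
    \sum_(q <- P1) \sum_(r <- P2) q.1 * r.1 * g (x + (q.2 *: p.1 + r.2))| <= e / 2 * C * U0 x.
  rewrite -sumrB (le_trans (ler_norm_sum _ _ _))//.
  apply: (@le_trans _ _ (\sum_(q <- P1) `|q.1| * (e / 2 / (\sum_(q <- P1) `|q.1| + 1) * C * U0 x))).
    apply: ler_sum => q _; under eq_bigr do rewrite -mulrA addrA.
    rewrite -mulr_sumr -mulrBr normrM ler_wpM2l//.
    have lx' l : List.In l (unzip2 bl) -> l (x + q.2 *: p.1) = 0.
      move=> lb; have lll : linear (l : V -> R^o).
        move: lb bo'; clear; elim: bl => [|r bl IH] //= [<-|lb] [] // *.
        exact: IH.
      by rewrite (form_shift _ _ _ lll) ql// mulr0 addr0 lx//; right.
    rewrite (le_trans (HP2 _ C g _ C0 U0' Ui' lx' hn))// -!mulrA.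
    rewrite ler_wpM2l ?(ltW e0)// ler_wpM2l// ler_wpM2l ?invr_ge0 ?(ltW S0)//.
    rewrite ler_wpM2l// (Uv p.1 (mem_head _ _)).
    by rewrite -[leRHS]mulr1 ler_wpM2l// w1_le1.
  rewrite -mulr_suml !mulrA ler_wpM2r// ler_wpM2r//.
  rewrite ler_pdivrMr// -mulrA mulrC ler_wpM2l ?lerDl//.
  by rewrite divr_ge0// ltW.
have -> : e * C * U0 x = e / 2 * C * U0 x + e / 2 * C * U0 x by field.
rewrite (le_trans _ (lerD A1 A2))// (le_trans _ (ler_normD _ _))//.
by rewrite addrA subrK.
Qed.

End Iterated.

(** * Iterated complex integrals *)

Section ComplexIntegral.
Context {R : realType} {V : vectType R}.
Variable bl : seq (V * (V -> R)).
Hypothesis bo : biorth bl.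
Local Notation b := (unzip1 bl).
Implicit Types (f : V -> R[i]) (x y : V) (C : R).

Definition IC f : R[i] :=
  Complex (iterR b (fun x => complex.Re (f x)) 0) (iterR b (fun x => complex.Im (f x)) 0).

(** Integrable decay and Lipschitz bounds with one constant. All estimates below
  are uniform over such functions, which makes quadrature available. *)
Definition niceC C f :=
  (forall x, normc (f x) <= C * wb bl x) /\
  forall v, v \in b -> forall (s : R) x,
    normc (f (x + s *: v) - f x) <= C * `|s| * (wb bl x + wb bl (x + s *: v)).

Lemma wb_gt0 x : 0 < wb bl x.
Proof. by apply: prodr_gt0 => p _; exact: w1_gt0. Qed.

Lemma niceC_ge0 C f : niceC C f -> 0 <= C.
Proof. by move=> [/(_ 0) H _]; have := wb_gt0 0; have := normc_ge0 (f 0); nra. Qed.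

Lemma niceC_Re C f : niceC C f -> nice b (fun x => 1 * wb bl x) C (fun x => complex.Re (f x)).
Proof.
move=> [fC fL]; split=> [x|v vb s x].
  by rewrite mul1r (le_trans (ler_Re_normc _)).
by rewrite !mul1r -ReN -ReD (le_trans (ler_Re_normc _))// fL.
Qed.

Lemma niceC_Im C f : niceC C f -> nice b (fun x => 1 * wb bl x) C (fun x => complex.Im (f x)).
Proof.
move=> [fC fL]; split=> [x|v vb s x].
  by rewrite mul1r (le_trans (ler_Im_normc _)).
by rewrite !mul1r -ImN -ImD (le_trans (ler_Im_normc _))// fL.
Qed.

Let U0 (x : V) : R := 1.
Let U00 x : 0 <= U0 x. Proof. exact: ler01. Qed.
Let Ui : invar U0 b. Proof. by []. Qed.
Let bD : {subset b <= b}. Proof. by []. Qed.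

Lemma integralC_IC C f : niceC C f -> integralC b f = IC f.
Proof.
move=> fn; have C0 := niceC_ge0 fn.
rewrite /integralC (iterint_iterR 0 bo C0 U00 Ui bD (niceC_Re fn)).
by rewrite (iterint_iterR 0 bo C0 U00 Ui bD (niceC_Im fn)).
Qed.

Lemma niceC_D C C' f g : niceC C f -> niceC C' g -> niceC (C + C') (fun x => f x + g x).
Proof.
move=> [fC fL] [gC gL]; split=> [x|v vb s x].
  by rewrite (le_trans (normcD _ _))// mulrDl lerD.
have -> : f (x + s *: v) + g (x + s *: v) - (f x + g x) =
  (f (x + s *: v) - f x) + (g (x + s *: v) - g x) by ring.
by rewrite (le_trans (normcD _ _))// !mulrDl lerD// ?fL ?gL// -mulrDl.
Qed.

Lemma niceC_Z C c f : niceC C f -> niceC (normc c * C) (fun x => c * f x).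
Proof.
move=> [fC fL]; split=> [x|v vb s x].
  by rewrite normcM -mulrA ler_wpM2l ?normc_ge0.
by rewrite -mulrBr normcM -!mulrA ler_wpM2l ?normc_ge0// mulrA fL.
Qed.

Lemma niceC_0 : niceC 0 (fun=> 0).
Proof. by split=> [x|v _ s x]; rewrite ?subrr normc0 !mul0r. Qed.

Lemma IC_D C C' f g : niceC C f -> niceC C' g -> IC (fun x => f x + g x) = IC f + IC g.
Proof.
move=> fn gn; have C0 := niceC_ge0 fn; have C0' := niceC_ge0 gn.
apply: complexE; rewrite ?ReD ?ImD /=.
  rewrite -(iterRD 0 bo C0 C0' U00 Ui bD (niceC_Re fn) (niceC_Re gn)).
  by congr iterR; apply/funext => x; rewrite ReD.
rewrite -(iterRD 0 bo C0 C0' U00 Ui bD (niceC_Im fn) (niceC_Im gn)).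
by congr iterR; apply/funext => x; rewrite ImD.
Qed.

Lemma nice_RZ C k (g : V -> R) : nice b (fun x => 1 * wb bl x) C g ->
  nice b (fun x => 1 * wb bl x) (`|k| * C) (fun x => k * g x).
Proof.
move=> [gC gL]; split=> [x|v vb s x].
  by rewrite normrM -mulrA ler_wpM2l.
by rewrite -mulrBr normrM -!mulrA ler_wpM2l// mulrA gL.
Qed.

Lemma IC_Z C c f : niceC C f -> IC (fun x => c * f x) = c * IC f.
Proof.
move=> fn; have C0 := niceC_ge0 fn.
have rn := niceC_Re fn; have im := niceC_Im fn.
have Z k g := fun h => iterRZ (g := g) k 0 bo C0 U00 Ui bD h.
have kC (k : R) : 0 <= `|k| * C by rewrite mulr_ge0.
apply: complexE; rewrite ?ReM ?ImM /=.
  rewrite -(Z _ _ rn) -mulNr -(Z _ _ im).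
  rewrite -(iterRD 0 bo (kC _) (kC _) U00 Ui bD (nice_RZ _ rn) (nice_RZ _ im)).
  by congr iterR; apply/funext => x; rewrite ReM mulNr.
rewrite -(Z _ _ rn) -(Z _ _ im).
rewrite -(iterRD 0 bo (kC _) (kC _) U00 Ui bD (nice_RZ _ im) (nice_RZ _ rn)).
by congr iterR; apply/funext => x; rewrite ImM.
Qed.

Lemma IC_N C f : niceC C f -> IC (fun x => - f x) = - IC f.
Proof.
move=> fn; rewrite -mulN1r -(IC_Z _ fn); congr IC; apply/funext => x; by rewrite mulN1r.
Qed.

Lemma niceC_N C f : niceC C f -> niceC C (fun x => - f x).
Proof.
move=> /(niceC_Z (-1)); rewrite normcN normc1 mul1r; congr niceC.
by apply/funext => x; rewrite mulN1r.
Qed.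

Lemma IC_B C C' f g : niceC C f -> niceC C' g -> IC (fun x => f x - g x) = IC f - IC g.
Proof. by move=> fn gn; rewrite (IC_D fn (niceC_N gn)) (IC_N gn). Qed.

Lemma IC_0 : IC (fun=> 0) = 0.
Proof.
rewrite -[RHS](mul0r (IC (fun=> 0))) -(IC_Z 0 niceC_0); congr IC.
by apply/funext => x; rewrite mul0r.
Qed.

Lemma niceC_sum (I : Type) (r : seq I) (F : I -> V -> R[i]) (C : I -> R) :
  (forall i, niceC (C i) (F i)) ->
  niceC (\sum_(i <- r) C i) (fun x => \sum_(i <- r) F i x).
Proof.
move=> Fn; elim: r => [|i r IH].
  by have := niceC_0; rewrite big_nil; congr niceC; apply/funext => x; rewrite big_nil.
rewrite big_cons; have := niceC_D (Fn i) IH; congr niceC.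
by apply/funext => x; rewrite big_cons.
Qed.

Lemma IC_sum (I : Type) (r : seq I) (F : I -> V -> R[i]) (C : I -> R) :
  (forall i, niceC (C i) (F i)) ->
  IC (fun x => \sum_(i <- r) F i x) = \sum_(i <- r) IC (F i).
Proof.
move=> Fn; elim: r => [|i r IH].
  by rewrite [RHS]big_nil -[RHS]IC_0; congr IC; apply/funext => x; rewrite big_nil.
rewrite big_cons -IH -(IC_D (Fn i) (niceC_sum r Fn)); congr IC.
by apply/funext => x; rewrite big_cons.
Qed.

Lemma IC_bd C f : niceC C f -> normc (IC f) <= 2 * (C * pi ^+ size bl).
Proof.
move=> fn; have C0 := niceC_ge0 fn.
rewrite (le_trans (ler_normc_ReIm _))//= mulr2n mulrDl mul1r.
have [H _] := iter_nice bo C0 U00 Ui bD (niceC_Re fn).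
have [K _] := iter_nice bo C0 U00 Ui bD (niceC_Im fn).
by rewrite lerD// -[leRHS]mulr1.
Qed.

Lemma IC_quad (e : R) : 0 < e -> exists P : seq (R * V), forall C f, niceC C f ->
  normc (IC f - \sum_(p <- P) real_complex R p.1 * f p.2) <= e * C.
Proof.
move=> e0; have e2 : 0 < e / 2 by rewrite divr_gt0.
have [P HP] := iterR_quad bo bD e2.
exists P => C f fn; have C0 := niceC_ge0 fn.
have l0 l : List.In l (unzip2 bl) -> l 0 = 0.
  move: bo; elim: (bl) => [|r bl' IH] //= [ll _ _ _ bo'] [<-|]; last exact: IH.
  exact: (lin0 ll).
have := HP U0 C _ 0 C0 U00 Ui l0 (niceC_Re fn); have := HP U0 C _ 0 C0 U00 Ui l0 (niceC_Im fn).
rewrite /U0 !mulr1 => H1 H2.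
rewrite (le_trans (ler_normc_ReIm _))// !(ReD, ImD, ReN, ImN)/=.
have -> : complex.Re (\sum_(p <- P) real_complex R p.1 * f p.2) =
    \sum_(p <- P) p.1 * complex.Re (f (0 + p.2)).
  rewrite (big_morph _ (@ReD R) (erefl _)); apply: eq_bigr => p _.
  by rewrite ReM/= mul0r subr0 add0r.
have -> : complex.Im (\sum_(p <- P) real_complex R p.1 * f p.2) =
    \sum_(p <- P) p.1 * complex.Im (f (0 + p.2)).
  rewrite (big_morph _ (@ImD R) (erefl _)); apply: eq_bigr => p _.
  by rewrite ImM/= mul0r addr0 add0r.
lra.
Qed.

Lemma IC_shift_dir C f v (s : R) : niceC C f -> v \in b -> IC (fun x => f (x + s *: v)) = IC f.
Proof.
move=> fn vb; have C0 := niceC_ge0 fn.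
rewrite /IC (iterR_shift b (fun x => complex.Re (f x))) (iterR_shift b (fun x => complex.Im (f x))).
rewrite (iterR_invar bo C0 U00 Ui bD (niceC_Re fn) vb).
by rewrite (iterR_invar bo C0 U00 Ui bD (niceC_Im fn) vb).
Qed.

Lemma IC_scale C f (c : R) : 0 < c -> niceC C f ->
  IC (fun x => f (c *: x)) = real_complex R (c ^- size bl) * IC f.
Proof.
move=> c0 fn; have C0 := niceC_ge0 fn.
have H := iterR_scale 0 c0 bo C0 U00 Ui bD (niceC_Re fn).
have K := iterR_scale 0 c0 bo C0 U00 Ui bD (niceC_Im fn).
apply: complexE; rewrite ?ReM ?ImM/= ?mul0r ?subr0 ?addr0.
  by rewrite H scaler0.
by rewrite K scaler0.
Qed.

Lemma IC_real_eq0 C (g : V -> R) : niceC C (fun x => real_complex R (g x)) ->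
  (forall x, 0 <= g x) -> IC (fun x => real_complex R (g x)) = 0 -> g 0 = 0.
Proof.
move=> gn g0 [H _]; have C0 := niceC_ge0 gn.
exact: (iterR_eq0 bo C0 U00 Ui bD (niceC_Re gn) g0 H).
Qed.

Lemma IC_real_mono C C' (g h : V -> R) : niceC C (fun x => real_complex R (g x)) ->
  niceC C' (fun x => real_complex R (h x)) -> (forall x, g x <= h x) ->
  complex.Re (IC (fun x => real_complex R (g x))) <= complex.Re (IC (fun x => real_complex R (h x))).
Proof.
move=> gn hn gh; rewrite -subr_ge0 -ReN -ReD -(IC_B hn gn)/=.
apply: (iterR_ge0 b (g := fun x => complex.Re (real_complex R (h x) - real_complex R (g x)))) => x.
by rewrite ReD ReN /= subr_ge0.
Qed.

(** Two powers of [jb] pay for each variable of integration. *)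
Lemma jb_wb : exists2 K : R, 0 < K & forall x, 1 <= K * wb bl x * jb x ^+ (2 * size bl).
Proof.
move: bo; elim: (bl) => [_|p r IH [ll _ _ _ /IH[K K0 HK]]].
  by exists 1 => // x; rewrite /wb big_nil !mulr1.
have [A A0 HA] := linear_form_nrm ll.
exists (K * (1 + A ^+ 2)) => [|x]; first by rewrite mulr_gt0// ltr_wpDr// sqr_ge0.
rewrite wb_cons /= mulnS exprD.
have -> : K * (1 + A ^+ 2) * (w1 (p.2 x) * wb r x) * (jb x ^+ 2 * jb x ^+ (2 * size r)) =
  (K * wb r x * jb x ^+ (2 * size r)) * (w1 (p.2 x) * ((1 + A ^+ 2) * jb x ^+ 2)) by ring.
rewrite mulr_ege1// /w1 ler_pdivlMl; last by rewrite ltr_wpDr// sqr_ge0.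
rewrite mulr1; have := HA x; have := nrm_ge0 x; rewrite /jb => n0 lA.
have : p.2 x ^+ 2 <= (A * nrm x) ^+ 2 by rewrite -real_normK ?num_real// lerXn2r ?nnegrE ?mulr_ge0.
have : 0 <= A ^+ 2 by rewrite sqr_ge0.
by rewrite exprMn; nra.
Qed.

Lemma wb_slow v (s : R) x : v \in b -> `|s| <= 1 -> wb bl (x + s *: v) <= 4 ^+ size bl * wb bl x.
Proof.
move=> vb s1.
have : forall p, List.In p bl -> linear (p.2 : V -> R^o) /\ `|p.2 v| <= 1.
  move: bo vb; elim: (bl) => [|q r IH] //= [ll lq orth1 orth2 bo'].
  rewrite inE => vb p [<-|pr].
    split=> //; case/predU1P: vb => [->|vr]; first by rewrite lq normr1.
    by rewrite orth1// normr0.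
  case/predU1P: vb => [->|vr]; last by apply: IH.
  split.
    move: bo' pr; clear; elim: r => [|q' r IH] //= [ll _ _ _ bo'] [<-|]; [exact: ll|exact: IH].
  rewrite orth2 ?normr0//; move: pr; clear; elim: r => [|q' r IH] //= [<-|/IH]; [by left|by right].
elim: (bl) => [_|p r IH H]; first by rewrite /wb !big_nil mulr1.
rewrite !wb_cons /= exprS mulrACA ler_pM ?w1_ge0 ?wb_ge0//; last by apply: IH => q qr; apply: H; right.
have [ll lv] := H p (or_introl erefl).
rewrite (form_shift _ _ _ ll) (le_trans (w1_shift 0 _ _))// addr0 ler_wpM2r ?w1_ge0//.
rewrite sub0r sqrrN.
have : `|s * p.2 v| ^+ 2 <= 1 by rewrite expr_le1// normrM mulr_ile1.
by rewrite real_normK ?num_real//; lra.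
Qed.

(** Short increments are bounded by the derivative, for which the weight at the
  two ends is comparable by [wb_slow]; long ones by the two values. *)
Lemma Sb_nice : exists2 K : R, 0 < K & forall k M f, (2 * size bl <= k)%N ->
  Sb b 1 (fun x => jb x ^+ k) M f -> niceC (K * M) f.
Proof.
have [K K0 HK] := jb_wb; exists (2 * (4 ^+ size bl * K)) => [|k M f kn fS].
  by rewrite !mulr_gt0// exprn_gt0.
have M0 : 0 <= M by rewrite (le_trans _ (Sb_bd fS 0))// mulr_ge0 ?jbX_ge0 ?normc_ge0.
have n1 : 1 <= 4 ^+ size bl :> R by rewrite exprn_ege1// ler1n.
have bd h (hM : forall x, jb x ^+ k * normc (h x) <= M) x : normc (h x) <= K * M * wb bl x.
  have h0 := normc_ge0 (h x).
  rewrite -[leLHS]mul1r (@le_trans _ _ (K * wb bl x * jb x ^+ k * normc (h x)))//.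
    rewrite ler_wpM2r// (le_trans (HK x))// ler_wpM2l ?jbX_le//.
    by rewrite mulr_ge0 ?wb_ge0// ltW.
  by rewrite -mulrA [leRHS]mulrAC ler_wpM2l// mulr_ge0 ?wb_ge0// ltW.
have KM0 : 0 <= K * M by rewrite mulr_ge0// ltW.
have KM1 : K * M <= 4 ^+ size bl * K * M by rewrite -mulrA ler_peMl.
split=> [x|v vb s x].
  rewrite (le_trans (bd _ (Sb_bd fS) x))// ler_wpM2r ?wb_ge0//.
  by rewrite -mulrA; apply: (le_trans KM1); lra.
have wx := wb_ge0 bl x; have wsx := wb_ge0 bl (x + s *: v).
have [s1|s1] := leP `|s| 1.
  have [g [fg gS]] := Sb_D fS vb.
  rewrite (@le_trans _ _ (2 * (4 ^+ size bl * K * M * wb bl x) * `|s|))//.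
    apply: isD_incr fg _ => t ts; rewrite (le_trans (bd _ (Sb_bd gS) _))//.
    have -> : 4 ^+ size bl * K * M * wb bl x = K * M * (4 ^+ size bl * wb bl x) by ring.
    by rewrite ler_wpM2l// wb_slow// (le_trans ts).
  have -> : 2 * (4 ^+ size bl * K) * M * `|s| * (wb bl x + wb bl (x + s *: v)) =
    2 * (4 ^+ size bl * K * M * wb bl x) * `|s| + 2 * (4 ^+ size bl * K * M) * `|s| * wb bl (x + s *: v) by ring.
  by rewrite lerDl !mulr_ge0// ltW// exprn_gt0.
rewrite (le_trans (normcB _ _))// (@le_trans _ _ (K * M * (wb bl x + wb bl (x + s *: v))))//.
  by rewrite mulrDr addrC lerD// bd//; exact: Sb_bd fS.
rewrite ler_wpM2r ?addr_ge0//.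
have {}s1 := ltW s1.
rewrite (@le_trans _ _ (2 * (4 ^+ size bl * K * M) * 1))//; first by lra.
have -> : 2 * (4 ^+ size bl * K) * M * `|s| = 2 * (4 ^+ size bl * K * M) * `|s| by ring.
by rewrite ler_wpM2l// !mulr_ge0// ltW// exprn_gt0.
Qed.

Lemma Sch_nice f : Sch f -> exists C, niceC C f.
Proof.
move=> fS; have [K K0 HK] := Sb_nice; have [M HM] := fS b 1%N (2 * size bl)%N.
by exists (K * M); apply: HK HM.
Qed.

(** The size [C'] of [f] gives the bound. It can be much smaller than [C], which
  also measures the Lipschitz constant. *)
Lemma IC_bd_size C C' f : 0 <= C' -> niceC C f -> (forall x, normc (f x) <= C' * wb bl x) ->
  normc (IC f) <= 2 * (C' * pi ^+ size bl).
Proof.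
move=> C0' fn fC; have C0 := niceC_ge0 fn.
have bR x : `|complex.Re (f x)| <= C' * (U0 x * wb bl x).
  by rewrite mul1r (le_trans (ler_Re_normc _)).
have bI x : `|complex.Im (f x)| <= C' * (U0 x * wb bl x).
  by rewrite mul1r (le_trans (ler_Im_normc _)).
rewrite (le_trans (ler_normc_ReIm _))//= mulr2n mulrDl mul1r.
have H := iterR_bd 0 bo C0 C0' U00 Ui bD (niceC_Re fn) bR.
have K := iterR_bd 0 bo C0 C0' U00 Ui bD (niceC_Im fn) bI.
by rewrite lerD// -[leRHS]mulr1.
Qed.

Lemma isD_Sch f g v : Sch f -> isD v f g -> Sch g.
Proof.
move=> fS fg; have [g' [fg' gS]] := Sch_D v fS.
by rewrite (isD_uniq fg fg').
Qed.

(** Compare with the translate by a small multiple of [v], which has the same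
  integral. *)
Lemma IC_isD f g v : v \in b -> Sch f -> isD v f g -> IC g = 0.
Proof.
move=> vb fS fg; have gS := isD_Sch fS fg; have [g2 [gg2 g2S]] := Sch_D v gS.
have [C fn] := Sch_nice fS; have [D gn] := Sch_nice gS; have [B g2n] := Sch_nice g2S.
have B0 := niceC_ge0 g2n.
pose K := 2 * (4 * (4 ^+ size bl * B) * pi ^+ size bl).
have K0 : 0 <= K by rewrite !mulr_ge0// exprn_ge0// pi_ge0.
suff H (h : R) : 0 < h -> h <= 1 -> normc (IC g) <= K * h.
  apply: normc_eq0; apply/eqP; rewrite eq_le normc_ge0 andbT; apply/ler_addgt0Pr => e e0.
  rewrite add0r; pose h := Num.min 1 (e / (K + 1)).
  have K1 : 0 < K + 1 by rewrite ltr_wpDl.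
  have h0 : 0 < h by rewrite lt_min ltr01 divr_gt0.
  rewrite (le_trans (H h h0 _))//; first by rewrite ge_min lexx.
  rewrite (@le_trans _ _ ((K + 1) * h))//; first by rewrite ler_wpM2r ?(ltW h0)// lerDl.
  by rewrite -ler_pdivlMl// mulrC ge_min lexx orbT.
move=> h0 h1.
have [E En] := Sch_nice (Sch_shift (h *: v) fS).
have : normc (IC (fun x => f (x + h *: v) - f x - real_complex R h * g x)) <=
    2 * (4 * (4 ^+ size bl * B) * h ^+ 2 * pi ^+ size bl).
  apply: (IC_bd_size (C := E + C + normc (real_complex R h) * D)).
  - by rewrite !mulr_ge0// ?exprn_ge0// ltW.
  - apply: niceC_D; last exact/niceC_N/niceC_Z.
    by apply: niceC_D => //; exact: niceC_N.
  - move=> x; rewrite [leRHS]mulrAC -[4 * _ * wb bl x]mulrA.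
    apply: (isD_taylor fg gg2) => s sh.
    have [g2C _] := g2n; rewrite (le_trans (g2C _))//.
    have -> : 4 ^+ size bl * B * wb bl x = B * (4 ^+ size bl * wb bl x) by ring.
    by rewrite ler_wpM2l// wb_slow// (le_trans sh)// ger0_norm// ltW.
rewrite (IC_B (C := E + C) (C' := normc (real_complex R h) * D)); first last.
- exact: niceC_Z.
- by apply: niceC_D => //; exact: niceC_N.
rewrite (IC_B En fn) (IC_shift_dir _ fn vb) subrr sub0r (IC_Z _ gn) normcN normcM normc_real (gtr0_norm h0).
have -> : 2 * (4 * (4 ^+ size bl * B) * h ^+ 2 * pi ^+ size bl) = h * (K * h) by rewrite /K; ring.
by rewrite ler_pM2l.
Qed.

(** A second derivative dominated by an integrable weight makes the Taylor
  remainder integrable, hence quadratic after integration. *)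
Lemma IC_under (W : vectType R) (w : W) (F F1 F2 : W -> V -> R[i]) (B : R) :
  (forall y : W, exists C, niceC C (F y)) -> (forall y : W, exists C, niceC C (F1 y)) ->
  (forall x, isD w (F^~ x) (F1^~ x)) -> (forall x, isD w (F1^~ x) (F2^~ x)) ->
  (forall (y : W) x, normc (F2 y x) <= B * wb bl x) ->
  isD w (fun y : W => IC (F y)) (fun y : W => IC (F1 y)).
Proof.
move=> Fn F1n FF FF1 FB; apply: isD_quad => y.
exists (2 * (4 * B * pi ^+ size bl)) => h h1.
have B0 : 0 <= B.
  by have := FB y 0; have := wb_gt0 (0 : V); have := normc_ge0 (F2 y 0); nra.
have [C Cn] := Fn (y + h *: w); have [D Dn] := Fn y; have [E En] := F1n y.
rewrite -(IC_B Cn Dn) -(IC_Z _ En).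
rewrite -(IC_B (niceC_D Cn (niceC_N Dn)) (niceC_Z (real_complex R h) En)).
have -> : 2 * (4 * B * pi ^+ size bl) * h ^+ 2 = 2 * ((4 * B * h ^+ 2) * pi ^+ size bl) by ring.
apply: IC_bd_size.
- by rewrite mulr_ge0 ?sqr_ge0// mulr_ge0.
- exact: niceC_D (niceC_D Cn (niceC_N Dn)) (niceC_N (niceC_Z (real_complex R h) En)).
- move=> x; rewrite [leRHS]mulrAC -[4 * B * _]mulrA.
  apply: (isD_taylor (FF x) (FF1 x)) => s _; exact: FB.
Qed.

Section Spanning.
Hypothesis span : forall y, y = \sum_(p <- bl) p.2 y *: p.1.

Lemma IC_shift f y : Sch f -> IC (fun x => f (x + y)) = IC f.
Proof.
move=> fS; rewrite (span y).
have : {subset unzip1 bl <= b} by [].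
elim: {1 3}bl => [_|p r IH rb].
  by rewrite big_nil; congr IC; apply/funext => x; rewrite addr0.
rewrite big_cons -IH => [|u ur]; last by apply: rb; rewrite inE ur orbT.
have [C Cn] := Sch_nice (Sch_shift (\sum_(q <- r) q.2 y *: q.1) fS).
rewrite -(IC_shift_dir (p.2 y) Cn (rb _ (mem_head _ _))).
by congr IC; apply/funext => x; rewrite addrA.
Qed.

End Spanning.

End ComplexIntegral.

(** * Functions of a point and a parameter *)

Section Products.
Context {R : realType}.
Implicit Types U V W : vectType R.

Lemma seq_bound (T : eqType) (Q : T -> R -> Prop) (s : seq T) :
  (forall x C C', C <= C' -> Q x C -> Q x C') -> (forall x, x \in s -> exists C, Q x C) ->
  exists C, forall x, x \in s -> Q x C.
Proof.
move=> Qm; elim: s => [_|x s IH H]; first by exists 0.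
have [|C HC] := IH; first by move=> y ys; apply: H; rewrite inE ys orbT.
have [D HD] := H x (mem_head _ _).
exists (Num.max C D) => y; rewrite inE => /predU1P[->|/HC].
  by apply: Qm HD; rewrite le_max lexx orbT.
by apply: Qm; rewrite le_max lexx.
Qed.

Lemma linear_fst V W : linear (fst : V * W -> V). Proof. by []. Qed.

Lemma linear_snd V W : linear (snd : V * W -> W). Proof. by []. Qed.

Lemma linear_inl V W : linear (fun v : V => (v, 0 : W)).
Proof. by move=> c x y; rewrite -[RHS]/(c *: x + y, c *: (0 : W) + 0) scaler0 addr0. Qed.

Lemma linear_inr V W : linear (fun w : W => (0 : V, w)).
Proof. by move=> c x y; rewrite -[RHS]/(c *: (0 : V) + 0, c *: x + y) scaler0 addr0. Qed.

Lemma pairE V W (v : V) (w : W) : (v, w) = (v, 0) + (0, w) :> V * W.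
Proof. by rewrite -[RHS]/(v + 0, 0 + w) addr0 add0r. Qed.

Lemma jb_fst V W : exists2 C : R, 0 < C & forall p : V * W, jb p.1 <= C * jb p.
Proof.
have [C C0 HC] := affine_jb 0 (@linear_fst V W); exists C => // p.
by have := HC p; rewrite addr0.
Qed.

Lemma jb_snd V W : exists2 C : R, 0 < C & forall p : V * W, jb p.2 <= C * jb p.
Proof.
have [C C0 HC] := affine_jb 0 (@linear_snd V W); exists C => // p.
by have := HC p; rewrite addr0.
Qed.

Lemma jb_pair V W : exists2 C : R, 0 < C & forall (v : V) (w : W), jb (v, w) <= C * (jb v * jb w).
Proof.
have [C C0 HC] := affine_jb 0 (@linear_inl V W).
have [D D0 HD] := affine_jb 0 (@linear_inr V W).
exists (C * D) => [|v w]; first by rewrite mulr_gt0.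
rewrite pairE (le_trans (jbD _ _))// mulrACA ler_pM ?jb_ge0//.
  by have := HC v; rewrite addr0.
by have := HD w; rewrite addr0.
Qed.

Lemma nrm_pair V W : exists2 C : R, 0 <= C & forall p : V * W, nrm p <= C * (nrm p.1 + nrm p.2).
Proof.
have [C C0 HC] := linear_nrm (@linear_inl V W).
have [D D0 HD] := linear_nrm (@linear_inr V W).
exists (C + D) => [|[v w]]; first by rewrite addr_ge0.
have h1 : nrm v <= nrm v + nrm w by rewrite lerDl nrm_ge0.
have h2 : nrm w <= nrm v + nrm w by rewrite lerDr nrm_ge0.
rewrite [X in nrm X](pairE v w) mulrDl; apply: (le_trans (nrmD _ _)); apply: lerD.
  by apply: (le_trans (HC v)); exact: (ler_wpM2l C0 h1).
by apply: (le_trans (HD w)); exact: (ler_wpM2l D0 h2).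
Qed.

Lemma Sch_swap V W (b : V * W -> R[i]) : Sch b -> Sch (fun p : W * V => b (p.2, p.1)).
Proof.
move=> bS; have lL : linear (fun p : W * V => (p.2, p.1) : V * W) by [].
have [C C0 HC] := linear_nrm (L := fun p : V * W => (p.2, p.1) : W * V) (fun _ _ _ => erefl).
have := @Sch_pull R _ _ (fun p : W * V => (p.2, p.1) : V * W) 0 b (1 + C) lL.
have e (p : W * V) : ((p.2, p.1) : V * W) + 0 = (p.2, p.1) by rewrite addr0.
move=> /(_ _ bS) H; have {}H := H _; have : Sch (fun p : W * V => b ((p.2, p.1) + 0)).
  by apply: H => -[w v]; rewrite addr0; apply: jb_le => //; exact: (HC (v, w)).
by congr Sch; apply/funext => p; rewrite addr0.
Qed.

(** Powers of the weight of the pair dominate products of powers of the weights of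
  the two components. *)
Lemma Sch_fiber V W (b : V * W -> R[i]) s n k l : Sch b ->
  exists M, forall v, Sb s n (fun w => jb v ^+ l * jb w ^+ k) M (fun w => b (v, w)).
Proof.
move=> bS; have [M HM] := bS (map (fun w : W => (0 : V, w)) s) n (l + k)%N.
have [C C0 HC] := jb_fst V W; have [D D0 HD] := jb_snd V W.
exists (C ^+ l * D ^+ k * M) => v.
have := Sb_pull (v, 0) (@linear_inr V W) HM.
have e w : ((0, w) : V * W) + (v, 0) = (v, w) by rewrite addrC -pairE.
have -> : (fun y : W => b ((0, y) + (v, 0))) = fun w => b (v, w).
  by apply/funext => w; rewrite e.
apply: (Sb_weaken (c := C ^+ l * D ^+ k)) => // [|w].
  by rewrite mulr_ge0// exprn_ge0// ltW.
rewrite e exprD mulrACA -!exprMn ler_pM ?exprn_ge0 ?jb_ge0 ?mulr_ge0 ?jb_ge0 ?(ltW C0) ?(ltW D0)//.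
  by rewrite lerXn2r ?nnegrE ?mulr_ge0 ?jb_ge0 ?(ltW C0)// (HC (v, w)).
by rewrite lerXn2r ?nnegrE ?mulr_ge0 ?jb_ge0 ?(ltW D0)// (HD (v, w)).
Qed.

Lemma Sch_fiber_Sch V W (b : V * W -> R[i]) v : Sch b -> Sch (fun w => b (v, w)).
Proof.
move=> bS s n k; have [M HM] := Sch_fiber s n k 0 bS; exists M.
by have := HM v; congr Sb; apply/funext => w; rewrite expr0 mul1r.
Qed.

Lemma Sch_fiber_Schl V W (b : V * W -> R[i]) w : Sch b -> Sch (fun v => b (v, w)).
Proof. by move=> /Sch_swap/(@Sch_fiber_Sch W V _ w). Qed.

Lemma isD_fiber V W (b b' : V * W -> R[i]) (u : W) v : isD (0, u) b b' ->
  isD u (fun w => b (v, w)) (fun w => b' (v, w)).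
Proof.
move=> bb; have := @isD_comp_affine R (V * W)%type W (fun w => (0, w)) (v, 0) u b b' (@linear_inr V W) bb.
have e w : ((0, w) : V * W) + (v, 0) = (v, w) by rewrite addrC -pairE.
by congr isD; apply/funext => w; rewrite e.
Qed.

Lemma isD_fiberl V W (b b' : V * W -> R[i]) (u : V) w : isD (u, 0) b b' ->
  isD u (fun v => b (v, w)) (fun v => b' (v, w)).
Proof.
move=> bb; have := @isD_comp_affine R (V * W)%type V (fun v => (v, 0)) (0, w) u b b' (@linear_inl V W) bb.
have e v : ((v, 0) : V * W) + (0, w) = (v, w) by rewrite -pairE.
by congr isD; apply/funext => v; rewrite e.
Qed.

Section Fibre.
Variables (V W : vectType R) (bl : seq (W * (W -> R))).
Hypothesis bo : biorth bl.

Lemma fiber_nice (b : V * W -> R[i]) l : Sch b ->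
  exists2 M, 0 <= M & forall v, niceC bl (M * jb v ^- l) (fun w => b (v, w)).
Proof.
move=> bS; have [K K0 HK] := Sb_nice bo.
have [M HM] := Sch_fiber (unzip1 bl) 1 (2 * size bl) l bS.
have M0 : 0 <= M.
  by rewrite (le_trans _ (Sb_bd (HM 0) 0))// !mulr_ge0 ?normc_ge0 ?jbX_ge0.
exists (K * M) => [|v]; first by rewrite mulr_ge0// ltW.
rewrite -mulrA; apply: (HK (2 * size bl)%N) => //.
apply: (Sb_weaken (c := jb v ^- l)) (HM v) => //; first by rewrite invr_ge0 jbX_ge0.
  by move=> w; rewrite mulrA mulVf ?mul1r// gt_eqF ?jbX_gt0.
by rewrite mulrC.
Qed.

(** Parametric functionals: a functional on the fibres which is bounded on the
  integrable class and commutes with derivatives in the parameter produces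
  symbol bounds, with a constant independent of the functional. Integration,
  evaluation, differences and quadrature errors are all of this kind. *)
Definition parametric (L : (W -> R[i]) -> R[i]) (e : R) :=
  [/\ 0 <= e, forall C g, niceC bl C g -> normc (L g) <= e * C &
    forall u (b b' : V * W -> R[i]), Sch b -> Sch b' -> isD (u, 0) b b' ->
      isD u (fun v => L (fun w => b (v, w))) (fun v => L (fun w => b' (v, w)))].

Lemma parametric_Sb (b : V * W -> R[i]) s n k : Sch b ->
  exists2 C, 0 <= C & forall L e, parametric L e ->
    Sb s n (fun v => jb v ^+ k) (e * C) (fun v => L (fun w => b (v, w))).
Proof.
elim: n b => [|n IH] b bS; have [M M0 HM] := fiber_nice k bS.
  exists M => // L e [e0 Lb _]; split=> // v.
  rewrite (le_trans (ler_wpM2l (jbX_ge0 v k) (Lb _ _ (HM v))))//.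
  rewrite mulrCA (mulrCA (jb v ^+ k)) mulfV ?mulr1//.
  by rewrite gt_eqF ?jbX_gt0.
pose Q u C := forall L e, parametric L e ->
  exists g, isD u (fun v => L (fun w => b (v, w))) g /\ Sb s n (fun v => jb v ^+ k) (e * C) g.
have [||C HC] := @seq_bound V Q s.
- move=> u C C' CC H L e Le; have [g [Lg gS]] := H L e Le; exists g; split=> //.
  by apply: Sb_mono gS => //; have [e0 _ _] := Le; rewrite ler_wpM2l.
- move=> u us; have [b' [bb' bS']] := Sch_D (u, 0) bS.
  have [C C0 HC] := IH b' bS'; exists C => L e Le.
  exists (fun v => L (fun w => b' (v, w))); split; last exact: HC.
  by have [_ _ LD] := Le; exact: LD.
exists (Num.max M C); first by rewrite le_max M0.
move=> L e Le; have [e0 Lb _] := Le; split.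
  move=> v; apply: (@le_trans _ _ (e * M)); last by rewrite ler_wpM2l// le_max lexx.
  rewrite (le_trans (ler_wpM2l (jbX_ge0 v k) (Lb _ _ (HM v))))//.
  rewrite mulrCA (mulrCA (jb v ^+ k)) mulfV ?mulr1//.
  by rewrite gt_eqF ?jbX_gt0.
move=> u us; have [g [Lg gS]] := HC u us L e Le; exists g; split=> //.
by apply: Sb_mono gS => //; rewrite ler_wpM2l// le_max lexx orbT.
Qed.

Lemma parametric_IC : parametric (IC bl) (2 * pi ^+ size bl).
Proof.
split=> [|C g gn|u b b' bS bS' bb'].
- by rewrite mulr_ge0// exprn_ge0// pi_ge0.
- by rewrite (le_trans (IC_bd bo gn))// mulrA mulrAC.
have [b2 [bb2 bS2]] := Sch_D (u, 0) bS'.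
have [M M0 HM] := fiber_nice 0 bS2.
apply: (IC_under bo (F := fun v w => b (v, w)) (F1 := fun v w => b' (v, w))
  (F2 := fun v w => b2 (v, w)) (B := M)).
- by move=> v; apply: (Sch_nice bo); exact: Sch_fiber_Sch.
- by move=> v; apply: (Sch_nice bo); exact: Sch_fiber_Sch.
- by move=> w; exact: isD_fiberl.
- by move=> w; exact: isD_fiberl.
- by move=> v w; have [H _] := HM v; have := H w; rewrite expr0 invr1 mulr1.
Qed.

Lemma parametric_eval w : parametric (fun g => g w) (wb bl w).
Proof.
split=> [|C g [gC _]|u b b' _ _ bb']; first exact: wb_ge0.
  by rewrite mulrC.
exact: isD_fiberl.
Qed.

Lemma parametric_diff w (t : R) u : u \in unzip1 bl ->
  parametric (fun g => g (w + t *: u) - g w) (`|t| * (wb bl w + wb bl (w + t *: u))).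
Proof.
move=> ub; split=> [|C g [_ gL]|u' b b' _ _ bb'].
- by rewrite mulr_ge0// addr_ge0// wb_ge0.
- by rewrite mulrC mulrA; exact: gL.
- by apply: isDB; exact: isD_fiberl.
Qed.

Lemma parametric_quad e (P : seq (R * W)) : 0 <= e ->
  (forall C f, niceC bl C f -> normc (IC bl f - \sum_(p <- P) real_complex R p.1 * f p.2) <= e * C) ->
  parametric (fun f => IC bl f - \sum_(p <- P) real_complex R p.1 * f p.2) e.
Proof.
move=> e0 HP; split=> // u b b' bS bS' bb'.
apply: isDB; first by have [_ _] := parametric_IC; apply.
apply: isD_sum => p; apply: isDZ; exact: isD_fiberl.
Qed.

Lemma IC_Sch (b : V * W -> R[i]) : Sch b -> Sch (fun v => IC bl (fun w => b (v, w))).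
Proof.
move=> bS s n k; have [C C0 HC] := parametric_Sb s n k bS.
by exists (2 * pi ^+ size bl * C); exact: HC parametric_IC.
Qed.

(** A tempered distribution commutes with integration over a parameter: both
  sides are approximated by the same quadrature. *)
Section Exchange.
Variable T : (V -> R[i]) -> R[i].
Hypothesis hT : tempered T.

Lemma tempered_nice (b : V * W -> R[i]) : Sch b ->
  exists C, niceC bl C (fun w => T (fun v => b (v, w))).
Proof.
move=> bS; have [A [k [A0 HA]]] := tempered_bd hT.
have [C C0 HC] := parametric_Sb ebasis k k bS.
exists (A * C); split=> [w|u ub t w].
  rewrite -mulrA [C * _]mulrC; apply: HA; first exact: Sch_fiber_Schl.
  exact: HC (parametric_eval w).
rewrite -(tempered_sub hT); [|exact: Sch_fiber_Schl|exact: Sch_fiber_Schl].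
rewrite -!mulrA; apply: HA.
  by apply: Sch_sub; exact: Sch_fiber_Schl.
by rewrite mulrC; exact: HC (parametric_diff w t ub).
Qed.

Lemma tempered_IC (b : V * W -> R[i]) : Sch b ->
  T (fun v => IC bl (fun w => b (v, w))) = IC bl (fun w => T (fun v => b (v, w))).
Proof.
move=> bS; have [A [k [A0 HA]]] := tempered_bd hT.
have [C C0 HC] := parametric_Sb ebasis k k bS.
have [D Dn] := tempered_nice bS; have D0 := niceC_ge0 Dn.
apply/eqP; rewrite -subr_eq0; apply/eqP; apply: normc_eq0; apply/eqP.
rewrite eq_le normc_ge0 andbT; apply/ler_addgt0Pr => e e0; rewrite add0r.
have E0 : 0 < A * C + D + 1 by rewrite ltr_wpDl// addr_ge0// mulr_ge0.
pose e' := e / (A * C + D + 1); have e'0 : 0 < e' by rewrite divr_gt0.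
have [P HP] := IC_quad bo e'0.
have H1 := HP _ _ Dn.
have H2 : normc (T (fun v => IC bl (fun w => b (v, w))) -
    \sum_(p <- P) real_complex R p.1 * T (fun v => b (v, p.2))) <= A * (e' * C).
  have FS (p : R * W) : Sch (fun v => real_complex R p.1 * b (v, p.2)).
    by apply: Sch_scale; exact: Sch_fiber_Schl.
  have -> : \sum_(p <- P) real_complex R p.1 * T (fun v => b (v, p.2)) =
      T (fun v => \sum_(p <- P) real_complex R p.1 * b (v, p.2)).
    rewrite (tempered_sum hT)//; apply: eq_bigr => p _.
    by rewrite (tempered_scale hT)//; exact: Sch_fiber_Schl.
  rewrite -(tempered_sub hT); [|exact: IC_Sch|exact: Sch_sum].
  apply: HA; first by apply: Sch_sub; [exact: IC_Sch|exact: Sch_sum].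
  exact: HC (parametric_quad (ltW e'0) HP).
rewrite -(subrK (\sum_(p <- P) real_complex R p.1 * T (fun v => b (v, p.2))) (T _)) -addrA.
rewrite normc_distC in H1.
rewrite (le_trans (normcD _ _))// (le_trans (lerD H2 H1))//.
have -> : e = e' * (A * C + D + 1) by rewrite /e' divfK// gt_eqF.
rewrite [A * _]mulrCA -mulrDr ler_wpM2l ?(ltW e'0)// lerDl//.
Qed.

End Exchange.

End Fibre.

(** By the argument of [tempered_IC]: the error of a quadrature in the second
  variable is small as a Schwartz function of the first. *)
Lemma IC_Fubini V W (bV : seq (V * (V -> R))) (bW : seq (W * (W -> R))) (b : V * W -> R[i]) :
  biorth bV -> biorth bW -> Sch b ->
  IC bV (fun v => IC bW (fun w => b (v, w))) = IC bW (fun w => IC bV (fun v => b (v, w))).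
Proof.
move=> oV oW bS.
have [C C0 HC] := parametric_Sb oW (unzip1 bV) 1 (2 * size bV) bS.
have bS' := Sch_swap bS; have [D Dn] := Sch_nice oW (IC_Sch oV bS').
have D0 := niceC_ge0 Dn; have [K K0 HK] := Sb_nice oV.
pose A : R := 2 * (K * C * pi ^+ size bV).
have A0 : 0 <= A by rewrite !mulr_ge0// ?exprn_ge0 ?pi_ge0// ltW.
apply/eqP; rewrite -subr_eq0; apply/eqP; apply: normc_eq0; apply/eqP.
rewrite eq_le normc_ge0 andbT; apply/ler_addgt0Pr => e e0; rewrite add0r.
have E0 : 0 < A + D + 1 by rewrite ltr_wpDl// addr_ge0.
pose e' := e / (A + D + 1); have e'0 : 0 < e' by rewrite divr_gt0.
have [P HP] := IC_quad oW e'0.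
have H1 := HP _ _ Dn.
have H2 : normc (IC bV (fun v => IC bW (fun w => b (v, w))) -
    \sum_(p <- P) real_complex R p.1 * IC bV (fun v => b (v, p.2))) <= A * e'.
  have nF (p : R * W) := Sch_nice oV (Sch_scale (real_complex R p.1) (Sch_fiber_Schl p.2 bS)).
  have [N HN] := choice nF.
  have -> : \sum_(p <- P) real_complex R p.1 * IC bV (fun v => b (v, p.2)) =
      IC bV (fun v => \sum_(p <- P) real_complex R p.1 * b (v, p.2)).
    rewrite (IC_sum oV _ HN); apply: eq_bigr => p _.
    by have [M Mn] := Sch_nice oV (Sch_fiber_Schl p.2 bS); rewrite (IC_Z oV _ Mn).
  have [M Mn] := Sch_nice oV (IC_Sch oW bS).
  rewrite -(IC_B oV Mn (niceC_sum P HN)).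
  have := HK _ _ _ (leqnn _) (HC _ _ (@parametric_quad V W bW oW e' P (ltW e'0) HP)).
  move=> /(IC_bd oV)/le_trans; apply; rewrite /A.
  by have -> : 2 * (K * (e' * C) * pi ^+ size bV) = 2 * (K * C * pi ^+ size bV) * e' by ring.
rewrite -(subrK (\sum_(p <- P) real_complex R p.1 * IC bV (fun v => b (v, p.2))) (IC _ _)) -addrA.
rewrite normc_distC in H1.
rewrite (le_trans (normcD _ _))// (le_trans (lerD H2 H1))//.
have -> : e = e' * (A + D + 1) by rewrite /e' divfK// gt_eqF.
by rewrite [A * _]mulrC -mulrDr ler_wpM2l ?(ltW e'0)// lerDl.
Qed.

End Products.

(** * Fourier transforms *)

Section PartialFourier.
Context {R : realType}.
Variables (V W S : vectType R) (bl : seq (W * (W -> R))) (B : S -> W -> R).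
Hypothesis bo : biorth bl.
Hypothesis Bl : forall w, linear (B^~ w : S -> R^o).
Hypothesis Br : forall s, linear (B s : W -> R^o).
Hypothesis BS : exists2 A : R, 0 <= A & forall s, nrm s <= A * \sum_(w <- unzip1 bl) `|B s w|.

Lemma Mod_cisr s : Mod (fun w => cis (B s w)).
Proof.
apply: (@Mod_cis _ _ _ (fun _ _ => 0) (fun=> 0) (B s)) => [x v t|v c x y].
  by rewrite (form_shift _ _ _ (Br s)); ring.
by rewrite -[RHS]/(c * 0 + 0) mulr0 addr0.
Qed.

Lemma isD_cisr s (u : W) :
  isD u (fun w => cis (B s w)) (fun w => Complex 0 (B s u) * cis (B s w)).
Proof.
apply: (isD_cis (Q2 := fun=> 0)) => x t.
by rewrite (form_shift _ _ _ (Br s)); ring.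
Qed.

(** Fourier transform in the second variable, for the pairing [B]. *)
Definition PF (b : V * W -> R[i]) (p : V * S) : R[i] :=
  IC bl (fun w => cis (B p.2 w) * b (p.1, w)).

Lemma PF_integrand (b : V * W -> R[i]) p : Sch b -> Sch (fun w => cis (B p.2 w) * b (p.1, w)).
Proof.
move=> bS; have := Sch_mul_Mod (Sch_fiber_Sch p.1 bS) (Mod_cisr p.2).
by congr Sch; apply/funext => w; rewrite mulrC.
Qed.

Lemma PF_Z c b p : Sch b -> PF (fun q => c * b q) p = c * PF b p.
Proof.
move=> bS; have [C Cn] := Sch_nice bo (PF_integrand p bS).
by rewrite /PF -(IC_Z bo c Cn); congr IC; apply/funext => w; rewrite mulrCA.
Qed.

(** Integration by parts. *)
Lemma PF_mulS (b b' : V * W -> R[i]) u p : u \in unzip1 bl -> Sch b -> isD (0, u) b b' ->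
  real_complex R (B p.2 u) * PF b p = PF (fun q => Complex 0 1 * b' q) p.
Proof.
move=> ub bS bb'; have bS' := isD_Sch bS bb'.
have gS := PF_integrand p bS.
have gD : isD u (fun w => cis (B p.2 w) * b (p.1, w))
    (fun w => Complex 0 (B p.2 u) * cis (B p.2 w) * b (p.1, w) + cis (B p.2 w) * b' (p.1, w)).
  by apply: isDM; [exact: isD_cisr|exact: isD_fiber].
have := IC_isD bo ub gS gD.
have [C Cn] := Sch_nice bo gS; have [D Dn] := Sch_nice bo (PF_integrand p bS').
rewrite (_ : (fun w => _) = fun w => Complex 0 (B p.2 u) * (cis (B p.2 w) * b (p.1, w)) +
   cis (B p.2 w) * b' (p.1, w)); last by apply/funext => w; rewrite mulrA.
rewrite (IC_D bo (niceC_Z _ Cn) Dn) (IC_Z bo _ Cn) => E.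
have E' : Complex 0 (B p.2 u) * PF b p = - PF b' p.
  by apply/eqP; rewrite -addr_eq0; apply/eqP.
have := congr1 (fun z => - Complex 0 1 * z) E'.
rewrite PF_Z// => E''; rewrite -[RHS]opprK -mulNr -[RHS]mulrN -E'' mulrA; congr (_ * _).
by apply: complexE; rewrite ?ReM ?ImM /=; ring.
Qed.

(** The symbol of the derivative in direction [(v, s)]. *)
Definition PFd (s : S) (b b' : V * W -> R[i]) (q : V * W) : R[i] :=
  Complex 0 (B s q.2) * b q + b' q.

Lemma PFd_Sch s b b' : Sch b -> Sch b' -> Sch (PFd s b b').
Proof.
move=> bS bS'; apply: Sch_add => //.
have ll : linear (fun q : V * W => B s q.2 : R^o) by move=> c x y; exact: Br.
have := Sch_scale (Complex 0 1) (Sch_mul_Mod bS (Mod_form ll)).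
congr Sch; apply/funext => q; rewrite mulrCA mulrC; congr (_ * _).
by apply: complexE; rewrite ?ReM ?ImM /=; ring.
Qed.

Lemma PF_isD_integrand (b b' : V * W -> R[i]) (v : V) (s : S) w : isD (v, 0) b b' ->
  isD (v, s) (fun p : V * S => cis (B p.2 w) * b (p.1, w))
    (fun p => cis (B p.2 w) * PFd s b b' (p.1, w)).
Proof.
move=> bb'.
have c1 : isD (v, s) (fun p : V * S => cis (B p.2 w)) (fun p => Complex 0 (B s w) * cis (B p.2 w)).
  apply: (isD_cis (Q2 := fun=> 0)) => x t.
  have -> : B (x + t *: (v, s)).2 w = B x.2 w + t * B s w.
    exact: (@form_shift _ _ (B^~ w) x.2 t s (Bl w)).
  by ring.
have l1 : linear (fun p : V * S => (p.1, 0 : W)).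
  by move=> c x y; rewrite -[RHS]/(c *: x.1 + y.1, c *: (0 : W) + 0) scaler0 addr0.
have c2 := @isD_comp_affine R _ _ (fun p : V * S => (p.1, 0 : W)) (0, w) (v, s) b b' l1 bb'.
have e (p : V * S) : ((p.1, 0) : V * W) + (0, w) = (p.1, w) by rewrite -pairE.
have := isDM c1 c2.
congr isD; apply/funext => p; rewrite e// /PFd /=; ring.
Qed.

Lemma PF_isD (b b' : V * W -> R[i]) (v : V) (s : S) : Sch b -> isD (v, 0) b b' ->
  isD (v, s) (PF b) (PF (PFd s b b')).
Proof.
move=> bS bb'; have bS' := isD_Sch bS bb'; have dS := PFd_Sch s bS bS'.
have [d' [dd' dS']] := Sch_D (v, 0) dS.
have [M M0 HM] := fiber_nice bo 0 (PFd_Sch s dS dS').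
apply: (IC_under bo (F := fun p w => cis (B p.2 w) * b (p.1, w))
  (F1 := fun p w => cis (B p.2 w) * PFd s b b' (p.1, w))
  (F2 := fun p w => cis (B p.2 w) * PFd s (PFd s b b') d' (p.1, w)) (B := M)).
- by move=> p; apply: (Sch_nice bo); exact: PF_integrand.
- by move=> p; apply: (Sch_nice bo); exact: PF_integrand.
- by move=> w; exact: PF_isD_integrand.
- by move=> w; exact: PF_isD_integrand.
- move=> p w; rewrite normcM normc_cis mul1r.
  by have [H _] := HM p.1; have := H w; rewrite expr0 invr1 mulr1.
Qed.

(** The coordinates of [p.1] can be moved into the symbol, those of [p.2] become
  derivatives of the symbol by [PF_mulS]; induct on the weight. *)
Lemma PF_bd (b : V * W -> R[i]) k : Sch b -> exists M, forall p, jb p ^+ k * normc (PF b p) <= M.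
Proof.
elim: k b => [|k IH] b bS.
  have [M M0 HM] := fiber_nice bo 0 bS.
  exists (2 * (M * pi ^+ size bl)) => p; rewrite expr0 mul1r.
  have [C Cn] := Sch_nice bo (PF_integrand p bS).
  apply: (IC_bd_size bo M0 Cn) => w; rewrite normcM normc_cis mul1r.
  by have [H _] := HM p.1; have := H w; rewrite expr0 invr1 mulr1.
have [A A0 HA] := BS; have [C0 C00 HC0] := nrm_pair V S.
have [M0 H0] := IH b bS.
have H1 (i : 'I_(\dim {:V})) : exists M, forall p, jb p ^+ k * (`|coord ebasis i p.1| * normc (PF b p)) <= M.
  have ll : linear (fun q : V * W => coord ebasis i q.1 : R^o).
    by move=> c x y; rewrite /= linearP.
  have S1 := Sch_mul_Mod bS (Mod_form ll).
  have [M HM] := IH _ S1; exists M => p; have := HM p.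
  have [C Cn] := Sch_nice bo (PF_integrand p bS).
  rewrite /PF (_ : (fun w => _) = fun w => real_complex R (coord ebasis i p.1) * (cis (B p.2 w) * b (p.1, w))).
    by rewrite (IC_Z bo _ Cn) normcM normc_real.
  by apply/funext => w /=; ring.
have H2 u : exists M, u \in unzip1 bl -> forall p, jb p ^+ k * (`|B p.2 u| * normc (PF b p)) <= M.
  have [ub|] := boolP (u \in unzip1 bl); last by exists 0.
  have [b' [bb' bS']] := Sch_D (0, u) bS.
  have [M HM] := IH _ (Sch_scale (Complex 0 1) bS').
  by exists M => _ p; rewrite -normc_real -normcM (PF_mulS p ub bS bb').
have [M1 {}H1] := choice H1; have [M2 {}H2] := choice H2.
exists (M0 + C0 * (\sum_i M1 i + A * \sum_(u <- unzip1 bl) M2 u)) => p.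
set N := normc (PF b p).
have N0 : 0 <= N by exact: normc_ge0.
have jp : jb p <= 1 + C0 * (\sum_i `|coord ebasis i p.1| + A * \sum_(u <- unzip1 bl) `|B p.2 u|).
  rewrite lerD2l (le_trans (HC0 p))// ler_wpM2l// lerD2l; exact: HA.
rewrite exprSr -mulrA (le_trans (ler_wpM2l (jbX_ge0 p k) (ler_wpM2r N0 jp)))//.
set X := _ + A * _; have -> : jb p ^+ k * ((1 + C0 * X) * N) = jb p ^+ k * N + C0 * (jb p ^+ k * (X * N)) by ring.
apply: lerD; first exact: H0.
apply: ler_wpM2l => //; rewrite /X mulrDl mulrDr; apply: lerD.
  rewrite mulr_suml mulr_sumr; apply: ler_sum => i _; exact: H1.
rewrite -mulrA mulrCA ler_wpM2l// mulr_suml mulr_sumr big_seq [leRHS]big_seq.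
apply: ler_sum => u ub; exact: H2.
Qed.

Lemma PF_Sch (b : V * W -> R[i]) : Sch b -> Sch (PF b).
Proof.
move=> bS s n k; elim: n b bS => [|n IH] b bS.
  by have [M HM] := PF_bd k bS; exists M.
apply: SbS => [p||u _]; [exact: jbX_ge0|exact: PF_bd|].
have [b' [bb' bS']] := Sch_D (u.1, 0) bS.
have [M HM] := IH _ (PFd_Sch u.2 bS bS').
exists (PF (PFd u.2 b b')), M; split=> //.
by case: u bb' {HM} => v t; exact: PF_isD.
Qed.

End PartialFourier.

Section FullFourier.
Context {R : realType}.
Variables (W S : vectType R) (bl : seq (W * (W -> R))) (B : S -> W -> R).
Hypothesis bo : biorth bl.
Hypothesis Bl : forall w, linear (B^~ w : S -> R^o).
Hypothesis Br : forall s, linear (B s : W -> R^o).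
Hypothesis BS : exists2 A : R, 0 <= A & forall s, nrm s <= A * \sum_(w <- unzip1 bl) `|B s w|.

Definition FT (f : W -> R[i]) (s : S) : R[i] := IC bl (fun w => cis (B s w) * f w).

Lemma FT_integrand f s : Sch f -> Sch (fun w => cis (B s w) * f w).
Proof.
move=> fS; have := Sch_mul_Mod fS (Mod_cisr Br s).
by congr Sch; apply/funext => w; rewrite mulrC.
Qed.

(** The full transform is the partial one with a trivial parameter space. *)
Lemma FT_Sch f : Sch f -> Sch (FT f).
Proof.
move=> fS; pose Z := 'rV[R]_0.
have lL : linear (fun p : Z * W => p.2) by [].
have bS : Sch (fun p : Z * W => f p.2).
  have [C C0 HC] := jb_pair Z W.
  have := @Sch_pull R _ _ (fun p : Z * W => p.2) 0 f C lL.
  move=> /(_ _ fS) H; have : Sch (fun p : Z * W => f (p.2 + 0)).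
    apply: H => -[z w]; rewrite addr0 (le_trans (HC z w))//.
    by rewrite [z]thinmx0 {1}/jb nrm0 addr0 mul1r.
  by congr Sch; apply/funext => p; rewrite addr0.
have := Sch_fiber_Sch (0 : Z) (PF_Sch bo Bl Br BS bS).
by [].
Qed.

(** Integration by parts, quantitatively: decay of the transform is controlled
  by finitely many derivatives. *)
Lemma FT_decay L : exists2 C, 0 <= C & forall M f s, Sch f ->
  Sb (unzip1 bl) L (fun w => jb w ^+ (2 * size bl)) M f ->
  jb s ^+ L * normc (FT f s) <= C * M.
Proof.
have [K K0 HK] := Sb_nice bo; have [A A0 HA] := BS.
have [K1 K10 HK1] := jb_wb bo.
elim: L => [|L [C C0 HC]].
  exists (2 * (K1 * pi ^+ size bl)) => [|M f s fS fM].
    by rewrite !mulr_ge0// ?exprn_ge0 ?pi_ge0// ltW.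
  have M0 : 0 <= M by rewrite (le_trans _ (Sb_bd fM 0))// mulr_ge0 ?jbX_ge0 ?normc_ge0.
  have [D Dn] := Sch_nice bo (FT_integrand s fS).
  rewrite expr0 mul1r.
  have -> : 2 * (K1 * pi ^+ size bl) * M = 2 * ((K1 * M) * pi ^+ size bl) by ring.
  apply: (IC_bd_size bo _ Dn) => [|w]; first by rewrite mulr_ge0// ltW.
  rewrite normcM normc_cis mul1r.
  have f0 := normc_ge0 (f w).
  rewrite -[leLHS]mul1r (le_trans (ler_wpM2r f0 (HK1 w)))//.
  rewrite -(mulrA (K1 * wb bl w)) [leRHS]mulrAC ler_wpM2l ?(Sb_bd fM w)//.
  by rewrite mulr_ge0 ?wb_ge0// ltW.
exists (C * (1 + A *+ size bl)) => [|M f s fS fM].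
  by rewrite mulr_ge0// addr_ge0// mulrn_wge0.
have M0 : 0 <= M by rewrite (le_trans _ (Sb_bd fM 0))// mulr_ge0 ?jbX_ge0 ?normc_ge0.
have N0 := normc_ge0 (FT f s).
have js : jb s <= 1 + A * \sum_(w <- unzip1 bl) `|B s w| by rewrite lerD2l HA.
rewrite exprSr -mulrA (le_trans (ler_wpM2l (jbX_ge0 s L) (ler_wpM2r N0 js)))//.
rewrite mulrDl mul1r mulrDr.
have -> : C * (1 + A *+ size bl) * M = C * M + A * ((C * M) *+ size bl).
  by rewrite -[A *+ _]mulr_natr -[C * M *+ _]mulr_natr; ring.
rewrite lerD//; first by apply: HC => //; apply: Sb_mono fM.
rewrite -mulrA mulrCA ler_wpM2l// mulr_suml mulr_sumr.
have -> : C * M *+ size bl = \sum_(u <- unzip1 bl) C * M.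
  by rewrite big_const_seq count_predT iter_addr_0 size_map.
rewrite big_seq [leRHS]big_seq.
apply: ler_sum => u ub.
have [g [fg gM]] := Sb_D fM ub; have gS := isD_Sch fS fg.
have E : real_complex R (B s u) * FT f s = Complex 0 1 * FT g s.
  have hS := FT_integrand s fS.
  have hD : isD u (fun w => cis (B s w) * f w)
      (fun w => Complex 0 (B s u) * cis (B s w) * f w + cis (B s w) * g w).
    by apply: isDM => //; exact: isD_cisr.
  have := IC_isD bo ub hS hD.
  have [D Dn] := Sch_nice bo hS; have [D' Dn'] := Sch_nice bo (FT_integrand s gS).
  rewrite (_ : (fun w => _) = fun w => Complex 0 (B s u) * (cis (B s w) * f w) +
     cis (B s w) * g w); last by apply/funext => w; rewrite mulrA.
  rewrite (IC_D bo (niceC_Z _ Dn) Dn') (IC_Z bo _ Dn) => E.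
  have E' : Complex 0 (B s u) * FT f s = - FT g s.
    by apply/eqP; rewrite -addr_eq0; apply/eqP.
  have := congr1 (fun z => - Complex 0 1 * z) E'.
  rewrite mulrNN mulrA => <-; congr (_ * _).
  by apply: complexE; rewrite ?ReM ?ImM /=; ring.
have n1 : normc (Complex 0 1 : R[i]) = 1 by rewrite /= expr0n expr1n add0r sqrtr1.
by rewrite -normc_real -normcM E normcM n1 mul1r; exact: HC.
Qed.

End FullFourier.

(** * Fourier inversion on a vector space and its dual *)

Section Systems.
Context {R : realType}.

Lemma mul_conjC_normc (z : R[i]) : z * (z^*)%C = real_complex R (normc z ^+ 2).
Proof.
rewrite sqr_normc_ReIm; case: z => a b.
by apply: complexE; rewrite ?ReM ?ImM /=; ring.
Qed.

Lemma sqr_normc_eq0 (z : R[i]) : normc z ^+ 2 = 0 -> z = 0.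
Proof. by move=> /eqP; rewrite expf_eq0 /= => /eqP z0; exact: normc_eq0. Qed.

Lemma IC_conj (V : vectType R) (bl : seq (V * (V -> R))) C f : biorth bl -> niceC bl C f ->
  IC bl (fun x => (f x)^*)%C = ((IC bl f)^*)%C.
Proof.
move=> bo fn; apply: complexE; rewrite ?ReJ ?ImJ /=.
  by congr iterR; apply/funext => x; rewrite ReJ.
have C0 := niceC_ge0 fn.
rewrite -mulN1r -(iterRZ (U0 := fun=> 1) (-1) 0 bo C0 _ _ (fun _ => id) (niceC_Im fn))//.
by congr iterR; apply/funext => x; rewrite ImJ mulN1r.
Qed.

Lemma biorth_map (V : vectType R) (I : eqType) (r : seq I) (v : I -> V) (l : I -> V -> R) :
  uniq r -> (forall i, linear (l i : V -> R^o)) -> (forall i j, l i (v j) = (i == j)%:R) ->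
  biorth [seq (v i, l i) | i <- r].
Proof.
move=> ur ll lv; elim: r ur => [|i r IH] //= /andP[ir ur].
split=> //=.
- by rewrite lv eqxx.
- move=> q; rewrite /unzip1 -map_comp => /mapP[j jr ->] /=; rewrite lv.
  by case: eqP ir => // ->; rewrite jr.
- move=> m; have : forall s, {subset s <= r} -> List.In m (unzip2 [seq (v i, l i) | i <- s]) -> m (v i) = 0.
    elim=> [|j s IHs] //= sr [<-|]; last by apply: IHs => k ks; apply: sr; rewrite inE ks orbT.
    rewrite lv; case: eqP => // e; move: ir; rewrite -e => /negP[]; apply: sr; exact: mem_head.
  exact.
- exact: IH.
Qed.

Variable E : vectType R.
Local Notation d := (\dim {:E}).
Local Notation ei i := ((ebasis : d.-tuple E)`_i).

Definition dcoord (i : 'I_d) : dual E := linfun (coord ebasis i : E -> R^o).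

Lemma dcoordE i x : dcoord i x = coord ebasis i x.
Proof. by rewrite lfunE. Qed.

Lemma ebasis_coord (i j : 'I_d) : coord ebasis i (ei j) = (i == j)%:R :> R.
Proof. by rewrite coord_free 1?eq_sym//; apply: basis_free; exact: vbasisP. Qed.

(** The bases underlying the two Lebesgue measures, each with its coordinate
  functions. *)
Definition sysE : seq (E * (E -> R)) := [seq (ei i, fun x : E => coord ebasis i x) | i : 'I_d <- enum 'I_d].

Definition sysD : seq (dual E * (dual E -> R)) :=
  [seq (dcoord i, fun xi : dual E => xi (ei i)) | i : 'I_d <- enum 'I_d].

Lemma biorth_sysE : biorth sysE.
Proof.
apply: biorth_map => [|i|i j]; first exact: enum_uniq.
  by move=> c x y; rewrite linearP.
exact: ebasis_coord.
Qed.

Lemma biorth_sysD : biorth sysD.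
Proof.
apply: biorth_map => [|i|i j]; first exact: enum_uniq.
  by move=> c x y; rewrite add_lfunE scale_lfunE.
by rewrite dcoordE ebasis_coord eq_sym.
Qed.

Lemma unzip_sysE : unzip1 sysE = ebasis.
Proof.
rewrite /unzip1 -map_comp; apply: (@eq_from_nth _ 0).
  by rewrite size_map size_enum_ord size_tuple.
move=> i; rewrite size_map size_enum_ord => id.
by rewrite (nth_map (Ordinal id)) ?size_enum_ord//= nth_enum_ord.
Qed.

Lemma unzip_sysD : unzip1 sysD = @dual_basis R E.
Proof. by rewrite /unzip1 -map_comp. Qed.

Lemma size_sysE : size sysE = d.
Proof. by rewrite size_map size_enum_ord. Qed.

Lemma size_sysD : size sysD = d.
Proof. by rewrite size_map size_enum_ord. Qed.

(** Spanning is what makes the integrals invariant under all translations. *)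
Lemma span_sysE y : y = \sum_(p <- sysE) p.2 y *: p.1.
Proof. by rewrite big_map big_enum /= -ebasis_sum. Qed.

Lemma span_sysD (y : dual E) : y = \sum_(p <- sysD) p.2 y *: p.1.
Proof.
rewrite big_map big_enum /=; apply/lfunP => x; rewrite sum_lfunE.
under eq_bigr do rewrite scale_lfunE dcoordE.
rewrite [in LHS](ebasis_sum x) linear_sum; apply: eq_bigr => i _.
by rewrite linearZ /= /GRing.scale/= mulrC.
Qed.

Definition prE (x : E) (xi : dual E) : R := pairing x xi.

Definition prD (xi : dual E) (x : E) : R := pairing x xi.

Lemma prE_l xi : linear (prE^~ xi : E -> R^o).
Proof. by move=> c x y; rewrite /prE /pairing linearP. Qed.

Lemma prE_r x : linear (prE x : dual E -> R^o).
Proof. by move=> c a b; rewrite /prE /pairing add_lfunE scale_lfunE. Qed.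

Lemma prD_l x : linear (prD^~ x : dual E -> R^o).
Proof. exact: prE_r. Qed.

Lemma prD_r xi : linear (prD xi : E -> R^o).
Proof. exact: prE_l. Qed.

Lemma prE_span : exists2 A : R, 0 <= A & forall s, nrm s <= A * \sum_(w <- unzip1 sysD) `|prE s w|.
Proof.
exists 1 => // s; rewrite mul1r unzip_sysD big_map big_enum /=.
by rewrite /nrm; apply: ler_sum => i _; rewrite /prE /pairing -/(dcoord i) dcoordE.
Qed.

Lemma prD_span : exists2 A : R, 0 <= A & forall s, nrm s <= A * \sum_(w <- unzip1 sysE) `|prD s w|.
Proof.
exists (\sum_i nrm (dcoord i)) => [|s]; first by apply: sumr_ge0 => i _; exact: nrm_ge0.
rewrite {1}(span_sysD s) big_map big_enum /= (le_trans (nrm_sum _ _ _))//.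
rewrite /unzip1 big_map big_map big_enum /= mulr_sumr; apply: ler_sum => i _.
rewrite nrmZ mulrC ler_wpM2r//.
by rewrite (bigD1 i)//= lerDl sumr_ge0// => j _; exact: nrm_ge0.
Qed.

Notation FE := (FT sysE prD).
Notation FD := (FT sysD prE).

Lemma FE_Sch f : Sch f -> Sch (FE f).
Proof. exact: (FT_Sch biorth_sysE prD_l prD_r prD_span). Qed.

Lemma FD_Sch f : Sch f -> Sch (FD f).
Proof. exact: (FT_Sch biorth_sysD prE_l prE_r prE_span). Qed.

Lemma Mod_pairing (V1 V2 : vectType R) (B : V1 -> V2 -> R) :
  (forall w, linear (B^~ w : V1 -> R^o)) -> (forall v, linear (B v : V2 -> R^o)) ->
  Mod (fun p : V1 * V2 => cis (B p.1 p.2)).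
Proof.
move=> Bl Br.
apply: (@Mod_cis _ _ _ (fun (v x : V1 * V2) => B v.1 x.2 + B x.1 v.2) (fun v => B v.1 v.2) (fun=> 0)).
- move=> [x1 x2] [v1 v2] t /=.
  have -> : B (x1 + t *: v1) (x2 + t *: v2) = B (x1 + t *: v1) x2 + t * B (x1 + t *: v1) v2.
    exact: (form_shift _ _ _ (Br _)).
  rewrite (form_shift x1 t v1 (Bl x2)) (form_shift x1 t v1 (Bl v2)); ring.
- move=> [v1 v2] c [x1 x2] [y1 y2] /=.
  have -> : B v1 (c *: x2 + y2) = c * B v1 x2 + B v1 y2 by exact: Br.
  have -> : B (c *: x1 + y1) v2 = c * B x1 v2 + B y1 v2 by exact: Bl.
  by rewrite -[RHS]/(c * (B v1 x2 + B x1 v2) + (B v1 y2 + B y1 v2)); ring.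
Qed.

Lemma Sch_tensor (V1 V2 : vectType R) (f : V1 -> R[i]) (g : V2 -> R[i]) :
  Sch f -> Sch g -> Sch (fun p : V1 * V2 => f p.1 * g p.2).
Proof.
move=> fS gS; have [C C0 HC] := jb_pair V1 V2.
have := @Sch_mul2 R _ _ _ (fun p : V1 * V2 => p.1) 0 (fun p : V1 * V2 => p.2) 0 f g C.
move=> /(_ (fun _ _ _ => erefl) (fun _ _ _ => erefl)) H.
have : Sch (fun p : V1 * V2 => f (p.1 + 0) * g (p.2 + 0)).
  by apply: H => // -[u v]; rewrite !addr0; exact: HC.
by congr Sch; apply/funext => p; rewrite !addr0.
Qed.

(** Fourier inversion up to the constant [cF], whose value is irrelevant. Inserting
  the dilates [G (e *: eta)] of a fixed function, with [G 0 = 1], makes the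
  double integral absolutely convergent; letting [e] tend to 0 on both sides of
  [Parseval] gives the formula at one point. *)
Section Inversion.
Variable G : dual E -> R[i].
Hypothesis GS : Sch G.
Hypothesis G0 : G 0 = 1.

Definition cF : R[i] := IC sysE (FD G).

Lemma Sch_lip (V : vectType R) (g : V -> R[i]) : Sch g ->
  exists2 C, 0 <= C & forall x, normc (g x - g 0) <= C * nrm x.
Proof.
move=> gS; have H (i : 'I_(\dim {:V})) := Sch_D (ebasis : seq V)`_i gS.
have [g1 Hg] := choice H.
have H2 i : exists M, forall x, normc (g1 i x) <= M.
  by have [M HM] := Sch_bd 0 (Hg i).2; exists M => x; have := HM x; rewrite expr0 mul1r.
have [M HM] := choice H2.
pose B := \sum_i `|M i|.
have HB i x : normc (g1 i x) <= B.
  by rewrite (le_trans (HM i x))// (le_trans (ler_norm _))// /B (bigD1 i)//= lerDl sumr_ge0.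
exists (2 * B) => [|x]; first by rewrite mulr_ge0// sumr_ge0.
have := lip_comb (fun i => coord ebasis i x) (fun i => (Hg i).1) HB (index_enum _) 0.
by rewrite -ebasis_sum add0r.
Qed.

Lemma Sch_dilate (V : vectType R) (g : V -> R[i]) (c : R) : 0 < c -> Sch g -> Sch (fun x => g (c *: x)).
Proof.
move=> c0 gS; have lL : linear (fun x : V => c *: x).
  by move=> a x y; rewrite scalerDr !scalerA mulrC.
have := @Sch_pull R V V (fun x => c *: x) 0 g (1 + c^-1) lL.
move=> H; have : Sch (fun x => g (c *: x + 0)).
  apply: H => // x; rewrite addr0; apply: jb_le; first by rewrite invr_ge0 ltW.
  by rewrite nrmZ (gtr0_norm c0) mulKf// gt_eqF.
by congr Sch; apply/funext => x; rewrite addr0.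
Qed.

Lemma Parseval (f : E -> R[i]) (g : dual E -> R[i]) : Sch f -> Sch g ->
  IC sysD (fun eta => g eta * FE f eta) = IC sysE (fun x => f x * FD g x).
Proof.
move=> fS gS; have bS : Sch (fun p : E * dual E => f p.1 * g p.2 * cis (prE p.1 p.2)).
  by apply: Sch_mul_Mod; [exact: Sch_tensor|exact: (Mod_pairing prE_l prE_r)].
transitivity (IC sysD (fun eta => IC sysE (fun x => f x * g eta * cis (prE x eta)))).
  congr IC; apply/funext => eta.
  have [C Cn] := Sch_nice biorth_sysE (FT_integrand prD_r eta fS).
  by rewrite /FT -(IC_Z biorth_sysE _ Cn); congr IC; apply/funext => x; rewrite /prD /prE; ring.
rewrite -(IC_Fubini biorth_sysE biorth_sysD bS) /=.
congr IC; apply/funext => x.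
have [C Cn] := Sch_nice biorth_sysD (FT_integrand prE_r x gS).
by rewrite /FT -(IC_Z biorth_sysD _ Cn); congr IC; apply/funext => eta; rewrite /prE; ring.
Qed.

Lemma inversion0 (f : E -> R[i]) : Sch f -> IC sysD (FE f) = cF * f 0.
Proof.
move=> fS; have bE := biorth_sysE; have bD := biorth_sysD.
have hS := FE_Sch fS; have gS := FD_Sch GS.
have [A A0 HA] := Sch_lip GS; have [B B0 HB] := Sch_lip fS.
have [K K0 HK] := jb_wb bD; have [K' K0' HK'] := jb_wb bE.
have [M HM] := Sch_bd (1 + 2 * size sysD) hS; have [N HN] := Sch_bd (1 + 2 * size sysE) gS.
have M0 : 0 <= M by rewrite (le_trans _ (HM 0))// mulr_ge0 ?jbX_ge0 ?normc_ge0.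
have N0 : 0 <= N by rewrite (le_trans _ (HN 0))// mulr_ge0 ?jbX_ge0 ?normc_ge0.
have decay (V : vectType R) (bl : seq (V * (V -> R))) (q : V -> R[i]) (k L : R) :
    0 <= L -> (forall x, 1 <= k * wb bl x * jb x ^+ (2 * size bl)) -> 0 < k ->
    (forall x, jb x ^+ (1 + 2 * size bl) * normc (q x) <= L) ->
    forall x, nrm x * normc (q x) <= k * L * wb bl x.
  move=> L0 Hk k0 HL x; have q0 := normc_ge0 (q x); have n0 := nrm_ge0 x.
  rewrite -[leLHS]mul1r (le_trans (ler_wpM2r (mulr_ge0 n0 q0) (Hk x)))//.
  rewrite -(mulrA (k * wb bl x)) [leRHS]mulrAC ler_wpM2l//.
    by rewrite mulr_ge0 ?wb_ge0// ltW.
  rewrite (le_trans _ (HL x))// mulrA ler_wpM2r// exprD expr1 mulrC ler_wpM2r ?jbX_ge0//.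
  by rewrite lerDr.
pose D : R := 2 * (K * M * A * pi ^+ size sysD) + 2 * (K' * N * B * pi ^+ size sysE).
have D0 : 0 <= D.
  by rewrite addr_ge0// !mulr_ge0// ?exprn_ge0 ?pi_ge0// ltW.
suff main e : 0 < e -> normc (IC sysD (FE f) - cF * f 0) <= D * e.
  apply/eqP; rewrite -subr_eq0; apply/eqP; apply: normc_eq0; apply/eqP.
  rewrite eq_le normc_ge0 andbT; apply/ler_addgt0Pr => e e0; rewrite add0r.
  have D1 : 0 < D + 1 by rewrite ltr_wpDl.
  rewrite (le_trans (main _ (divr_gt0 e0 D1)))// mulrA ler_pdivrMr// mulrC.
  by rewrite ler_wpM2l ?(ltW e0)// lerDl.
move=> e0.
have GeS := Sch_dilate e0 GS; have feS := Sch_dilate e0 fS.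
have E1 : IC sysD (fun eta => G (e *: eta) * FE f eta) = IC sysE (fun x => f (e *: x) * FD G x).
  rewrite (Parseval fS GeS).
  have FDe x : FD (fun eta => G (e *: eta)) x = real_complex R (e ^- size sysD) * FD G (e^-1 *: x).
    have [C Cn] := Sch_nice bD (FT_integrand prE_r (e^-1 *: x) GS).
    rewrite /FT -(IC_scale bD e0 Cn); congr IC; apply/funext => eta.
    congr (cis _ * _); rewrite /prE /pairing linearZ /= scale_lfunE /GRing.scale/=.
    by rewrite mulrA mulVf ?mul1r// gt_eqF.
  have ei0 : 0 < e^-1 by rewrite invr_gt0.
  have S2 := Sch_mul feS gS; have [C Cn] := Sch_nice bE S2.
  have [C' Cn'] := Sch_nice bE (Sch_dilate ei0 S2).
  transitivity (real_complex R (e ^- size sysD) * IC sysE (fun x => f (e *: (e^-1 *: x)) * FD G (e^-1 *: x))).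
    rewrite -(IC_Z bE _ Cn'); congr IC; apply/funext => x.
    by rewrite FDe scalerA mulfV ?gt_eqF// scale1r mulrCA.
  rewrite (IC_scale bE ei0 Cn) mulrA -rmorphM size_sysD size_sysE exprVn invrK mulVf ?mul1r//.
  by rewrite expf_neq0// gt_eqF.
have [C1 n1] := Sch_nice bD hS; have [C2 n2] := Sch_nice bD (Sch_mul GeS hS).
have [C3 n3] := Sch_nice bE gS; have [C4 n4] := Sch_nice bE (Sch_mul feS gS).
have -> : IC sysD (FE f) - cF * f 0 =
  - (IC sysD (fun eta => G (e *: eta) * FE f eta) - IC sysD (FE f)) +
  (IC sysE (fun x => f (e *: x) * FD G x) - f 0 * IC sysE (FD G)).
  by rewrite E1 /cF; ring.
rewrite (le_trans (normcD _ _))// normcN -(IC_B bD n2 n1) -(IC_Z bE _ n3) -(IC_B bE n4 (niceC_Z _ n3)).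
have rot (a b c p q : R) : 0 <= a -> 0 <= b -> c * p <= q -> a * (b * c) * p <= a * b * q.
  by move=> a0 b0 h; rewrite -!mulrA ler_wpM2l// ler_wpM2l.
have swp (a b c p : R) : 2 * (a * b * c * p) * e = 2 * ((c * e * (a * b)) * p) by ring.
rewrite /D mulrDl; apply: lerD.
  rewrite swp.
  apply: (IC_bd_size bD _ (niceC_D n2 (niceC_N n1))) => [|eta].
    by rewrite !mulr_ge0// ltW.
  have -> : G (e *: eta) * FE f eta - FE f eta = (G (e *: eta) - G 0) * FE f eta.
    by rewrite G0; ring.
  rewrite normcM (le_trans (ler_wpM2r (normc_ge0 _) (HA _)))// nrmZ (gtr0_norm e0).
  rewrite -[leRHS](mulrA (_ * e)); apply: rot; rewrite ?(ltW e0)//.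
  exact: decay.
rewrite swp.
apply: (IC_bd_size bE _ (niceC_D n4 (niceC_N (niceC_Z _ n3)))) => [|x].
  by rewrite !mulr_ge0// ltW.
rewrite -mulrBl normcM (le_trans (ler_wpM2r (normc_ge0 _) (HB _)))// nrmZ (gtr0_norm e0).
rewrite -[leRHS](mulrA (_ * e)); apply: rot; rewrite ?(ltW e0)//.
exact: decay.
Qed.

(** By translation, the formula at every point. *)
Lemma inversion (f : E -> R[i]) y : Sch f ->
  IC sysD (fun eta => IC sysE (fun x => cis (pairing (x - y) eta) * f x)) = cF * f y.
Proof.
move=> fS; have := inversion0 (Sch_shift y fS); rewrite add0r => <-.
congr IC; apply/funext => eta.
have hS : Sch (fun x => cis (pairing (x - y) eta) * f x).
  have := FT_integrand prD_r eta (Sch_shift y fS) => /(Sch_shift (- y)).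
  by congr Sch; apply/funext => x; rewrite subrK.
rewrite -(IC_shift biorth_sysE span_sysE y hS); congr IC; apply/funext => x.
by rewrite addrK.
Qed.

(** Were [cF] zero, [inversion] would make the integral of the squared modulus
  of every Fourier transform vanish, hence every Fourier transform, hence the
  integral of every Schwartz function, in particular that of [|phi| ^ 2]. *)
Lemma cF_neq0 (phi : E -> R[i]) : Sch phi -> phi 0 <> 0 -> cF != 0.
Proof.
move=> phS ph0; apply/eqP => c0; apply: ph0.
have bE := biorth_sysE; have bD := biorth_sysD.
have key h : Sch h -> IC sysE h = 0.
  move=> hS; pose k x := (h x)^*%C; have kS : Sch k := Sch_conj hS.
  have fS := FE_Sch hS.
  have conjE eta : (FE h eta)^*%C = IC sysE (fun x => k x * cis (- prE x eta)).
    have [C Cn] := Sch_nice bE (FT_integrand prD_r eta hS).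
    rewrite /FT -(IC_conj bE Cn); congr IC; apply/funext => x.
    by rewrite rmorphM mulrC; congr (_ * _); rewrite /cis cosN sinN.
  have bS : Sch (fun p : E * dual E => k p.1 * FE h p.2 * cis (- prE p.1 p.2)).
    apply: Sch_mul_Mod; first exact: Sch_tensor.
    apply: (@Mod_pairing E (dual E) (fun x xi => - prE x xi)) => [xi c x y|x c xi eta].
      by rewrite prE_l opprD /GRing.scale/= mulrN.
    by rewrite prE_r opprD /GRing.scale/= mulrN.
  have E1 : IC sysD (fun eta => FE h eta * (FE h eta)^*%C) = 0.
    transitivity (IC sysD (fun eta => IC sysE (fun x => k x * FE h eta * cis (- prE x eta)))).
      congr IC; apply/funext => eta; rewrite conjE.
      have [C Cn] : exists C, niceC sysE C (fun x => k x * cis (- prE x eta)).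
        apply: (Sch_nice bE); have := Sch_conj (FT_integrand prD_r eta hS).
        congr Sch; apply/funext => x.
        by rewrite rmorphM mulrC; congr (_ * _); rewrite /cis cosN sinN.
      by rewrite -(IC_Z bE _ Cn); congr IC; apply/funext => x; ring.
    rewrite -(IC_Fubini bE bD bS) -(IC_0 bE); congr IC; apply/funext => x /=.
    have := inversion x hS; rewrite c0 mul0r => E0.
    have [C Cn] : exists C, niceC sysD C (fun eta => cis (- prE x eta) * FE h eta).
      apply: (Sch_nice bD); have := FT_integrand prE_r (- x) fS.
      by congr Sch; apply/funext => eta; rewrite /prE /pairing linearN.
    transitivity (k x * IC sysD (fun eta => cis (- prE x eta) * FE h eta)).
      by rewrite -(IC_Z bD _ Cn); congr IC; apply/funext => eta; ring.
    rewrite (_ : IC sysD _ = 0) ?mulr0// -[RHS]E0; congr IC; apply/funext => eta.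
    have [C' Cn'] := Sch_nice bE (FT_integrand prD_r eta hS).
    rewrite /FT -(IC_Z bE _ Cn'); congr IC; apply/funext => y.
    by rewrite mulrA -cisD; congr (cis _ * _); rewrite /prE /prD /pairing linearB addrC.
  have E2 : (fun eta => FE h eta * (FE h eta)^*%C) = fun eta => real_complex R (normc (FE h eta) ^+ 2).
    by apply/funext => eta; rewrite mul_conjC_normc.
  have [C Cn] := Sch_nice bD (Sch_mul fS (Sch_conj fS)).
  rewrite E2 in E1 Cn.
  have := IC_real_eq0 bD Cn (fun eta => sqr_ge0 _) E1.
  move=> /sqr_normc_eq0 h0; rewrite -[RHS]h0 /FT; congr IC; apply/funext => x.
  by rewrite /prD /pairing lfunE /= cis0 mul1r.
have S2 := Sch_mul phS (Sch_conj phS).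
have := key _ S2; have E2 : (fun x => phi x * (phi x)^*%C) = fun x => real_complex R (normc (phi x) ^+ 2).
  by apply/funext => x; rewrite mul_conjC_normc.
have [C Cn] := Sch_nice bE S2; rewrite E2 in Cn * => E1.
have h0 := IC_real_eq0 bE Cn (fun x => sqr_ge0 _) E1.
exact: (sqr_normc_eq0 h0).
Qed.

End Inversion.

End Systems.

(** * Sums over a lattice *)

Section LatticeSums.
Context {R : realType}.

(** The bounded increasing function [u / (1 + |u|)] against which the weights
  telescope. *)
Lemma weight_step (u : R) :
  (1 + `|u|) ^- 2 <= 4 * ((u + 1) / (1 + `|u + 1|) - u / (1 + `|u|)).
Proof.
have [u0|u0] := leP 0 u.
  have u1 : 0 <= u + 1 by rewrite addr_ge0.
  rewrite !ger0_norm//.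
  have -> : (u + 1) / (1 + (u + 1)) - u / (1 + u) = ((1 + u) * (2 + u))^-1 by field; lra.
  have P1 : 0 < 1 + u by lra.
  have P2 : 0 < 2 + u by lra.
  rewrite -[leLHS]mul1r ler_pdivrMr ?exprn_gt0//.
  have -> : 4 * ((1 + u) * (2 + u))^-1 * (1 + u) ^+ 2 = 4 * (1 + u) / (2 + u) by field; lra.
  by rewrite ler_pdivlMr//; lra.
have [u1|u1] := leP 0 (u + 1).
  rewrite (ler0_norm (ltW u0)) (ger0_norm u1).
  have -> : (u + 1) / (1 + (u + 1)) - u / (1 - u) = (1 - 2 * u - 2 * u ^+ 2) / ((2 + u) * (1 - u)).
    by field; apply/andP; split; lra.
  have P1 : 0 < 1 - u by lra.
  have P2 : 0 < 2 + u by lra.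
  rewrite -[leLHS]mul1r ler_pdivrMr ?exprn_gt0//.
  have -> : 4 * ((1 - 2 * u - 2 * u ^+ 2) / ((2 + u) * (1 - u))) * (1 - u) ^+ 2
     = 4 * (1 - 2 * u - 2 * u ^+ 2) * (1 - u) / (2 + u) by field; apply/andP; split; lra.
  rewrite ler_pdivlMr// mul1r.
  have H : 1 <= 1 - 2 * u - 2 * u ^+ 2 by nra.
  have : 1 * 1 <= (1 - 2 * u - 2 * u ^+ 2) * (1 - u) by apply: ler_pM => //; lra.
  lra.
rewrite !ltr0_norm//.
have -> : (u + 1) / (1 - (u + 1)) - u / (1 - u) = ((- u) * (1 - u))^-1 by field; apply/andP; split; lra.
have P1 : 0 < 1 - u by lra.
have P2 : 0 < - u by lra.
rewrite -[leLHS]mul1r ler_pdivrMr ?exprn_gt0//.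
have -> : 4 * ((- u) * (1 - u))^-1 * (1 - u) ^+ 2 = 4 * (1 - u) / (- u) by field; apply/andP; split; lra.
by rewrite ler_pdivlMr//; lra.
Qed.

Lemma weight_sum1 (s : R) M : \sum_(k < M) (1 + `|s - k%:R|) ^- 2 <= 8.
Proof.
pose h (u : R) := u / (1 + `|u|).
have hb u : `|h u| <= 1.
  by rewrite /h normrM normfV (@ger0_norm _ (1 + _)) ?addr_ge0// ler_pdivrMr ?ltr_pwDl// mul1r lerDr.
rewrite (@le_trans _ _ (\sum_(k < M) 4 * (h (k.+1%:R - s) - h (k%:R - s))))//.
  apply: ler_sum => k _; rewrite distrC.
  by have := weight_step (k%:R - s); rewrite /h -addrA (addrC (- s) 1) addrA natr1.
rewrite -mulr_sumr.
rewrite -(big_mkord xpredT (fun k => h (k.+1%:R - s) - h (k%:R - s))) telescope_sumr//.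
have := hb (M%:R - s); have := hb (0%:R - s); rewrite !ler_norml => /andP[? ?] /andP[? ?]; lra.
Qed.

(** In the coordinates of the lattice basis the weight is dominated by a product
  of one-dimensional weights. A finite set of lattice points lies in a box of
  integers, over which the product sums factor by factor. *)
Lemma lattice_sum (V : vectType R) (J : set V) : lattice J ->
  exists2 K : R, 0 <= K & forall x (A : {fset V}), [set` A] `<=` J ->
    \sum_(l <- enum_fset A) jb (x - l) ^- (2 * \dim {:V}) <= K.
Proof.
case=> b bb JE; pose d := \dim {:V}.
have bf : free b := basis_free bb.
have H (i : 'I_d) : exists2 C : R, 0 <= C & forall x, `|coord b i x| <= C * nrm x.
  by apply: linear_form_nrm => c x y; rewrite linearP.
have H' i : exists C : R, 0 <= C /\ forall x, `|coord b i x| <= C * nrm x by have [C c0 HC] := H i; exists C.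
have [C0 HC0] := choice H'.
pose C := 1 + \sum_i C0 i.
have Cb i x : 1 + `|coord b i x| <= C * jb x.
  have [c0 HC] := HC0 i.
  have ci : C0 i <= \sum_i C0 i by rewrite (bigD1 i)//= lerDl sumr_ge0// => j _; exact: (HC0 j).1.
  rewrite /jb mulrDr mulr1 lerD//.
    by rewrite /C lerDl (le_trans _ ci).
  rewrite (le_trans (HC x))// ler_wpM2r ?nrm_ge0// /C.
  by rewrite (le_trans ci)// lerDr.
have C1 : 1 <= C by rewrite /C lerDl sumr_ge0// => j _; exact: (HC0 j).1.
have C00 : 0 < C by rewrite (lt_le_trans _ C1).
exists (C ^+ (2 * d) * 8 ^+ d) => [|x A AJ]; first by rewrite mulr_ge0// exprn_ge0// ltW.
have zP l : l \in A -> exists z : 'I_d -> int, l = \sum_(i < d) b`_i *~ z i.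
  by move=> lA; have := AJ l lA; rewrite JE.
have [z Hz] : exists z : V -> 'I_d -> int, forall l, l \in A -> l = \sum_(i < d) b`_i *~ z l i.
  have : forall l, exists z : 'I_d -> int, l \in A -> l = \sum_(i < d) b`_i *~ z i.
    move=> l; case lA: (l \in A); last by exists (fun=> 0).
    by have [z zl] := zP l lA; exists z.
  by move=> /choice[z Hz]; exists z.
have cz l i : l \in A -> coord b i l = (z l i)%:~R.
  move=> lA; rewrite {1}(Hz l lA) linear_sum /= (bigD1 i)//= big1 => [|j ji].
    by rewrite addr0 raddfMz /= coord_free// eqxx.
  by rewrite raddfMz /= coord_free// ?(negbTE ji) ?mul0rz//.
pose N := (\max_(l <- enum_fset A) \max_(i < d) `|z l i|%N)%N.
have zN l i : l \in A -> (`|z l i| <= N)%N.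
  move=> lA; apply: (@leq_trans (\max_(i < d) `|z l i|%N)); first exact: (leq_bigmax i).
  by rewrite /N (big_rem l)//= leq_maxl.
pose g l : {ffun 'I_d -> 'I_(N.*2.+1)} := [ffun i => inord (absz (z l i + N%:Z)%R)].
have gE l i : l \in A -> (g l i)%:R = coord b i l + N%:R :> R.
  move=> lA; rewrite ffunE inordK; last first.
    by have := zN l i lA; rewrite ltnS -addnn; lia.
  rewrite cz// -[RHS]/((z l i)%:~R + (N%:Z)%:~R) -intrD -[LHS]/(((absz (z l i + N%:Z)%R)%:Z)%:~R).
  by congr (_%:~R); have := zN l i lA; lia.
pose q (s : 'I_d -> R) (h : {ffun 'I_d -> 'I_(N.*2.+1)}) := \prod_(i < d) (1 + `|s i - (h i)%:R|) ^- 2.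
pose s i := coord b i x + N%:R.
rewrite (@le_trans _ _ (C ^+ (2 * d) * \sum_(l <- enum_fset A) q s (g l)))//.
  rewrite mulr_sumr big_seq [leRHS]big_seq; apply: ler_sum => l lA.
  rewrite /q -[leLHS]mul1r ler_pdivrMr ?jbX_gt0// mulrAC -ler_pdivrMr; last first.
    by apply: prodr_gt0 => i _; rewrite invr_gt0 exprn_gt0// ltr_pwDl.
  rewrite mul1r -prodfV; under eq_bigr do rewrite invrK.
  rewrite -exprMn exprM -/d.
  rewrite (_ : ((C * jb (x - l)) ^+ 2) ^+ d = \prod_(i < d) (C * jb (x - l)) ^+ 2); last first.
    by rewrite prodr_const card_ord.
  apply: ler_prod => i _; rewrite exprn_ge0 ?addr_ge0//=.
  rewrite lerXn2r ?nnegrE ?addr_ge0 ?mulr_ge0 ?jb_ge0 ?(ltW C00)//.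
  by rewrite gE// /s opprD addrACA subrr addr0 -linearB /=.
rewrite ler_wpM2l ?exprn_ge0 ?(ltW C00)//.
have q0 h : 0 <= q s h by apply: prodr_ge0 => i _; rewrite invr_ge0 exprn_ge0// addr_ge0.
rewrite (@le_trans _ _ (\sum_h q s h))//.
  rewrite -(big_map g xpredT) big_uniq /=.
    by rewrite big_mkcond; apply: ler_sum => h _; case: ifP.
  rewrite map_inj_in_uniq ?fset_uniq// => l l' lA l'A gg.
  rewrite (Hz l lA) (Hz l' l'A); apply: eq_bigr => i _; congr (_ *~ _).
  have : coord b i l + N%:R = coord b i l' + N%:R by rewrite -!gE// gg.
  by move=> /addIr; rewrite !cz// => /intr_inj.
rewrite /q -(bigA_distr_bigA (fun (i : 'I_d) (k : 'I_(N.*2.+1)) => (1 + `|s i - k%:R|) ^- 2)).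
rewrite -[X in 8 ^+ X](card_ord d) -prodr_const; apply: ler_prod => i _.
by rewrite weight_sum1 andbT sumr_ge0// => k _; rewrite invr_ge0 exprn_ge0// addr_ge0.
Qed.

Lemma sum_fsetD (I : choiceType) (M : nmodType) (A B : {fset I}) (F : I -> M) : [set` A] `<=` [set` B] ->
  \sum_(l <- enum_fset B) F l = \sum_(l <- enum_fset A) F l + \sum_(l <- enum_fset (B `\` A)%fset) F l.
Proof.
move=> AB; rewrite -big_cat; apply: perm_big; apply: uniq_perm.
- exact: fset_uniq.
- rewrite cat_uniq !fset_uniq /= andbT; apply/hasPn => x.
  by rewrite -[x \in enum_fset _]/(x \in (B `\` A)%fset) inE => /andP[].
- move=> x; rewrite mem_cat -![x \in enum_fset _]/(x \in (_ : {fset _})) inE.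
  by case xA: (x \in A) => //=; exact: AB.
Qed.

(** Take [A] almost attaining the supremum of the finite sums. *)
Lemma summable_tail (V : vectType R) (J : set V) (w : V -> R) K : (forall l, 0 <= w l) ->
  (forall A : {fset V}, [set` A] `<=` J -> \sum_(l <- enum_fset A) w l <= K) ->
  forall e, 0 < e -> exists2 A : {fset V}, [set` A] `<=` J &
    forall B U : {fset V}, [set` A] `<=` [set` B] -> [set` B] `<=` [set` U] -> [set` U] `<=` J ->
      \sum_(l <- enum_fset (U `\` B)%fset) w l <= e.
Proof.
move=> w0 wK e e0; pose S := [set r | exists2 A : {fset V}, [set` A] `<=` J & r = \sum_(l <- enum_fset A) w l].
have hS : has_sup S.
  split; first by exists (\sum_(l <- enum_fset (fset0 : {fset V})) w l), fset0 => // x; rewrite inE.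
  by exists K => _ [A AJ ->]; exact: wK.
have [_ [A AJ ->] HA] := sup_adherent e0 hS.
exists A => // B U AB BU UJ.
have : \sum_(l <- enum_fset U) w l <= sup S by apply: sup_upper_bound => //; exists U.
have : 0 <= \sum_(l <- enum_fset (B `\` A)%fset) w l by apply: sumr_ge0.
have := sum_fsetD w AB; have := sum_fsetD w BU; lra.
Qed.

End LatticeSums.

(** * Summation inside a tempered distribution *)

Section Limits.
Context {R : realType} {V : vectType R}.
Implicit Types (f g h : V -> R[i]) (x v : V).

Lemma Sb_sum_in s n (w : V -> R) (I : eqType) (r : seq I) (F : I -> V -> R[i]) (M : I -> R) :
  (forall x, 0 <= w x) -> (forall i, i \in r -> Sb s n w (M i) (F i)) ->
  Sb s n w (\sum_(i <- r) M i) (fun x => \sum_(i <- r) F i x).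
Proof.
move=> w0; elim: r => [|i r IH] H.
  rewrite big_nil (_ : (fun x => _) = fun=> 0); first exact: Sb_0.
  by apply/funext => x; rewrite big_nil.
rewrite big_cons (_ : (fun x => _) = fun x => F i x + \sum_(j <- r) F j x).
  apply: Sb_add => //; first by apply: H; rewrite mem_head.
  by apply: IH => j jr; apply: H; rewrite inE jr orbT.
by apply/funext => x; rewrite big_cons.
Qed.

(** One more derivative, controlled uniformly, makes the difference quotients
  converge uniformly, so that the derivatives of [h] approximate those of [g]. *)
Lemma Sb_limit (s : seq V) n (w : V -> R) M N g : (forall x, 1 <= w x) -> Sch g ->
  (forall (X : seq V) e, 0 < e -> exists h, [/\ Sb s n w M h, Sb s n.+1 (fun=> 1) N h &
    forall x, x \in X -> normc (g x - h x) <= e]) ->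
  Sb s n w M g.
Proof.
move=> w1; elim: n g => [|n IH] g gS H.
  split=> // x; apply/ler_addgt0Pr => e e0.
  have w0 : 0 < w x by rewrite (lt_le_trans _ (w1 x)).
  have [h [hM _ hg]] := H [:: x] _ (divr_gt0 e0 w0).
  rewrite -(subrK (h x) (g x)) (le_trans (ler_wpM2l (ltW w0) (normcD _ _)))// mulrDr addrC.
  apply: lerD; first exact: (Sb_bd hM).
  by rewrite mulrC -ler_pdivlMr// hg// mem_head.
split=> [x|v vs].
  apply/ler_addgt0Pr => e e0.
  have w0 : 0 < w x by rewrite (lt_le_trans _ (w1 x)).
  have [h [hM _ hg]] := H [:: x] _ (divr_gt0 e0 w0).
  rewrite -(subrK (h x) (g x)) (le_trans (ler_wpM2l (ltW w0) (normcD _ _)))// mulrDr addrC.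
  apply: lerD; first exact: (Sb_bd hM).
  by rewrite mulrC -ler_pdivlMr// hg// mem_head.
have [g1 [gg1 g1S]] := Sch_D v gS; exists g1; split=> //.
have [g2 [gg2 g2S]] := Sch_D v g1S.
have [B HB] := Sch_bd 0 g2S.
apply: IH => // X e e0.
pose D := 4 * (`|B| + `|N|) + 1.
have D0 : 0 < D by rewrite /D ltr_wpDl// mulr_ge0// addr_ge0.
pose t := e / (2 * D).
have t0 : 0 < t by rewrite /t divr_gt0// mulr_gt0.
have et : 0 < e * t / 4 by rewrite divr_gt0// mulr_gt0.
have [h [hM hN hg]] := H (X ++ [seq x + t *: v | x <- X]) _ et.
have [h1 [hh1 h1M]] := Sb_D hM vs.
have [h1' [hh1' h1N]] := Sb_D hN vs; have E1 := isD_uniq hh1' hh1; subst h1'.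
have [h2 [hh2 h2N]] := Sb_D h1N vs.
exists h1; split=> // x xX.
have T1 : normc (g (x + t *: v) - g x - real_complex R t * g1 x) <= 4 * `|B| * t ^+ 2.
  apply: (isD_taylor gg1 gg2) => s0 _; have := HB (x + s0 *: v).
  by rewrite expr0 mul1r => /le_trans; apply; exact: ler_norm.
have T2 : normc (h (x + t *: v) - h x - real_complex R t * h1 x) <= 4 * `|N| * t ^+ 2.
  apply: (isD_taylor hh1 hh2) => s0 _; have := Sb_bd h2N (x + s0 *: v).
  by rewrite mul1r => /le_trans; apply; exact: ler_norm.
have T3 : normc (g x - h x) <= e * t / 4 by apply: hg; rewrite mem_cat xX.
have T4 : normc (g (x + t *: v) - h (x + t *: v)) <= e * t / 4.
  by apply: hg; rewrite mem_cat (map_f (fun y => y + t *: v) xX) orbT.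
have E : real_complex R t * (g1 x - h1 x) =
   (h (x + t *: v) - h x - real_complex R t * h1 x) -
   (g (x + t *: v) - g x - real_complex R t * g1 x) +
   ((g (x + t *: v) - h (x + t *: v)) - (g x - h x)) by ring.
have : normc (real_complex R t * (g1 x - h1 x)) <= 4 * `|N| * t ^+ 2 + 4 * `|B| * t ^+ 2 + (e * t / 4 + e * t / 4).
  rewrite E (le_trans (normcD _ _))// lerD// (le_trans (normcB _ _))// lerD//.
rewrite normcM normc_real (gtr0_norm t0) => F.
rewrite -(ler_pM2l t0) (le_trans F)//.
have G : t * D = e / 2 by rewrite /t; field; rewrite gt_eqF.
have -> : t * e = e / 2 * t + e * t / 2 by field.
rewrite -G /D; have := sqr_ge0 t; rewrite expr2; nra.
Qed.

(** The remainders have small seminorms, being pointwise limits of finite sums over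
  the tail, to which [Sb_limit] applies. *)
Lemma tempered_has_sum (W : vectType R) (J : set W) (w : W -> R) K (F : W -> V -> R[i]) f T :
  tempered T -> (forall l, 0 <= w l) ->
  (forall A : {fset W}, [set` A] `<=` J -> \sum_(l <- enum_fset A) w l <= K) ->
  (forall l, Sch (F l)) -> Sch f ->
  (forall k n, exists C, forall l, J l -> Sb ebasis n (fun x => jb x ^+ k) (C * w l) (F l)) ->
  (forall x, has_sum J (F^~ x) (f x)) ->
  has_sum J (fun l => T (F l)) (T f).
Proof.
move=> hT w0 wK FS fS FB Fs e e0.
have [C [k [C0 HC]]] := tempered_bd hT.
have [C1 HC1] := FB k k; have [C2 HC2] := FB 0%N k.+1.
pose D := C * `|C1| + 1.
have D0 : 0 < D by rewrite /D ltr_wpDl// mulr_ge0.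
have e1 : 0 < e / (2 * D) by rewrite divr_gt0// mulr_gt0.
have [A AJ HA] := summable_tail w0 wK e1.
exists A; split=> // B AB BJ.
pose g x := f x - \sum_(l <- enum_fset B) F l x.
have gS : Sch g by apply: Sch_sub => //; exact: Sch_sum.
have -> : \sum_(j <- enum_fset B) T (F j) - T f = - T g.
  by rewrite /g (tempered_sub hT)//; [rewrite (tempered_sum hT)// opprB|exact: Sch_sum].
rewrite normcN.
have gq : qb k (`|C1| * (e / (2 * D))) g.
  apply: (@Sb_limit _ _ _ _ (`|C2| * (e / (2 * D)))) => // [x|X d d0]; first exact: jbX_ge1.
  have fin (r : seq V) : exists2 B' : {fset W}, [set` B'] `<=` J & forall x, x \in r ->
      forall B'' : {fset W}, [set` B'] `<=` [set` B''] -> [set` B''] `<=` J ->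
      normc (\sum_(j <- enum_fset B'') F j x - f x) < d.
    elim: r => [|x r [B' B'J IH]]; first by exists fset0 => // y; rewrite inE.
    have [Bx [BxJ Hx]] := Fs x d d0.
    exists (B' `|` Bx)%fset => [l /=|y]; first by rewrite inE => /orP[/B'J|/BxJ].
    rewrite inE => /predU1P[->|yr] B'' sB BJ''.
      by apply: Hx => // l lx; apply: sB => /=; rewrite inE lx orbT.
    by apply: IH => // l lx; apply: sB => /=; rewrite inE lx.
  have [B' B'J HB'] := fin X.
  pose U := (B `|` B')%fset.
  have UJ : [set` U] `<=` J by move=> l /=; rewrite inE => /orP[/BJ|/B'J].
  have BU : [set` B] `<=` [set` U] by move=> l /= lB; rewrite inE lB.
  have tl : \sum_(l <- enum_fset (U `\` B)%fset) w l <= e / (2 * D) by exact: HA.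
  have inJ l : l \in enum_fset (U `\` B)%fset -> J l.
    by rewrite -[l \in _]/(l \in (U `\` B)%fset) inE => /andP[_ /UJ].
  have red Q Q' n : (forall l, J l -> Sb ebasis n Q (Q' * w l) (F l)) -> (forall x, 0 <= Q x) ->
      Sb ebasis n Q (`|Q'| * (e / (2 * D))) (fun x => \sum_(l <- enum_fset (U `\` B)%fset) F l x).
    move=> HQ Q0.
    have : Sb ebasis n Q (\sum_(l <- enum_fset (U `\` B)%fset) (Q' * w l))
       (fun x => \sum_(l <- enum_fset (U `\` B)%fset) F l x).
      by apply: Sb_sum_in => // l lU; apply: HQ; exact: inJ.
    apply: Sb_mono => //; rewrite -mulr_sumr.
    have s0 : 0 <= \sum_(l <- enum_fset (U `\` B)%fset) w l by apply: sumr_ge0.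
    by rewrite (le_trans (ler_wpM2r s0 (ler_norm Q')))// ler_wpM2l.
  exists (fun x => \sum_(l <- enum_fset (U `\` B)%fset) F l x); split.
  - by apply: red => // x; exact: jbX_ge0.
  - by apply: red => // l Jl; have := HC2 l Jl; congr Sb; apply/funext => x; rewrite expr0.
  - move=> x xX; rewrite /g.
    have -> : f x - \sum_(l <- enum_fset B) F l x - \sum_(l <- enum_fset (U `\` B)%fset) F l x
       = - (\sum_(l <- enum_fset U) F l x - f x) by rewrite (sum_fsetD (F^~ x) BU); ring.
    rewrite normcN ltW//; apply: HB' => // l /= lB'; by rewrite inE lB' orbT.
rewrite (le_lt_trans (HC _ _ gS gq))//.
have -> : C * (`|C1| * (e / (2 * D))) = (C * `|C1|) / D * (e / 2) by field; rewrite gt_eqF.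
have : C * `|C1| / D <= 1 by rewrite ler_pdivrMr// mul1r /D lerDl.
nra.
Qed.

End Limits.

(** * Phase space translations and the absorption argument *)

Section Recentering.
Context {R : realType} {E : vectType R}.
Local Notation es := (ebasis : seq E).
Local Notation PS := (E * dual E)%type.
Implicit Types (f : E -> R[i]) (z : PS).

(** The phase space translation that moves [z] to the origin. *)
Definition recenter z f (x : E) : R[i] := cis (pairing x z.2) * f (x + z.1).

Lemma recenter_Sch z f : Sch f -> Sch (recenter z f).
Proof. by move=> fS; exact: (FT_integrand (@prD_r R E) z.2 (Sch_shift z.1 fS)). Qed.

Lemma qb_le k k' M M' f : (k' <= k)%N -> M <= M' -> qb k M f -> qb k' M' f.
Proof.
move=> kk MM; apply: (@Sb_weaken _ _ _ _ _ _ _ _ _ _ _ 1) => //; last by rewrite mul1r.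
by move=> x; rewrite mul1r; exact: jbX_le.
Qed.

(** Every derivative of a plane wave brings down one coordinate of the frequency. *)
Lemma cis_bd n : exists2 C : R, 0 <= C & forall xi : dual E,
  Sb es n (fun=> 1) (C * jb xi ^+ n) (fun x => cis (pairing x xi)).
Proof.
have [A A0 HA] : exists2 A : R, 0 <= A & forall v, v \in es -> forall xi : dual E, `|pairing v xi| <= A * jb xi.
  have H (i : 'I_(\dim {:E})) : exists C : R, 0 <= C /\ forall xi : dual E, `|pairing es`_i xi| <= C * nrm xi.
    by have [C C0 HC] := linear_form_nrm (@prE_r R E es`_i); exists C.
  have [C HC] := choice H.
  exists (\sum_i C i) => [|v /ebasisP[i ->] xi]; first by apply: sumr_ge0 => i _; exact: (HC i).1.
  rewrite (le_trans ((HC i).2 xi))// ler_pM ?(HC i).1 ?nrm_ge0// /jb ?lerDr//.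
  by rewrite (bigD1 i)//= lerDl sumr_ge0// => j _; exact: (HC j).1.
exists ((1 + A) ^+ n) => [|xi]; first by rewrite exprn_ge0// addr_ge0.
have bd x k : 1 * normc (cis (pairing x xi)) <= (1 + A) ^+ k * jb xi ^+ k.
  by rewrite mul1r normc_cis -exprMn exprn_ege1// mulr_ege1 ?jb_ge1// lerDl.
elim: n => [|n IH]; first by split=> // x; exact: (bd x 0%N).
split=> [x|v vs]; first exact: bd.
exists (fun x => Complex 0 (prD xi v) * cis (prD xi x)); split.
  exact: (isD_cisr (@prD_r R E) xi v).
have := Sb_scale (Complex 0 (prD xi v)) IH; apply: Sb_mono => //.
rewrite [(1 + A) ^+ n.+1]exprS exprS mulrACA ler_wpM2r ?mulr_ge0 ?exprn_ge0 ?jb_ge0 ?addr_ge0//.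
have -> : normc (Complex 0 (prD xi v)) = `|prD xi v|.
  by rewrite /normc expr0n /= add0r sqrtr_sqr.
by rewrite (le_trans (HA v vs xi))// ler_wpM2r ?jb_ge0// lerDr.
Qed.

Lemma jb_shift_pow (V : vectType R) k (x y : V) : jb x ^+ k <= jb y ^+ k * jb (x - y) ^+ k.
Proof.
rewrite -exprMn lerXn2r ?nnegrE ?mulr_ge0 ?jb_ge0//.
by rewrite -{1}(subrK y x) mulrC jbD.
Qed.

Lemma unrecenterE z f x : f x = cis (pairing z.1 z.2) * (cis (pairing x (- z.2)) * recenter z f (x - z.1)).
Proof.
rewrite /recenter subrK !mulrA -!cisD.
rewrite (_ : _ + _ + _ = 0) ?cis0 ?mul1r// /pairing opp_lfunE linearB /=; ring.
Qed.

(** Translation costs powers of the position in the weight, modulation costs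
  powers of the frequency in the derivatives. *)
Lemma unrecenter_bd k n : exists2 C : R, 0 <= C & forall z f M,
  Sb es n (fun x => jb x ^+ k) M (recenter z f) -> Sb es n (fun x => jb x ^+ k) (C * jb z ^+ (n + k) * M) f.
Proof.
have [C C0 HC] := cis_bd n.
have [C1 C10 H1] := jb_fst E (dual E); have [C2 C20 H2] := jb_snd E (dual E).
exists (2 ^+ n * C * C2 ^+ n * C1 ^+ k) => [|z f M fM].
  by rewrite !mulr_ge0 ?exprn_ge0// ltW.
have M0 : 0 <= M by rewrite (le_trans _ (Sb_bd fM 0))// mulr_ge0 ?jbX_ge0 ?normc_ge0.
have S1 : Sb es n (fun x => jb (x - z.1) ^+ k) M (fun x => recenter z f (x - z.1)).
  exact: (Sb_shift (- z.1) fM).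
have S2 := Sb_mul (fun=> ler01) (fun x => jbX_ge0 (x - z.1) k) (HC (- z.2)) S1.
have S3 := Sb_scale (cis (pairing z.1 z.2)) S2.
rewrite (_ : f = fun x => cis (pairing z.1 z.2) * (cis (pairing x (- z.2)) * recenter z f (x - z.1))); last first.
  by apply/funext => x; exact: unrecenterE.
apply: (@Sb_weaken _ _ _ _ _ _ _ _ _ _ _ (jb z.1 ^+ k) _ _ _ _ _ S3) => // [|x|].
- exact: jbX_ge0.
- by rewrite mul1r jb_shift_pow.
- rewrite normc_cis mul1r jbN exprD.
  have -> : jb z.1 ^+ k * (2 ^+ n * (C * jb z.2 ^+ n * M)) = (2 ^+ n * C * M) * (jb z.2 ^+ n * jb z.1 ^+ k) by ring.
  have -> : 2 ^+ n * C * C2 ^+ n * C1 ^+ k * (jb z ^+ n * jb z ^+ k) * M =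
    (2 ^+ n * C * M) * ((C2 * jb z) ^+ n * (C1 * jb z) ^+ k) by rewrite !exprMn; ring.
  rewrite ler_wpM2l ?mulr_ge0 ?exprn_ge0//.
  apply: ler_pM; rewrite ?jbX_ge0// lerXn2r ?nnegrE ?jb_ge0 ?mulr_ge0 ?(ltW C20) ?(ltW C10) ?jb_ge0//.
Qed.

(** Order functions are used only through this inequality, with an integer exponent
  and the fixed weight [jb]. *)
Lemma order_function_jb (V : vectType R) (m : V -> R) : order_function m ->
  (forall z : V, 0 < m z) /\ exists2 C : R, 0 <= C & exists N, forall z w : V, m z <= C * jb (z - w) ^+ N * m w.
Proof.
case=> m0 [nN [[N00 NZ ND] [C0 [N0 [C00 N01 Hm]]]]]; split=> //.
have Nz : nN 0 = 0 by rewrite -(scale0r (0 : V)) NZ normr0 mul0r.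
have Nge x : 0 <= nN x.
  by have := ND x (- x); rewrite subrr Nz -scaleN1r NZ normrN1 mul1r; lra.
have [C C1 HC] : exists2 C : R, 0 <= C & forall x, nN x <= C * nrm x.
  by apply: sublinear_nrm => // c x; rewrite NZ.
have [n Hn] : exists n : nat, N0 <= n%:R.
  by exists (Num.bound N0); apply/ltW/archi_boundP; rewrite (le_trans ler01).
have J x : 1 <= japanese nN x <= (1 + C) * jb x.
  rewrite /japanese; apply/andP; split.
    by rewrite -[leLHS]sqrtr1 ler_sqrt ?addr_ge0 ?sqr_ge0// lerDl sqr_ge0.
  rewrite (@le_trans _ _ (1 + nN x))//.
    rewrite -[leRHS]ger0_norm ?addr_ge0// -sqrtr_sqr ler_sqrt ?sqr_ge0//.
    by rewrite sqrrD expr1n -addrA lerD2l lerDr mul1r mulrn_wge0.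
  rewrite /jb mulrDr mulr1 mulrDl mul1r; have := HC x; have := nrm_ge0 x; lra.
exists (C0 * (1 + C) ^+ n); first by rewrite mulr_ge0 ?exprn_ge0 ?addr_ge0// ltW.
exists n => z w; rewrite (le_trans (Hm z w))// ler_wpM2r ?(ltW (m0 w))// -mulrA ler_wpM2l ?(ltW C00)//.
have /andP[J1 J2] := J (z - w).
rewrite -exprMn (@le_trans _ _ (japanese nN (z - w) `^ n%:R))//; first exact: ler_powR.
rewrite powR_mulrn ?(le_trans ler01)// lerXn2r ?nnegrE ?(le_trans ler01)//.
exact: le_trans J1 J2.
Qed.

(** The bounds [2 * S + B0 / 2 ^+ j] hold for all [j]. *)
Lemma halving (I : Type) (X Y : I -> R) (S B0 : R) : 0 <= S -> 0 <= B0 -> (forall i, 0 <= Y i) ->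
  (forall i, X i <= B0 * Y i) ->
  (forall B, 0 <= B -> (forall i, X i <= B * Y i) -> forall i, X i <= (S + B / 2) * Y i) ->
  forall i, X i <= 2 * S * Y i.
Proof.
move=> S0 B00 Y0 H0 Hs.
have it j : forall i, X i <= (2 * S + B0 / 2 ^+ j) * Y i.
  elim: j => [|j IH] i; first by rewrite expr0 divr1 (le_trans (H0 i))// ler_wpM2r// lerDr mulr_ge0.
  have B' : 0 <= 2 * S + B0 / 2 ^+ j by rewrite addr_ge0 ?mulr_ge0// invr_ge0 exprn_ge0.
  rewrite (le_trans (Hs _ B' IH i))// ler_wpM2r// exprS invfM.
  rewrite [2^-1 * _]mulrC mulrA; lra.
move=> i; apply/ler_addgt0Pr => e e0.
pose j := Num.bound (B0 * Y i / e).
rewrite (le_trans (it j i))// mulrDl lerD2l mulrAC ler_pdivrMr ?exprn_gt0//.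
rewrite (mulrC e) -ler_pdivrMr//.
have : B0 * Y i / e <= j%:R by apply/ltW/archi_boundP; rewrite divr_ge0 ?(ltW e0)// mulr_ge0.
by move=> /le_trans; apply; rewrite -natrX ler_nat ltnW// ltn_expl.
Qed.

Section Absorption.
Variables (m : PS -> R) (Cm : R) (N : nat).
Hypothesis m0 : forall z, 0 < m z.
Hypothesis mP : forall z w, m z <= Cm * jb (z - w) ^+ N * m w.
Variable a : (E -> R[i]) -> R[i].
Hypothesis aT : tempered a.

(** The intrinsic description of the symbol class: testing against any wave packet
  of unit size centred at [z] gives at most a multiple of [m z]. *)
Definition microlocal_bound k (C : R) := forall f z M, Sch f -> qb k M (recenter z f) -> normc (a f) <= C * m z * M.

Variables (W : vectType R) (I : set W) (ctr : W -> PS -> PS) (T : W -> (E -> R[i]) -> E -> R[i]) (c : R[i]).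
Hypothesis c0 : c != 0.
Hypothesis TS : forall l f, Sch f -> Sch (T l f).
Hypothesis Tsum : forall f, Sch f -> has_sum I (fun l => a (T l f)) (c * a f).
Hypothesis ctr_sum : exists n (K : R), 0 <= K /\ forall z (A : {fset W}), [set` A] `<=` I ->
  \sum_(l <- enum_fset A) jb (ctr l z - z) ^- n <= K.
Hypothesis near : exists k p (S : R), 0 <= S /\ forall l f z M, I l -> Sch f -> qb k M (recenter z f) ->
  normc (a (T l f)) <= S * m z * jb (ctr l z - z) ^+ p * M.
Hypothesis far : forall L, exists k0, forall k, (k0 <= k)%N -> exists C, forall l f z M, I l -> Sch f ->
  qb k M (recenter z f) -> qb k (C * jb (ctr l z - z) ^- L * M) (recenter (ctr l z) (T l f)).

(** Decompose [f] into the pieces [T l f]. The finitely many pieces centred near [z]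
  obey the bound by [near]. The others are small wave packets at their own
  centres by [far], so the bound to be proved applies to them, with its own
  constant [B] but with a factor [1 / 2] gained from the distance; hence [B]
  improves to [S' + B / 2]. The argument needs some finite [B] to start with.
  Temperedness provides one for the weight [m + e * jb ^+ N'], which satisfies
  the inequality of order functions uniformly in [e], so [e] can be sent to 0 in
  the end. *)
Lemma absorption : exists k C, microlocal_bound k C.
Proof.
have [n [K [K0 HK]]] := ctr_sum.
have [k2 [p [S [S0 H2]]]] := near.
have [Ca [ka [Ca0 Ha]]] := tempered_bd aT.
have [Cu Cu0 Hu] := unrecenter_bd ka ka.
(* [N'] is the loss in [unrecenter_bd] at the order [ka] of the distribution; the
  decay [L] beats the growth of both weights, leaves a summable factor, and
  leaves one power more to make far pieces small. *)
pose N' := (ka + ka)%N; pose L := (N + N' + n).+1.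
have [k3 H3] := far L.
pose k := maxn k2 (maxn k3 ka).
have k2k : (k2 <= k)%N by rewrite leq_maxl.
have k3k : (k3 <= k)%N by rewrite leq_max leq_maxl orbT.
have kak : (ka <= k)%N by rewrite leq_max leq_maxr orbT.
have [C3 HC3] := H3 k k3k.
have c1 : 0 < normc c.
  by rewrite lt_neqAle normc_ge0 andbT eq_sym; apply: contraNneq c0 => /normc_eq0 ->.
have Cm0 : 0 <= Cm.
  have := mP 0 0; rewrite subrr /jb nrm0 addr0 expr1n mulr1 => /(le_trans (ltW (m0 0))).
  by rewrite pmulr_lge0.
have [D [D0 DE]] : exists D, 0 <= D /\ D = (Cm + 1) * `|C3|.
  by exists ((Cm + 1) * `|C3|); rewrite mulr_ge0// addr_ge0.
have [r rE] : exists r, r = 1 + 2 * K * D / normc c by exists (1 + 2 * K * D / normc c).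
have r1 : 1 <= r by rewrite rE lerDl divr_ge0 ?(ltW c1)// !mulr_ge0.
have r0 : 0 < r by rewrite (lt_le_trans _ r1).
have [S' S'E] : exists S', S' = S * r ^+ (p + n) * K / normc c by exists (S * r ^+ (p + n) * K / normc c).
have S'0 : 0 <= S' by rewrite S'E divr_ge0 ?(ltW c1)// !mulr_ge0 ?exprn_ge0 ?(ltW r0).
have main e : 0 < e -> forall f z M, Sch f -> qb k M (recenter z f) ->
    normc (a f) <= 2 * S' * ((m z + e * jb z ^+ N') * M).
  move=> e0.
  pose me z := m z + e * jb z ^+ N'.
  have me0 z : 0 < me z by rewrite addr_gt0// mulr_gt0// jbX_gt0.
  have meP z w : me z <= (Cm + 1) * jb (z - w) ^+ (N + N') * me w.
    rewrite /me mulrDr; apply: lerD.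
      rewrite (le_trans (mP z w))// ler_wpM2r ?(ltW (m0 w))//.
      by rewrite ler_pM ?jbX_ge0 ?lerDl// jbX_le// leq_addr.
    rewrite [leRHS]mulrCA ler_wpM2l ?(ltW e0)//.
    rewrite (le_trans (jb_shift_pow N' z w))// mulrC ler_wpM2r ?jbX_ge0//.
    by rewrite -[leLHS]mul1r ler_pM ?jbX_ge0 ?lerDr// jbX_le// leq_addl.
  pose Ix := {q : (E -> R[i]) * PS * R | Sch q.1.1 /\ qb k q.2 (recenter q.1.2 q.1.1)}.
  pose X (q : Ix) := normc (a (sval q).1.1).
  pose Y (q : Ix) := me (sval q).1.2 * (sval q).2.
  suff H q : X q <= 2 * S' * Y q.
    by move=> f z M fS fM; exact: (H (exist _ (f, z, M) (conj fS fM))).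
  have Y0 q' : 0 <= Y q'.
    by case: q' => -[[f z] M] [fS fM]; rewrite /Y /= mulr_ge0 ?(qb_ge0 fM)// ltW.
  move: q; apply: (@halving _ X Y S' (Ca * Cu / e)) => //.
  - by rewrite divr_ge0 ?(ltW e0)// mulr_ge0.
  - case=> -[[f z] M] [/= fS fM]; rewrite /X /Y /=.
    have M0 := qb_ge0 fM.
    have fk := qb_le kak (lexx M) fM.
    rewrite (le_trans (Ha _ _ fS (Hu _ _ _ fk)))//.
    have -> : Ca * (Cu * jb z ^+ (ka + ka) * M) = Ca * Cu / e * ((e * jb z ^+ N') * M).
      by rewrite /N'; field; rewrite gt_eqF.
    rewrite ler_wpM2l ?mulr_ge0 ?invr_ge0 ?(ltW e0)//.
    by rewrite ler_wpM2r// /me lerDr ltW.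
  - move=> B B0 HB; case=> -[[f z] M] [/= fS fM]; rewrite /X /Y /=.
    have M0 := qb_ge0 fM.
    have HB' g w M' : Sch g -> qb k M' (recenter w g) -> normc (a g) <= B * (me w * M').
      by move=> gS gM; exact: (HB (exist _ (g, w, M') (conj gS gM))).
    have mz := ltW (me0 z).
    have term l : I l -> normc (a (T l f)) <=
        (S * r ^+ (p + n) + B * D / r) * (me z * M) * jb (ctr l z - z) ^- n.
      move=> Il; set dl := ctr l z - z.
      have jn : 0 <= jb dl ^- n by rewrite invr_ge0 jbX_ge0.
      have mm : m z <= me z by rewrite /me lerDl mulr_ge0 ?jbX_ge0// ltW.
      have [lr|lr] := leP (jb dl) r.
        rewrite (le_trans (H2 l f z M Il fS (qb_le k2k (lexx M) fM)))// -/dl.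
        rewrite (@le_trans _ _ (S * r ^+ (p + n) * (me z * M) * jb dl ^- n))//; last first.
          rewrite ler_wpM2r// ler_wpM2r ?mulr_ge0// lerDl.
          by rewrite divr_ge0 ?(ltW r0)// mulr_ge0.
        rewrite ler_pdivlMr ?jbX_gt0//.
        have -> : S * m z * jb dl ^+ p * M * jb dl ^+ n = (S * M) * (m z * jb dl ^+ (p + n)).
          by rewrite exprD; ring.
        have -> : S * r ^+ (p + n) * (me z * M) = (S * M) * (me z * r ^+ (p + n)) by ring.
        rewrite ler_wpM2l ?mulr_ge0// ler_pM ?jbX_ge0 ?(ltW (m0 z))//.
        by rewrite lerXn2r ?nnegrE ?jb_ge0 ?(ltW r0).
      have J0 := jbX_ge0 dl.
      rewrite (le_trans (HB' _ _ _ (TS _ fS) (HC3 l f z M Il fS fM)))// -/dl.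
      rewrite (@le_trans _ _ (B * D / r * (me z * M) * jb dl ^- n))//; last first.
        rewrite ler_wpM2r// ler_wpM2r ?mulr_ge0// lerDr.
        by rewrite !mulr_ge0 ?exprn_ge0// ltW.
      have -> : B * D / r * (me z * M) * jb dl ^- n = B * (D / r * (me z * M) * jb dl ^- n) by ring.
      rewrite ler_wpM2l//.
      rewrite (@le_trans _ _ ((Cm + 1) * jb dl ^+ (N + N') * me z * (`|C3| * jb dl ^- L * M)))//.
        rewrite ler_pM ?(ltW (me0 _)) ?meP//.
          exact: (qb_ge0 (HC3 l f z M Il fS fM)).
        rewrite ler_wpM2r// ler_wpM2r ?ler_norm// invr_ge0; exact: jbX_ge0.
      have -> : (Cm + 1) * jb dl ^+ (N + N') * me z * (`|C3| * jb dl ^- L * M) =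
         D * (me z * M) * jb dl ^- n * (jb dl)^-1.
        rewrite /L DE -addn1 !exprD expr1; field; rewrite ?jb_neq0 ?expf_neq0 ?jb_neq0//.
      have -> : D / r * (me z * M) * jb dl ^- n = D * (me z * M) * jb dl ^- n * r^-1 by ring.
      rewrite ler_wpM2l ?mulr_ge0//.
      by rewrite lef_pV2 ?posrE ?jb_gt0// ltW.
    rewrite -(ler_pM2l c1) -normcM; apply/ler_addgt0Pr => d d0.
    have [A [AI HA]] := Tsum fS d0.
    have := HA A (fun _ => id) AI; set s := \sum_(_ <- _) _; rewrite normc_distC => As.
    rewrite -(subrK s (c * a f)) addrC (le_trans (normcD _ _))// lerD//; last exact: ltW.
    rewrite (le_trans (normc_sum _ _ _))//.
    rewrite (@le_trans _ _ (\sum_(l <- enum_fset A)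
        (S * r ^+ (p + n) + B * D / r) * (me z * M) * jb (ctr l z - z) ^- n))//.
      by rewrite big_seq [leRHS]big_seq; apply: ler_sum => l lA; apply: term; exact: AI.
    rewrite -mulr_sumr.
    have q0 : 0 <= S * r ^+ (p + n) + B * D / r.
      by rewrite addr_ge0// ?mulr_ge0 ?exprn_ge0 ?invr_ge0// ltW.
    rewrite (le_trans (ler_wpM2l _ (HK z A AI)))// ?mulr_ge0//.
    have -> : (S * r ^+ (p + n) + B * D / r) * (me z * M) * K =
       (S * r ^+ (p + n) * K + B * (K * D / r)) * (me z * M) by ring.
    rewrite [leRHS]mulrA ler_wpM2r ?mulr_ge0// mulrDr; apply: lerD.
      by rewrite S'E [normc c * _]mulrC divfK// gt_eqF.
    rewrite [leRHS]mulrCA ler_wpM2l// ler_pdivrMr//.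
    have -> : normc c / 2 * r = normc c / 2 + K * D by rewrite rE; field; rewrite gt_eqF.
    by rewrite lerDr divr_ge0// ltW.
exists k, (2 * S') => f z M fS fM; have M0 := qb_ge0 fM.
apply/ler_addgt0Pr => d d0.
pose q := 2 * S' * jb z ^+ N' * M + 1.
have q0 : 0 < q by rewrite ltr_wpDl// !mulr_ge0 ?jbX_ge0.
rewrite (le_trans (main _ (divr_gt0 d0 q0) _ _ _ fS fM))//.
have -> : 2 * S' * ((m z + d / q * jb z ^+ N') * M) = 2 * S' * m z * M + (q - 1) / q * d.
  by rewrite /q; field; rewrite gt_eqF.
rewrite lerD2l ger_pMl// ler_pdivrMr// mul1r; lra.
Qed.

End Absorption.

End Recentering.

(** * Domination of iterated integrals *)

Section Domination.
Context {R : realType}.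
Local Notation mu := (@lebesgue_measure R).
Local Open Scope ereal_scope.

(** Nonmeasurable integrands are allowed: positive and negative parts are
  integrated as suprema over simple functions, which are monotone. *)
Lemma abs_integral_le (f g : R -> \bar R) : (forall t, `|f t| <= g t) ->
  `|\int[mu]_(t in setT) f t| <= \int[mu]_(t in setT) g t.
Proof.
move=> fg; have g0 t : 0 <= g t by rewrite (le_trans _ (fg t)).
have mono (h : R -> \bar R) : (forall t, 0 <= h t) -> (forall t, h t <= g t) ->
    0 <= \int[mu]_(t in setT) h t <= \int[mu]_(t in setT) g t.
  move=> h0 hg; rewrite integral_ge0//= !ge0_integralTE//.
  apply: le_ereal_sup => _ [k kh <-]; exists k => // x; exact: le_trans (kh x) (hg x).
have /andP[A0 AG] : 0 <= \int[mu]_(t in setT) f^\+ t <= \int[mu]_(t in setT) g t.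
  apply: mono => t; first by [].
  rewrite (le_trans _ (fg t))// funeposE ge_max abse_ge0 andbT; exact: lee_abs.
have /andP[B0 BG] : 0 <= \int[mu]_(t in setT) f^\- t <= \int[mu]_(t in setT) g t.
  apply: mono => t; first by [].
  by rewrite (le_trans _ (fg t))// funenegE ge_max abse_ge0 andbT -abseN; exact: lee_abs.
rewrite integralE.
move: A0 AG B0 BG; set A := \int[mu]_(t in setT) _^\+ t; set B := \int[mu]_(t in setT) _^\- t.
case: (\int[mu]_(t in setT) g t) => [G| |]; first 1 last.
- by move=> *; exact: leey.
- by case: A.
case: A => [A| |]//; case: B => [B| |]//.
rewrite !lee_fin => A0 AG B0 BG; rewrite /= ler_norml; apply/andP; split; lra.
Qed.

Lemma integral_w1 (a : R) : \int[mu]_(t in setT) (w1 (t + a))%:E = pi%:E.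
Proof.
have := integrable_fin_num measurableT (integrable_w1a a).
have := @int1_w1a R a; rewrite /int1 /Rintegral => <- H.
by rewrite fineK.
Qed.

Context {V : vectType R}.

Lemma iterint_abs_le (b : seq V) (f g : V -> \bar R) x : (forall y, `|f y| <= g y) ->
  `|iterint b f x| <= iterint b g x.
Proof.
move=> fg; elim: b x => [|v b IH] x //=.
by apply: abs_integral_le => t; exact: IH.
Qed.

Lemma iterint_wb (bl : seq (V * (V -> R))) (C : R) (U : V -> R) g x : biorth bl -> (0 <= C)%R ->
  (forall y, 0 <= U y)%R -> invar U (unzip1 bl) ->
  iterint (unzip1 bl) (fun y => (C * U y * wb bl (y - g))%:E) x = (C * U x * pi ^+ size bl)%:E.
Proof.
move=> + C0; elim: bl U x => [|p bl IH] U x bo U0 Ui /=.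
  by rewrite /wb big_nil.
have [ll lv lq ql bo'] := biorth_cons bo; have [Uv Ub] := invar_cons Ui.
have E t : iterint (unzip1 bl) (fun y => (C * U y * wb (p :: bl) (y - g))%:E) (x + t *: p.1) =
    (C * U x * pi ^+ size bl)%:E * (w1 (t + p.2 (x - g)))%:E.
  rewrite (_ : (fun y => _) = fun y => (C * (U y * w1 (p.2 (y - g))) * wb bl (y - g))%:E); last first.
    by apply/funext => y; rewrite wb_cons !mulrA.
  rewrite (IH (fun y => U y * w1 (p.2 (y - g)))%R)//.
  - rewrite -EFinM; congr EFin.
    have -> : U (x + t *: p.1)%R = U x by apply: Uv; rewrite mem_head.
    have -> : p.2 (x + t *: p.1 - g)%R = (t + p.2 (x - g))%R.
      by rewrite [RHS]addrC addrAC (form_shift _ _ _ ll) lv mulr1.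
    by ring.
  - by move=> y; rewrite mulr_ge0// w1_ge0.
  - move=> v vb s y /=; rewrite Ub//; congr (_ * w1 _)%R.
    by rewrite addrAC (form_shift _ _ _ ll) (lq v vb) mulr0 addr0.
under eq_integral do rewrite E.
rewrite ge0_integralZl//.
- by rewrite integral_w1 -EFinM exprS; congr EFin; ring.
- apply/measurable_EFinP; apply: measurable_cont; exact: cont_shift cont_w1.
- by move=> t _; rewrite lee_fin w1_ge0.
- by rewrite lee_fin !mulr_ge0// exprn_ge0// pi_ge0.
Qed.

Lemma iterint_bd (bl : seq (V * (V -> R))) (C : R) (f : V -> R) g : biorth bl -> (0 <= C)%R ->
  (forall x, `|f x| <= C * wb bl (x - g))%R ->
  `|iterint (unzip1 bl) (fun x => (f x)%:E) 0| <= (C * pi ^+ size bl)%:E.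
Proof.
move=> bo C0 fC.
have := @iterint_wb bl C (fun=> 1%R) g 0 bo C0 (fun=> ler01) (fun _ _ _ _ => erefl).
rewrite mulr1 => <-; apply: iterint_abs_le => y.
rewrite abse_EFin lee_fin; exact: fC.
Qed.

Local Close Scope ereal_scope.

Lemma wb_le1 (bl : seq (V * (V -> R))) (x : V) : wb bl x <= 1.
Proof.
rewrite /wb; suff /andP[] : 0 <= \prod_(p <- bl) w1 (p.2 x) <= 1 by [].
elim/big_ind: _ => [|u v /andP[u0 u1] /andP[v0 v1]|p _]; first by rewrite ler01 lexx.
  by rewrite mulr_ge0//= mulr_ile1.
by rewrite w1_ge0 w1_le1.
Qed.

Lemma integralC_bd (bl : seq (V * (V -> R))) C (f : V -> R[i]) g : biorth bl -> 0 <= C ->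
  (forall x, normc (f x) <= C * wb bl (x - g)) ->
  normc (integralC (unzip1 bl) f) <= 2 * (C * pi ^+ size bl).
Proof.
move=> bo C0 fC.
have fb (h : V -> R) : (forall x, `|h x| <= normc (f x)) ->
    `|fine (iterint (unzip1 bl) (fun x => (h x)%:E) 0)| <= C * pi ^+ size bl.
  move=> hf; have := @iterint_bd bl C h g bo C0 (fun x => le_trans (hf x) (fC x)).
  by case: (iterint _ _ _) => [r| |] //=; rewrite ?lee_fin.
rewrite (le_trans (ler_normc_ReIm _))//= mulrDl !mul1r; apply: lerD; apply: fb => x.
  exact: ler_Re_normc.
exact: ler_Im_normc.
Qed.

End Domination.

(** * Localization in position *)

Section FourierSide.
Context {R : realType} {E : vectType R}.
Local Notation PS := (E * dual E)%type.
Local Notation es := (ebasis : seq E).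
Local Notation FE := (FT (@sysE R E) (@prD R E)).
Local Notation FD := (FT (@sysD R E) (@prE R E)).
Implicit Types (f chi : E -> R[i]) (psi : dual E -> R[i]) (z : PS).

Lemma integralC_sysD C psi : niceC (@sysD R E) C psi -> integralC (@dual_basis R E) psi = IC (@sysD R E) psi.
Proof. by move=> fn; rewrite -(integralC_IC (@biorth_sysD R E) fn) unzip_sysD. Qed.

Lemma fourier_dual_Sch_integrand psi x : Sch psi -> Sch (fun xi => cis (- pairing x xi) * psi xi).
Proof.
move=> pS; have := FT_integrand (@prE_r R E) (- x) pS.
by congr Sch; apply/funext => xi; rewrite /prE /pairing linearN.
Qed.

Lemma fourier_dualE psi x : Sch psi ->
  fourier_dual psi x = IC (@sysD R E) (fun xi => cis (- pairing x xi) * psi xi).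
Proof.
move=> pS; have [C Cn] := Sch_nice (@biorth_sysD R E) (fourier_dual_Sch_integrand x pS).
exact: integralC_sysD Cn.
Qed.

Lemma fourier_dual_Sch psi : Sch psi -> Sch (fourier_dual psi).
Proof.
move=> pS.
have lN : linear (fun x : E => - x) by move=> c x y; rewrite opprD scalerN.
have H : forall u : E, jb u <= 1 * jb (- u + 0) by move=> u; rewrite addr0 jbN mul1r.
have := Sch_pull lN H (FD_Sch pS); congr Sch; apply/funext => x.
rewrite (fourier_dualE _ pS) addr0 /FT; congr IC; apply/funext => xi.
by rewrite /prE /pairing linearN.
Qed.

(** Translation and modulation act on a Fourier transform by a phase and a
  translation. *)
Lemma FE_recenter z f eta : Sch f -> normc (FE f eta) = normc (FE (recenter z f) (eta - z.2)).
Proof.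
move=> fS; pose g x := cis (- pairing z.1 eta) * (cis (prD eta x) * f x).
have hS : Sch (fun x => cis (prD eta x) * f x) := FT_integrand (@prD_r R E) eta fS.
have [C Cn] := Sch_nice (@biorth_sysE R E) hS.
have gS : Sch g by exact: Sch_scale.
rewrite (_ : FE (recenter z f) (eta - z.2) = IC (@sysE R E) (fun x => g (x + z.1))).
  by rewrite (IC_shift (@biorth_sysE R E) (@span_sysE R E) _ gS) /g (IC_Z (@biorth_sysE R E) _ Cn) normcM normc_cis mul1r.
congr IC; apply/funext => x; rewrite /recenter /g !mulrA -!cisD; congr (cis _ * _).
by rewrite /prD /pairing add_lfunE opp_lfunE linearD /=; ring.
Qed.

(** The transform of a wave packet at [z] concentrates at the frequency [z.2]. *)
Lemma FE_decay L : exists k, exists2 C : R, 0 <= C & forall f z M eta, Sch f -> qb k M (recenter z f) ->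
  jb (eta - z.2) ^+ L * normc (FE f eta) <= C * M.
Proof.
have [C C0 HC] := FT_decay (@biorth_sysE R E) (@prD_r R E) (@prD_span R E) L.
exists (maxn L (2 * size (@sysE R E))), C => // f z M eta fS fM.
rewrite (FE_recenter z eta fS); apply: HC; first exact: recenter_Sch.
apply: (@Sb_weaken _ _ _ _ _ _ _ _ _ _ _ 1 _ _ _ _ _ fM) => //.
- by rewrite unzip_sysE.
- exact: leq_maxl.
- by move=> x; rewrite mul1r jbX_le// leq_maxr.
- by rewrite mul1r.
Qed.

Lemma weight_mod (m : PS -> R) Cm N : (forall z, 0 < m z) ->
  (forall z w, m z <= Cm * jb (z - w) ^+ N * m w) ->
  exists2 C : R, 0 <= C & forall y y' xi xi',
    m (y, xi) <= C * jb (y - y') ^+ N * jb (xi - xi') ^+ N * m (y', xi').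
Proof.
move=> m0 mP; have [C C0 HC] := jb_pair E (dual E).
exists (`|Cm| * C ^+ N) => [|y y' xi xi']; first by rewrite mulr_ge0// exprn_ge0// ltW.
rewrite (le_trans (mP (y, xi) (y', xi')))// ler_wpM2r ?(ltW (m0 _))//.
rewrite -mulrA -[leRHS]mulrA -!exprMn.
rewrite (@le_trans _ _ (`|Cm| * jb ((y, xi) - (y', xi')) ^+ N))//.
  by rewrite ler_wpM2r ?jbX_ge0// ler_norm.
rewrite ler_wpM2l//  lerXn2r ?nnegrE ?mulr_ge0 ?jb_ge0 ?(ltW C0)//.
exact: HC.
Qed.

Section Chi.
Variables (m : PS -> R) (Cm : R) (N : nat).
Hypothesis m0 : forall z, 0 < m z.
Hypothesis mP : forall z w, m z <= Cm * jb (z - w) ^+ N * m w.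
Variable a : (E -> R[i]) -> R[i].
Hypothesis aT : tempered a.
Variables (G : dual E -> R[i]).
Hypothesis GS : Sch G.
Hypothesis G0 : G 0 = 1.
Variable chi : E -> R[i].
Hypothesis chiS : Sch chi.

Lemma translate_Sch (V : vectType R) (g : V -> R[i]) v : Sch g -> Sch (translate v g).
Proof. exact: Sch_shift. Qed.

Lemma mul_distrE (g f : E -> R[i]) : Sch f -> mul_distr g a f = a (fun x => g x * f x).
Proof. by move=> fS; rewrite /mul_distr patchT// mem_set//; exact: Sch_schwartz. Qed.

Lemma fourier_distrE u psi : Sch psi -> fourier_distr u psi = u (fourier_dual psi).
Proof. by move=> pS; rewrite /fourier_distr patchT// mem_set//; exact: Sch_schwartz. Qed.

Lemma distr_of_funE (F : dual E -> R[i]) psi : Sch psi ->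
  distr_of_fun F psi = integralC (@dual_basis R E) (fun xi => F xi * psi xi).
Proof. by move=> pS; rewrite /distr_of_fun patchT// mem_set//; exact: Sch_schwartz. Qed.

(** The value at [xi] of the Fourier transform of [translate j chi * a]. *)
Definition local_hat j (xi : dual E) : R[i] := a (fun x => translate j chi x * cis (- pairing x xi)).

Lemma wave_Sch j xi : Sch (fun x => translate j chi x * cis (- pairing x xi)).
Proof.
have := FT_integrand (@prD_r R E) (- xi) (translate_Sch j chiS).
by congr Sch; apply/funext => x; rewrite mulrC /prD /pairing opp_lfunE.
Qed.

Lemma wave_pair_Sch j psi : Sch psi ->
  Sch (fun p : PS => translate j chi p.1 * psi p.2 * cis (- pairing p.1 p.2)).
Proof.
move=> pS; apply: Sch_mul_Mod; first exact: Sch_tensor (translate_Sch j chiS) pS.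
apply: (@Mod_pairing R E (dual E) (fun x xi => - prE x xi)) => [xi c x y|x c xi eta].
  by rewrite prE_l opprD /GRing.scale/= mulrN.
by rewrite prE_r opprD /GRing.scale/= mulrN.
Qed.

Lemma wave_pairE j psi xi : Sch psi ->
  a (fun x => translate j chi x * psi xi * cis (- pairing x xi)) = local_hat j xi * psi xi.
Proof.
move=> pS; rewrite mulrC -(tempered_scale aT _ (wave_Sch j xi)); congr a.
by apply/funext => x; ring.
Qed.

Lemma local_hat_nice j psi : Sch psi -> exists C, niceC (@sysD R E) C (fun xi => local_hat j xi * psi xi).
Proof.
move=> pS; have [C Cn] := tempered_nice (@biorth_sysD R E) aT (wave_pair_Sch j pS).
exists C; move: Cn; congr niceC; apply/funext => xi; exact: wave_pairE.
Qed.

(** The distribution [a] passes under the integral defining [fourier_dual]. *)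
Lemma local_hat_distr j :
  fourier_distr (mul_distr (translate j chi) a) = distr_of_fun (local_hat j).
Proof.
apply/funext => psi; have [|pN] := pselect (schwartz psi); last first.
  by rewrite /fourier_distr /distr_of_fun !patchN// notin_setE.
move=> /schwartz_Sch pS.
rewrite (fourier_distrE _ pS) (distr_of_funE _ pS) (mul_distrE _ (fourier_dual_Sch pS)).
have [C Cn] := local_hat_nice j pS; rewrite (integralC_sysD Cn).
have bS := wave_pair_Sch j pS.
transitivity (a (fun x => IC (@sysD R E) (fun xi => translate j chi x * psi xi * cis (- pairing x xi)))).
  congr a; apply/funext => x.
  have [C' Cn'] := Sch_nice (@biorth_sysD R E) (fourier_dual_Sch_integrand x pS).
  rewrite (fourier_dualE _ pS) -(IC_Z (@biorth_sysD R E) _ Cn'); congr IC.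
  by apply/funext => xi; ring.
rewrite (tempered_IC (@biorth_sysD R E) aT bS); congr IC; apply/funext => xi.
exact: wave_pairE.
Qed.

(** The test function is a wave packet at [(j, xi)] whose shape is [chi]. *)
Lemma local_hat_bd k C : microlocal_bound m a k C -> exists2 C' : R, 0 < C' &
  forall j xi, normc (local_hat j xi) <= C' * m (j, xi).
Proof.
move=> aB; have [M HM] := chiS es k k.
exists (`|C * M| + 1) => [|j xi]; first by rewrite ltr_wpDl.
have W : qb k M (recenter (j, xi) (fun x => translate j chi x * cis (- pairing x xi))).
  have := Sb_scale (cis (- pairing j xi)) HM; rewrite normc_cis mul1r.
  rewrite /qb; congr Sb; apply/funext => x; rewrite /recenter /translate /= addrK mulrCA -cisD mulrC.
  by congr (_ * cis _); rewrite /pairing linearD /=; ring.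
rewrite (le_trans (aB _ _ _ (wave_Sch j xi) W))// mulrAC ler_wpM2r ?(ltW (m0 _))//.
by rewrite (le_trans (ler_norm _))// lerDl.
Qed.

Lemma niceC_lip (V : vectType R) (bl : seq (V * (V -> R))) C (g : V -> R[i]) : biorth bl -> niceC bl C g ->
  forall r, {subset unzip1 r <= unzip1 bl} -> forall (c : V * (V -> R) -> R) x,
  normc (g (x + \sum_(p <- r) c p *: p.1) - g x) <= 2 * C * \sum_(p <- r) `|c p|.
Proof.
move=> bo gn; have C0 := niceC_ge0 gn.
elim=> [|p r IH] rs c x; first by rewrite !big_nil addr0 subrr normc0 mulr0.
rewrite !big_cons (addrC (c p *: _)) addrA; set y := x + _.
rewrite -(subrK (g y) (g _)) -addrA mulrDr (le_trans (normcD _ _))// lerD//.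
  have pb : p.1 \in unzip1 bl by apply: rs; rewrite mem_head.
  rewrite (le_trans (gn.2 _ pb (c p) y))//.
  have := wb_le1 bl y; have := wb_le1 bl (y + c p *: p.1) => w1 w2.
  have cp : 0 <= C * `|c p| by rewrite mulr_ge0.
  rewrite (le_trans (ler_wpM2l cp (lerD w2 w1)))//.
  by rewrite (_ : 1 + 1 = 2)// mulrC mulrA.
by apply: IH => q qr; apply: rs; rewrite inE qr orbT.
Qed.

(** Multiplied by a Schwartz function the transform is Lipschitz by
  [local_hat_nice]. The factor [psi] equal to 1 at [xi] is then removed, using
  that the transform is locally bounded. *)
Lemma local_hat_cont j (C : R) : (forall xi, normc (local_hat j xi) <= C * m (j, xi)) ->
  fcontinuous (local_hat j).
Proof.
move=> HC xi e e0; pose psi := translate xi G.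
have pS : Sch psi := translate_Sch xi GS.
have p1 : psi xi = 1 by rewrite /psi /translate subrr G0.
have [A An] := local_hat_nice j pS; have A0 := niceC_ge0 An.
have [B B0 HB] := Sch_lip GS.
have [D D0 HD] := weight_mod m0 mP.
pose d := \dim {:dual E}.
pose Q := `|C| * (D * 2 ^+ N * m (j, xi)) * B.
have Q0 : 0 <= Q by rewrite !mulr_ge0 ?exprn_ge0// ltW.
pose K := \sum_(i < d) \sum_(p <- @sysD R E) `|p.2 (ebasis`_i)|.
have K0 : 0 <= K by apply: sumr_ge0 => i _; exact: sumr_ge0.
(* [niceC_lip] measures [y] by the coordinates of [sysD], [nrm] by those of the
  basis chosen in [dual E]. *)
have nK (y : dual E) : \sum_(p <- @sysD R E) `|p.2 y| <= K * nrm y.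
  rewrite (@le_trans _ _ (\sum_(p <- @sysD R E) \sum_(i < d) `|coord ebasis i y| * `|p.2 (ebasis`_i)|))//.
    rewrite big_map [leRHS]big_map; apply: ler_sum => i _ /=.
    rewrite {1}(ebasis_sum y) sum_lfunE (le_trans (ler_norm_sum _ _ _))//.
    by apply: ler_sum => l _; rewrite scale_lfunE normrM.
  rewrite exchange_big /= /K mulr_suml; apply: ler_sum => i _.
  rewrite -mulr_sumr mulrC ler_wpM2l ?sumr_ge0//; exact: coord_le_nrm.
pose L := 2 * A * K + Q + 1.
have L0 : 0 < L by rewrite ltr_wpDl// addr_ge0// !mulr_ge0.
pose dl := Num.min 1 (e / L) / (d.+1)%:R.
have dl0 : 0 < dl by rewrite divr_gt0 ?ltr0n// lt_min ltr01 divr_gt0.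
exists dl => // eta Heta; set y := eta - xi.
have ny : nrm y <= Num.min 1 (e / L).
  rewrite (@le_trans _ _ (\sum_(i < d) dl))//; first by apply: ler_sum => i _; apply/ltW/Heta.
  rewrite sumr_const card_ord -mulr_natr /dl -mulrA ler_piMr ?(ltW (divr_gt0 _ _))//.
    by rewrite le_min ler01 divr_ge0// ltW.
  by rewrite mulrC ler_pdivrMr ?ltr0n// mul1r ler_nat.
have ny1 : nrm y <= 1 by rewrite (le_trans ny)// ge_min lexx.
have nye : L * nrm y <= e by rewrite mulrC -ler_pdivlMr// (le_trans ny)// ge_min lexx orbT.
have E1 : local_hat j eta - local_hat j xi =
   (local_hat j eta * psi eta - local_hat j xi * psi xi) - local_hat j eta * (psi eta - psi xi).
  by rewrite p1; ring.
have T1 : normc (local_hat j eta * psi eta - local_hat j xi * psi xi) <= 2 * A * K * nrm y.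
  have := @niceC_lip _ _ _ _ (@biorth_sysD R E) An _ (fun _ => id) (fun p => p.2 y) xi.
  rewrite -span_sysD (_ : xi + y = eta); last by rewrite /y addrC subrK.
  move=> h; rewrite (le_trans h)// -[leRHS]mulrA; apply: ler_wpM2l; [exact: mulr_ge0|exact: nK].
have T2 : normc (local_hat j eta * (psi eta - psi xi)) <= Q * nrm y.
  rewrite normcM.
  have -> : psi eta - psi xi = G y - G 0 by rewrite /psi /translate subrr.
  have b2 : normc (local_hat j eta) <= `|C| * (D * 2 ^+ N * m (j, xi)).
    rewrite (le_trans (HC eta))// (@le_trans _ _ (`|C| * m (j, eta)))//.
      by rewrite ler_wpM2r ?ler_norm// ltW.
    rewrite ler_wpM2l// (le_trans (HD j j eta xi))// subrr {1}/jb nrm0 addr0 expr1n mulr1.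
    rewrite ler_wpM2r ?(ltW (m0 _))// ler_wpM2l// lerXn2r ?nnegrE ?jb_ge0//.
    by rewrite /jb -/y; lra.
  rewrite (le_trans (ler_pM (normc_ge0 _) (normc_ge0 _) b2 (HB y)))//.
  by rewrite mulrA.
rewrite E1 (le_lt_trans (normcB _ _))// (le_lt_trans (lerD T1 T2))//.
rewrite -mulrDl; have n0 := nrm_ge0 y.
have {}nye : (2 * A * K + Q) * nrm y + nrm y <= e by rewrite -[X in _ + X]mul1r -mulrDl.
have [n1|n1] := ltP 0 (nrm y); first by lra.
have -> : nrm y = 0 by apply/eqP; rewrite eq_le n1 n0.
by rewrite mulr0.
Qed.

Lemma microlocal_local_hat k C : microlocal_bound m a k C -> exists2 C' : R, 0 < C' &
  forall j, exists2 F : dual E -> R[i],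
    is_function (fourier_distr (mul_distr (translate j chi) a)) F &
    forall xs, normc (F xs) <= C' * m (j, xs).
Proof.
move=> /local_hat_bd[C' C'0 HC']; exists C' => // j; exists (local_hat j) => //.
split; last exact: local_hat_distr.
exact: (local_hat_cont (HC' j)).
Qed.

Section Converse.
Hypothesis cF0 : cF G != 0.

(** Every Schwartz function is the Fourier transform of an explicit one, on which
  the distribution [fourier_distr] can be evaluated. *)
Lemma fourier_dual_FE f : Sch f -> fourier_dual (fun eta => (cF G)^-1 * FE f eta) = f.
Proof.
move=> fS; have hS := FE_Sch fS; apply/funext => y.
rewrite (fourier_dualE _ (Sch_scale _ hS)).
have [C Cn] : exists C, niceC (@sysD R E) C (fun eta => cis (- pairing y eta) * FE f eta).
  by apply: (Sch_nice (@biorth_sysD R E)); exact: fourier_dual_Sch_integrand.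
apply: (mulfI cF0); rewrite -(inversion GS G0 y fS).
transitivity (cF G * ((cF G)^-1 * IC (@sysD R E) (fun eta => cis (- pairing y eta) * FE f eta))).
  congr (_ * _); rewrite -(IC_Z (@biorth_sysD R E) _ Cn); congr IC.
  by apply/funext => eta; ring.
rewrite mulrA mulfV// mul1r; congr IC; apply/funext => eta.
have [C' Cn'] := Sch_nice (@biorth_sysE R E) (FT_integrand (@prD_r R E) eta fS).
rewrite /FT -(IC_Z (@biorth_sysE R E) _ Cn'); congr IC; apply/funext => x.
by rewrite mulrA -cisD; congr (cis _ * _); rewrite /prD /pairing linearB /=; ring.
Qed.

Variable J : set E.
Hypothesis JL : lattice J.
Variable C : R.
Hypothesis loc : forall j, J j -> exists2 F : dual E -> R[i],
    is_function (fourier_distr (mul_distr (translate j chi) a)) F &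
    forall xs, normc (F xs) <= C * m (j, xs).

Definition chi_centre (j : E) z : PS := (j, z.2).

Definition chi_piece j f x := translate j chi x * f x.

Lemma jb_chi_centre : exists2 K : R, 0 < K & forall j z,
  jb (j - z.1) <= K * jb (chi_centre j z - z).
Proof.
have [K K0 HK] := jb_fst E (dual E); exists K => // j z; exact: (HK (chi_centre j z - z)).
Qed.

(** By [fourier_dual_FE], [a (chi_piece l f)] is the integral of the function given
  by the hypothesis against the transform of [f]; the latter decays away from
  [z.2] faster than [m (l, _)] grows. *)
Lemma chi_near : exists k p (S : R), 0 <= S /\ forall l f z M, J l -> Sch f -> qb k M (recenter z f) ->
  normc (a (chi_piece l f)) <= S * m z * jb (chi_centre l z - z) ^+ p * M.
Proof.
pose n := size (@sysD R E).
have [k [Cd Cd0 Hd]] := FE_decay (N + 2 * n).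
have [D D0 HD] := weight_mod m0 mP.
have [K K0 HK] := jb_wb (@biorth_sysD R E).
have [K1 K10 HK1] := jb_chi_centre.
pose c1 := normc (cF G)^-1.
have c10 : 0 <= c1 by exact: normc_ge0.
exists k, N, (2 * (`|C| * D * c1 * Cd * K * K1 ^+ N * pi ^+ n)); split.
  by rewrite !mulr_ge0 ?exprn_ge0 ?pi_ge0// ltW.
move=> l f z M Jl fS fM; have M0 := qb_ge0 fM.
have [F [_ Fd] FC] := loc Jl.
pose psi eta := (cF G)^-1 * FE f eta.
have pS : Sch psi by apply: Sch_scale; exact: FE_Sch.
have -> : a (chi_piece l f) = integralC (@dual_basis R E) (fun xi => F xi * psi xi).
  rewrite -(distr_of_funE _ pS) -Fd (fourier_distrE _ pS) (mul_distrE _ (fourier_dual_Sch pS)).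
  by rewrite fourier_dual_FE.
have mz := ltW (m0 z).
pose Q := `|C| * D * c1 * Cd * K * jb (l - z.1) ^+ N * (m z * M).
have Q0 : 0 <= Q by rewrite !mulr_ge0 ?exprn_ge0 ?jb_ge0// ltW.
have H eta : normc (F eta * psi eta) <= Q * wb (@sysD R E) (eta - z.2).
  rewrite normcM /psi normcM -/c1.
  have J1 := jbX_gt0 (eta - z.2) (N + 2 * n).
  have h1 : normc (FE f eta) <= Cd * M / jb (eta - z.2) ^+ (N + 2 * n).
    by rewrite ler_pdivlMr// mulrC; exact: Hd.
  have h2 : normc (F eta) <= `|C| * (D * jb (l - z.1) ^+ N * jb (eta - z.2) ^+ N * m z).
    rewrite (le_trans (FC eta))// (@le_trans _ _ (`|C| * m (l, eta)))//.
      by rewrite ler_wpM2r ?ler_norm// ltW.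
    by rewrite ler_wpM2l//; case: (z) => z1 z2; exact: HD.
  have h3 : (jb (eta - z.2) ^+ (2 * n))^-1 <= K * wb (@sysD R E) (eta - z.2).
    by rewrite -[leLHS]mul1r ler_pdivrMr ?jbX_gt0//; exact: HK.
  rewrite (le_trans (ler_pM (normc_ge0 _) _ h2 (ler_wpM2l c10 h1)))//.
    by rewrite mulr_ge0 ?normc_ge0.
  have -> : `|C| * (D * jb (l - z.1) ^+ N * jb (eta - z.2) ^+ N * m z) *
      (c1 * (Cd * M / jb (eta - z.2) ^+ (N + 2 * n))) =
    (`|C| * D * c1 * Cd * jb (l - z.1) ^+ N * (m z * M)) * (jb (eta - z.2) ^+ (2 * n))^-1.
    rewrite exprD; have := jbX_gt0 (eta - z.2) N; have := jbX_gt0 (eta - z.2) (2 * n).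
    move: (jb (l - z.1) ^+ N) (jb (eta - z.2) ^+ N) (jb (eta - z.2) ^+ (2 * n)) => v A B B0 A0.
    by field; rewrite !gt_eqF.
  have -> : Q * wb (@sysD R E) (eta - z.2) = (`|C| * D * c1 * Cd * jb (l - z.1) ^+ N * (m z * M)) *
     (K * wb (@sysD R E) (eta - z.2)) by rewrite /Q; ring.
  by rewrite ler_wpM2l// !mulr_ge0 ?exprn_ge0 ?jb_ge0.
rewrite -unzip_sysD (le_trans (integralC_bd (@biorth_sysD R E) Q0 H))// /Q.
have : jb (l - z.1) ^+ N <= K1 ^+ N * jb (chi_centre l z - z) ^+ N.
  by rewrite -exprMn lerXn2r ?nnegrE ?mulr_ge0 ?jb_ge0 ?(ltW K10)//.
move: (jb (l - z.1) ^+ N) (jb (chi_centre l z - z) ^+ N) => u v uv.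
have -> : 2 * (`|C| * D * c1 * Cd * K * u * (m z * M) * pi ^+ n) =
   (2 * (`|C| * D * c1 * Cd * K * pi ^+ n) * (m z * M)) * u by move: (pi ^+ n) => q; ring.
have -> : 2 * (`|C| * D * c1 * Cd * K * K1 ^+ N * pi ^+ n) * m z * v * M =
   (2 * (`|C| * D * c1 * Cd * K * pi ^+ n) * (m z * M)) * (K1 ^+ N * v) by move: (pi ^+ n) => q; ring.
by rewrite ler_wpM2l// !mulr_ge0 ?exprn_ge0 ?pi_ge0// ltW.
Qed.

(** [chi] decays away from [l] and [f] away from [z.1], so that their product is
  small when these points are far apart. *)
Lemma chi_far L : exists k0, forall k, (k0 <= k)%N -> exists C, forall l f z M, J l -> Sch f ->
  qb k M (recenter z f) -> qb k (C * jb (chi_centre l z - z) ^- L * M) (recenter (chi_centre l z) (chi_piece l f)).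
Proof.
have [K1 K10 HK1] := jb_chi_centre.
have [K2 K20 HK2] := jb_pair E (dual E).
have jc l z : jb (chi_centre l z - z) <= K2 * jb (l - z.1).
  have J0 : jb (0 : dual E) = 1 by rewrite /jb nrm0 addr0.
  have := HK2 (l - z.1) 0; rewrite J0 mulr1.
  by rewrite (_ : (l - z.1, 0) = chi_centre l z - z)//; apply: injective_projections => //=; rewrite subrr.
exists L => k Lk.
have [Mc HMc] := chiS es k (k + k).
exists (2 ^+ k * `|Mc| * K2 ^+ L) => l f z M Jl fS fM; have M0 := qb_ge0 fM.
set u := l - z.1.
have S1 : Sb es k (fun x => jb (x + u) ^+ k) M (fun x => recenter z f (x + u)).
  exact: (Sb_shift u fM).
have S2 := Sb_mul (fun x => jbX_ge0 x (k + k)) (fun x => jbX_ge0 (x + u) k) HMc S1.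
have S3 := Sb_scale (cis (- pairing u z.2)) S2.
rewrite /qb (_ : recenter _ _ = fun x => cis (- pairing u z.2) * (chi x * recenter z f (x + u))); last first.
  apply/funext => x; rewrite /recenter /chi_piece /translate /= addrK /u.
  rewrite -addrA subrK mulrCA [in RHS]mulrCA; congr (_ * _).
  by rewrite mulrA -cisD; congr (cis _ * _); rewrite /pairing linearD /=; ring.
have ju := jb_gt0 u.
apply: (@Sb_weaken _ _ _ _ _ _ _ _ _ _ _ (jb u ^- k) _ _ _ _ _ S3) => // [|x|].
- by rewrite invr_ge0 jbX_ge0.
- rewrite mulrC ler_pdivlMr ?jbX_gt0// exprD -mulrA ler_wpM2l ?jbX_ge0//.
  rewrite -exprMn lerXn2r ?nnegrE ?mulr_ge0 ?jb_ge0//.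
  rewrite -{1}(addKr x u) mulrC (le_trans (jbD _ _))// jbN mulrC; exact: lexx.
- rewrite normc_cis mul1r.
  have J0 : 0 <= jb u ^- k by rewrite invr_ge0 jbX_ge0.
  have h1 : jb u ^- k <= K2 ^+ L * jb (chi_centre l z - z) ^- L.
    rewrite ler_pdivlMr ?jbX_gt0// mulrC ler_pdivrMr ?jbX_gt0//.
    rewrite (@le_trans _ _ ((K2 * jb u) ^+ L))//.
      by rewrite lerXn2r ?nnegrE ?mulr_ge0 ?jb_ge0 ?(ltW K20)//; exact: jc.
    by rewrite exprMn ler_wpM2l ?exprn_ge0 ?(ltW K20)// jbX_le.
  have h2 : 2 ^+ k * (Mc * M) <= 2 ^+ k * `|Mc| * M.
    by rewrite -mulrA ler_wpM2l ?exprn_ge0// ler_wpM2r// ler_norm.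
  rewrite (le_trans (ler_wpM2l J0 h2))//.
  have -> : 2 ^+ k * `|Mc| * K2 ^+ L * jb (chi_centre l z - z) ^- L * M =
     (K2 ^+ L * jb (chi_centre l z - z) ^- L) * (2 ^+ k * `|Mc| * M) by ring.
  by rewrite ler_wpM2r// !mulr_ge0 ?exprn_ge0.
Qed.

Lemma has_sumMr (V : vectType R) (I : set V) (g : V -> R[i]) s c : has_sum I g s ->
  has_sum I (fun l => g l * c) (s * c).
Proof.
move=> gs e e0; have c0 : 0 < normc c + 1 by rewrite ltr_wpDl// normc_ge0.
have [A [AI HA]] := gs _ (divr_gt0 e0 c0); exists A; split=> // B AB BI.
rewrite -mulr_suml -mulrBl normcM.
have := HA B AB BI; set t := normc (_ - _) => ht.
have t0 : 0 <= t by exact: normc_ge0.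
rewrite (@le_lt_trans _ _ (t * (normc c + 1)))//; first by rewrite ler_wpM2l// lerDl.
by rewrite -ltr_pdivlMr.
Qed.

Hypothesis chi1 : partition_of_unity J chi.

(** Here decay of [f] at infinity pays for the distance of the pieces to 0. *)
Lemma chi_sum f : Sch f -> has_sum J (fun l => a (chi_piece l f)) (1 * a f).
Proof.
move=> fS; rewrite mul1r; have [K K0 HK] := lattice_sum JL.
apply: (@tempered_has_sum _ _ _ _ (fun l => jb (0 - l) ^- (2 * \dim {:E})) K) => //.
- by move=> l; rewrite invr_ge0 jbX_ge0.
- exact: HK.
- by move=> l; apply: Sch_mul => //; exact: translate_Sch.
- move=> k n; set q := (2 * _)%N.
  have [M HM] := chiS es n q; have [M' HM'] := fS es n (k + q)%N.
  exists (2 ^+ n * (M * M')) => l _.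
  have S1 : Sb es n (fun x => jb (x - l) ^+ q) M (translate l chi).
    exact: (Sb_shift (- l) HM).
  have S2 := Sb_mul (fun x => jbX_ge0 (x - l) q) (fun x => jbX_ge0 x (k + q)) S1 HM'.
  apply: (@Sb_weaken _ _ _ _ _ _ _ _ _ _ _ (jb (0 - l) ^- q) _ _ _ _ _ S2) => // [|x|].
  + by rewrite invr_ge0 jbX_ge0.
  + rewrite mulrC ler_pdivlMr ?jbX_gt0// exprD mulrCA ler_wpM2l ?jbX_ge0//.
    rewrite -exprMn lerXn2r ?nnegrE ?mulr_ge0 ?jb_ge0//.
    by rewrite (_ : 0 - l = (x - l) - x) ?jbB// addrAC subrr.
  + by rewrite mulrC.
- by move=> x; have := has_sumMr (f x) (chi1 x); rewrite mul1r.
Qed.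

Lemma chi_microlocal : exists k C, microlocal_bound m a k C.
Proof.
apply: (@absorption _ _ _ Cm N m0 mP _ aT _ J chi_centre chi_piece 1).
- exact: oner_neq0.
- by move=> l f fS; apply: Sch_mul => //; exact: translate_Sch.
- exact: chi_sum.
- have [K K0 HK] := lattice_sum JL; have [K1 K10 HK1] := jb_chi_centre.
  exists (2 * \dim {:E})%N, (K1 ^+ (2 * \dim {:E}) * K); split; first by rewrite mulr_ge0 ?exprn_ge0// ltW.
  move=> z A AJ; rewrite (le_trans _ (ler_wpM2l _ (HK z.1 A AJ))) ?exprn_ge0 ?(ltW K10)//.
  rewrite mulr_sumr; apply: ler_sum => l _.
  rewrite ler_pdivlMr ?jbX_gt0// mulrC ler_pdivrMr ?jbX_gt0// -exprMn.
  by rewrite lerXn2r ?nnegrE ?mulr_ge0 ?jb_ge0 ?(ltW K10)// jb_distC.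
- exact: chi_near.
- exact: chi_far.
Qed.

End Converse.

End Chi.

End FourierSide.

(** * The Cauchy-Schwarz inequality *)

Section CauchySchwarz.
Context {R : realType} {V : vectType R}.
Variable bl : seq (V * (V -> R)).
Hypothesis bo : biorth bl.
Implicit Types (u f : V -> R[i]).

Lemma niceC_mul C C' f g : niceC bl C f -> niceC bl C' g -> niceC bl (2 * (C * C')) (fun x => f x * g x).
Proof.
move=> fn gn; have C0 := niceC_ge0 fn; have C0' := niceC_ge0 gn.
have CC : 0 <= C * C' by exact: mulr_ge0.
split=> [x|v vb s x].
  rewrite normcM (le_trans (ler_pM (normc_ge0 _) (normc_ge0 _) (fn.1 x) (gn.1 x)))//.
  rewrite mulrACA; have := wb_le1 bl x; have := wb_ge0 bl x; set q := wb bl x => q0 q1.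
  have : q * q <= q by rewrite -[leRHS]mulr1 ler_wpM2l.
  nra.
have := wb_le1 bl x; have := wb_ge0 bl x; have := wb_le1 bl (x + s *: v); have := wb_ge0 bl (x + s *: v).
have := fn.2 v vb s x; have := gn.2 v vb s x; have := fn.1 (x + s *: v); have := gn.1 x.
set q := wb bl x; set q' := wb bl (x + s *: v) => b1 b2 b3 b4 q'0 q'1 q0 q1.
have -> : f (x + s *: v) * g (x + s *: v) - f x * g x =
   f (x + s *: v) * (g (x + s *: v) - g x) + g x * (f (x + s *: v) - f x) by ring.
rewrite (le_trans (normcD _ _))// !normcM.
have h1 := ler_pM (normc_ge0 _) (normc_ge0 _) b2 b3.
have h2 := ler_pM (normc_ge0 _) (normc_ge0 _) b1 b4.
rewrite (le_trans (lerD h1 h2))//.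
have -> : C * q' * (C' * `|s| * (q + q')) + C' * q * (C * `|s| * (q + q')) =
  (C * C' * `|s| * (q + q')) * (q + q') by ring.
have -> : 2 * (C * C') * `|s| * (q + q') = (C * C' * `|s| * (q + q')) * 2 by ring.
by rewrite ler_wpM2l// ?mulr_ge0 ?addr_ge0//; lra.
Qed.

Lemma niceC_conj C f : niceC bl C f -> niceC bl C (fun x => (f x)^*)%C.
Proof.
have nJ (z : R[i]) : normc (z^*)%C = normc z by case: z => a b; rewrite /normc /= sqrrN.
case=> f1 f2; split=> [x|v vb s x]; first by rewrite nJ.
by rewrite -rmorphB /= nJ; exact: f2.
Qed.

Lemma niceC_sqr C f : niceC bl C f -> niceC bl (2 * (C * C)) (fun x => real_complex R (normc (f x) ^+ 2)).
Proof.
move=> fn; have := niceC_mul fn (niceC_conj fn).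
by congr niceC; apply/funext => x; rewrite mul_conjC_normc.
Qed.

Lemma sqr_normc_add_conj (p q t : R[i]) : real_complex R (normc (p + (t * q)^*%C) ^+ 2) =
  real_complex R (normc p ^+ 2) + real_complex R (normc t ^+ 2) * real_complex R (normc q ^+ 2) +
  (t * (p * q) + (t^*)%C * (p * q)^*%C).
Proof.
rewrite -!mul_conjC_normc; case: p => a b; case: q => c d; case: t => e f.
by apply: complexE; rewrite !(ReD, ImD, ReM, ImM, ReJ, ImJ) /=; ring.
Qed.

(** Expand the nonnegative integral of [|u - s I f^*| ^ 2], where [I] is the
  integral of [u * f], and choose the real number [s]. *)
Lemma Cauchy_Schwarz C C' u f A B : niceC bl C u -> niceC bl C' f ->
  complex.Re (IC bl (fun x => real_complex R (normc (u x) ^+ 2))) <= A ->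
  complex.Re (IC bl (fun x => real_complex R (normc (f x) ^+ 2))) <= B ->
  normc (IC bl (fun x => u x * f x)) ^+ 2 <= A * B.
Proof.
move=> un fn uA fB.
set I := IC bl (fun x => u x * f x).
have un2 := niceC_sqr un; have fn2 := niceC_sqr fn; have ufn := niceC_mul un fn.
have ufJ := niceC_conj ufn.
have Rge0 C1 (h : V -> R) : niceC bl C1 (fun x => real_complex R (h x)) -> (forall x, 0 <= h x) ->
    0 <= complex.Re (IC bl (fun x => real_complex R (h x))).
  move=> hn h0; have z0 : niceC bl 0 (fun=> real_complex R 0) by exact: niceC_0.
  by have := IC_real_mono bo z0 hn h0; rewrite IC_0.
have A0 : 0 <= A by rewrite (le_trans _ uA)// (Rge0 _ _ un2)// => x; rewrite sqr_ge0.
have B0 : 0 <= B by rewrite (le_trans _ fB)// (Rge0 _ _ fn2)// => x; rewrite sqr_ge0.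
have Q s : 2 * s * normc I ^+ 2 <= A + s ^+ 2 * normc I ^+ 2 * B.
  pose tau := real_complex R (- s) * (I^*)%C.
  pose h x := normc (u x + (tau * f x)^*%C) ^+ 2.
  have hE : (fun x => real_complex R (h x)) = fun x =>
      real_complex R (normc (u x) ^+ 2) + real_complex R (normc tau ^+ 2) * real_complex R (normc (f x) ^+ 2) +
      (tau * (u x * f x) + (tau^*)%C * (u x * f x)^*%C).
    by apply/funext => x; exact: sqr_normc_add_conj.
  have T1 := niceC_Z (real_complex R (normc tau ^+ 2)) fn2.
  have T2 := niceC_Z tau ufn; have T3 := niceC_Z (tau^*)%C ufJ.
  have hn := niceC_D (niceC_D un2 T1) (niceC_D T2 T3).
  have h0 x : 0 <= h x by exact: sqr_ge0.
  have := hn; rewrite -hE => /Rge0 /(_ h0).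
  rewrite hE (IC_D bo (niceC_D un2 T1) (niceC_D T2 T3)) (IC_D bo un2 T1) (IC_D bo T2 T3).
  rewrite (IC_Z bo _ fn2) (IC_Z bo _ ufn) (IC_Z bo _ ufJ) (IC_conj bo ufn) -/I.
  rewrite !ReD -rmorphM ReJ.
  have -> : complex.Re (tau * I) = - s * normc I ^+ 2.
    by rewrite /tau -mulrA [_ * I]mulrC mul_conjC_normc -rmorphM.
  have nt : normc tau ^+ 2 = s ^+ 2 * normc I ^+ 2.
    rewrite /tau normcM normc_real normrN exprMn real_normK ?num_real//; congr (_ * _ ^+ 2).
    by case: (I) => a b; rewrite /normc /= sqrrN.
  have -> : complex.Re (real_complex R (normc tau ^+ 2) * IC bl (fun x => real_complex R (normc (f x) ^+ 2)))
     = s ^+ 2 * normc I ^+ 2 * complex.Re (IC bl (fun x => real_complex R (normc (f x) ^+ 2))).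
    by rewrite ReM nt /= mul0r subr0.
  have k0 : 0 <= s ^+ 2 * normc I ^+ 2 by rewrite mulr_ge0 ?sqr_ge0.
  have := ler_wpM2l k0 fB; lra.
have [Bp|] := ltP 0 B.
  have := Q B^-1.
  have -> : B^-1 ^+ 2 * normc I ^+ 2 * B = B^-1 * normc I ^+ 2 by field; rewrite gt_eqF.
  move=> H; have {}H : B^-1 * normc I ^+ 2 <= A by lra.
  by move: H; rewrite mulrC ler_pdivrMr.
move=> Bn; have -> : B = 0 by apply/eqP; rewrite eq_le B0 Bn.
rewrite mulr0; have [//|Ip] := leP (normc I ^+ 2) 0.
have := Q ((A + 1) / normc I ^+ 2).
have -> : B = 0 by apply/eqP; rewrite eq_le B0 Bn.
rewrite mulr0 addr0 -mulrA divfK ?gt_eqF//; lra.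
Qed.

End CauchySchwarz.

(** * Kernels of Weyl operators *)

Section WeylKernel.
Context {R : realType} {E : vectType R}.
Local Notation PS := (E * dual E)%type.
Local Notation es := (ebasis : seq E).
Local Notation bE := (@biorth_sysE R E).
Local Notation bD := (@biorth_sysD R E).
Local Notation FE := (FT (@sysE R E) (@prD R E)).
Implicit Types (f : E -> R[i]) (b : PS -> R[i]) (z g : PS).

Lemma half_add (V : vectType R) (x : V) : 2^-1 *: (x + x) = x.
Proof.
have -> : x + x = 2%:R *: x by rewrite scaler_nat mulr2n.
by rewrite scalerA mulVf ?scale1r// pnatr_eq0.
Qed.

(** The kernel of a Weyl operator is a partial Fourier transform of its symbol in
  these variables. *)
Definition midpoint_diff (p : E * E) : E * E := (2^-1 *: (p.1 + p.2), p.1 - p.2).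

Lemma midpoint_diff_linear : linear midpoint_diff.
Proof.
move=> c [x y] [x' y']; rewrite /midpoint_diff /=; apply: injective_projections => /=.
  by rewrite addrACA -scalerDr [LHS]scalerDr !scalerA [c * _]mulrC.
by rewrite scalerBr opprD addrACA.
Qed.

Lemma jb_midpoint_diff : exists2 C : R, 0 < C & forall p : E * E, jb p <= C * jb (midpoint_diff p).
Proof.
pose L (q : E * E) : E * E := (q.1 + 2^-1 *: q.2, q.1 - 2^-1 *: q.2).
have lL : linear L.
  move=> c [x y] [x' y']; rewrite /L /=; apply: injective_projections => /=.
    by rewrite !scalerDr !scalerA [c * _]mulrC addrACA.
  by rewrite scalerBr scalerDr !scalerA [c * _]mulrC opprD addrACA.
have LK p : L (midpoint_diff p) = p.
  case: p => x y; rewrite /L /midpoint_diff /=; congr pair.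
    by rewrite -scalerDr addrACA subrr addr0 half_add.
  by rewrite -scalerBr opprB addrC addrA subrK half_add.
have [C C0 HC] := linear_nrm lL.
exists (1 + C) => [|p]; first by rewrite ltr_pwDl.
by apply: jb_le => //; rewrite -{1}(LK p).
Qed.

Definition wker b (p : E * E) : R[i] := weyl_kernel b p.1 p.2.

Lemma wkerE b p : Sch b ->
  wker b p = real_complex R ((2 * pi) ^- \dim {:E}) * PF (@sysD R E) (@prE R E) b (midpoint_diff p).
Proof.
move=> bS; have [C Cn] := Sch_nice bD (PF_integrand (@prE_r R E) (midpoint_diff p) bS).
by rewrite /wker /weyl_kernel; congr (_ * _); exact: (integralC_sysD Cn).
Qed.

Lemma wker_Sch b : Sch b -> Sch (wker b).
Proof.
move=> bS; have pS := PF_Sch bD (@prE_l R E) (@prE_r R E) (@prE_span R E) bS.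
have [C C0 HC] := jb_midpoint_diff.
have H p : jb p <= C * jb (midpoint_diff p + 0) by rewrite addr0.
have := Sch_scale (real_complex R ((2 * pi) ^- \dim {:E})) (Sch_pull midpoint_diff_linear H pS).
by congr Sch; apply/funext => p; rewrite (wkerE _ bS) addr0.
Qed.

(** Shift the momentum variable of integration by [g.2]. *)
Lemma wker_translate b g x y : Sch b ->
  wker (translate g b) (x, y) = cis (pairing (x - y) g.2) * wker b (x - g.1, y - g.1).
Proof.
move=> bS; rewrite !wkerE//; last exact: translate_Sch.
rewrite mulrCA; congr (_ * _).
set q := midpoint_diff (x - g.1, y - g.1).
have qE : midpoint_diff (x, y) - (g.1, 0) = q.
  rewrite /q /midpoint_diff /=; apply: injective_projections => /=.
    by rewrite [in RHS]addrACA -opprD scalerBr half_add.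
  by rewrite opprB addrA subrK subr0.
have I1 := PF_integrand (@prE_r R E) q bS.
have I2 := Sch_shift (- g.2) (Sch_scale (cis (pairing (x - y) g.2)) I1).
have [C Cn] := Sch_nice bD I1.
rewrite /PF -(IC_Z bD _ Cn) -(IC_shift bD (@span_sysD R E) (- g.2) (Sch_scale _ I1)); congr IC.
apply/funext => w; rewrite mulrA -cisD /translate -qE /midpoint_diff /= subr0 -/(x - y); congr (cis _ * b _).
by rewrite /prE /pairing add_lfunE opp_lfunE; ring.
Qed.

(** The transposed Weyl operators take this form in coordinates centred at their
  symbols, see [weylT_recenter]. *)
Definition twisted (k : E * E -> R[i]) (phi : E -> R[i]) (u : E) (om : dual E) (x : E) : R[i] :=
  FE (fun t => k (x, t) * phi (t + u)) om.

Lemma isD_zero (V : vectType R) (f : V -> R[i]) : isD 0 f (fun=> 0).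
Proof.
move=> x; have := isDC (0 : V) (f x) x.
by under eq_fun do rewrite /=; case=> H1 H2; split; [move: H1|move: H2]; apply: eq_is_derive => //;
  apply/funext => t; rewrite scaler0 addr0.
Qed.

Lemma twisted_Sch k phi u om : Sch k -> Sch phi ->
  Sch (fun p : E * E => k p * (cis (prD om p.2) * phi (p.2 + u))).
Proof.
move=> kS pS; apply: Sch_mul_Mod => //.
have := Mod_pull 0 (@linear_snd R E E) (Sch_Mod (FT_integrand (@prD_r R E) om (Sch_shift u pS))).
by congr Mod; apply/funext => p; rewrite addr0.
Qed.

Lemma twistedE k phi u om x :
  twisted k phi u om x = IC (@sysE R E) (fun t => k (x, t) * (cis (prD om t) * phi (t + u))).
Proof. by rewrite /twisted /FT; congr IC; apply/funext => t; rewrite mulrCA. Qed.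

Lemma twisted_isD k k' phi u om v : Sch k -> Sch k' -> Sch phi -> isD (v, 0) k k' ->
  isD v (twisted k phi u om) (twisted k' phi u om).
Proof.
move=> kS k'S pS kk'.
have [_ _ H] := @parametric_IC R E E (@sysE R E) bE.
have D0 : isD (v, 0 : E) (fun p : E * E => cis (prD om p.2) * phi (p.2 + u)) (fun=> 0).
  have z := isD_zero (fun t => cis (prD om t) * phi (t + u)).
  have := @isD_comp_affine R E (E * E)%type snd 0 (v, 0) _ _ (@linear_snd R E E) z.
  by congr isD; apply/funext => p; rewrite addr0.
have D1 := isDM kk' D0.
have D2 : isD (v, 0 : E) (fun p : E * E => k p * (cis (prD om p.2) * phi (p.2 + u)))
    (fun p => k' p * (cis (prD om p.2) * phi (p.2 + u))).
  by move: D1; congr isD; apply/funext => p; rewrite mulr0 addr0.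
have := H _ _ _ (twisted_Sch u om kS pS) (twisted_Sch u om k'S pS) D2.
by congr isD; apply/funext => x; rewrite twistedE.
Qed.

(** Decay in [om] comes from integration by parts in the twisted variable, decay in
  [u] from the decay of [k] in its second variable and of [phi] at infinity.
  Derivatives in [x] only touch [k], so that smoothness of the result is free and
  the order [L] required of [phi] does not depend on [n]. *)
Lemma twisted_bd k n l L : Sch k -> exists2 C : R, 0 <= C & forall phi u om M, Sch phi ->
  Sb es L (fun x => jb x ^+ L) M phi ->
  Sb es n (fun x => jb x ^+ l) (C * (jb u ^- L * jb om ^- L * M)) (twisted k phi u om).
Proof.
have base k' : Sch k' -> exists2 C : R, 0 <= C & forall phi u om M x, Sch phi ->
    Sb es L (fun x => jb x ^+ L) M phi ->
    jb x ^+ l * normc (twisted k' phi u om x) <= C * (jb u ^- L * jb om ^- L * M).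
  move=> k'S; pose q := (2 * size (@sysE R E))%N.
  have [C1 C10 HC] := FT_decay bE (@prD_r R E) (@prD_span R E) L.
  have [M1 HM1] := Sch_fiber es L (q + L) l k'S.
  exists (C1 * (2 ^+ L * `|M1|)) => [|phi u om M x pS pM]; first by rewrite !mulr_ge0 ?exprn_ge0.
  have M0 : 0 <= M by rewrite (le_trans _ (Sb_bd pM 0))// mulr_ge0 ?jbX_ge0 ?normc_ge0.
  have S1 : Sb es L (fun x => jb (x + u) ^+ L) M (fun x => phi (x + u)).
    exact: (Sb_shift u pM).
  have w0 (t : E) : 0 <= jb x ^+ l * jb t ^+ (q + L) by rewrite mulr_ge0 ?jbX_ge0.
  have S2 := Sb_mul w0 (fun t => jbX_ge0 (t + u) L) (HM1 x) S1.
  have S3 : Sb (unzip1 (@sysE R E)) L (fun t => jb t ^+ q) (jb x ^- l * jb u ^- L * (2 ^+ L * (`|M1| * M)))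
      (fun t => k' (x, t) * phi (t + u)).
    rewrite unzip_sysE.
    apply: (@Sb_weaken _ _ _ _ _ _ _ _ _ _ _ (jb x ^- l * jb u ^- L) _ _ _ _ _ S2) => // [|t|].
    - by rewrite mulr_ge0 ?invr_ge0 ?jbX_ge0.
    - have h : jb u ^+ L <= jb t ^+ L * jb (t + u) ^+ L.
        rewrite -exprMn lerXn2r ?nnegrE ?mulr_ge0 ?jb_ge0//.
        have {1}-> : u = (t + u) - t by rewrite addrAC subrr add0r.
        rewrite (le_trans (jbB _ _))// [leRHS]mulrC; exact: lexx.
      have -> : jb x ^- l * jb u ^- L * (jb x ^+ l * jb t ^+ (q + L) * jb (t + u) ^+ L) =
         jb u ^- L * (jb t ^+ q * (jb t ^+ L * jb (t + u) ^+ L)).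
        have := jbX_gt0 x l; have := jbX_gt0 u L; rewrite exprD.
        move: (jb x ^+ l) (jb u ^+ L) (jb t ^+ q) (jb t ^+ L) (jb (t + u) ^+ L) => A1 A2 A3 A4 A5 p2 p1.
        by field; rewrite !gt_eqF.
      rewrite mulrC ler_pdivlMr ?jbX_gt0// ler_wpM2l ?jbX_ge0//.
    - by rewrite ler_wpM2l ?mulr_ge0 ?invr_ge0 ?jbX_ge0// ler_wpM2l ?exprn_ge0// ler_wpM2r// ler_norm.
  have hS : Sch (fun t => k' (x, t) * phi (t + u)).
    by apply: Sch_mul; [exact: Sch_fiber_Sch|exact: Sch_shift].
  have := HC _ _ om hS S3; rewrite -/(twisted k' phi u om x); move: (normc _) => y.
  rewrite mulrC -ler_pdivlMr ?jbX_gt0// => h.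
  rewrite (le_trans (ler_wpM2l (jbX_ge0 _ _) h))//.
  have := jbX_gt0 x l; have := jbX_gt0 u L; have := jbX_gt0 om L.
  move: (jb x ^+ l) (jb u ^+ L) (jb om ^+ L) (2 ^+ L) => A1 A2 A3 A4 p3 p2 p1.
  by rewrite le_eqVlt; apply/orP; left; apply/eqP; field; rewrite !gt_eqF.
elim: n k => [|n IH] k kS.
  have [C C0 HC] := base k kS; exists C => // phi u om M pS pM; split=> // x; exact: HC.
have [C C0 HC] := base k kS.
have [C' HC'] : exists C', forall v, v \in es -> C <= C' /\ exists k', [/\ isD (v, 0) k k', Sch k' &
    forall phi u om M, Sch phi -> Sb es L (fun x => jb x ^+ L) M phi ->
    Sb es n (fun x => jb x ^+ l) (C' * (jb u ^- L * jb om ^- L * M)) (twisted k' phi u om)].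
  apply: (@seq_bound R E (fun v C' => C <= C' /\ exists k', [/\ isD (v, 0) k k', Sch k' &
    forall phi u om M, Sch phi -> Sb es L (fun x => jb x ^+ L) M phi ->
    Sb es n (fun x => jb x ^+ l) (C' * (jb u ^- L * jb om ^- L * M)) (twisted k' phi u om)])).
    move=> v D D' DD' [CD [k' [kk' k'S Hk']]]; split; first exact: le_trans CD DD'.
    exists k'; split=> // phi u om M pS pM; apply: Sb_mono (Hk' phi u om M pS pM) => //.
    have M0 : 0 <= M by rewrite (le_trans _ (Sb_bd pM 0))// mulr_ge0 ?jbX_ge0 ?normc_ge0.
    by rewrite ler_wpM2r// !mulr_ge0// invr_ge0 jbX_ge0.
  move=> v _; have [k' [kk' k'S]] := Sch_D (v, 0) kS.
  have [C1 C10 HC1] := IH k' k'S; exists (Num.max C C1); split; first by rewrite le_max lexx.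
  exists k'; split=> // phi u om M pS pM; apply: Sb_mono (HC1 phi u om M pS pM) => //.
  have M0 : 0 <= M by rewrite (le_trans _ (Sb_bd pM 0))// mulr_ge0 ?jbX_ge0 ?normc_ge0.
  by rewrite ler_wpM2r ?le_max ?lexx ?orbT// !mulr_ge0// invr_ge0 jbX_ge0.
exists (Num.max C C') => [|phi u om M pS pM]; first by rewrite le_max C0.
have M0 : 0 <= M by rewrite (le_trans _ (Sb_bd pM 0))// mulr_ge0 ?jbX_ge0 ?normc_ge0.
have q0 : 0 <= jb u ^- L * jb om ^- L * M by rewrite !mulr_ge0// invr_ge0 jbX_ge0.
split=> [x|v vs].
  by rewrite (le_trans (HC phi u om M x pS pM))// ler_wpM2r// le_max lexx.
have [_ [k' [kk' k'S Hk']]] := HC' v vs.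
exists (twisted k' phi u om); split; first exact: twisted_isD.
by apply: Sb_mono (Hk' phi u om M pS pM) => //; rewrite ler_wpM2r// le_max lexx orbT.
Qed.

End WeylKernel.

(** * Localization in phase space *)

Section XiSide.
Context {R : realType} {E : vectType R}.
Local Notation PS := (E * dual E)%type.
Local Notation es := (ebasis : seq E).
Local Notation bE := (@biorth_sysE R E).
Local Notation bD := (@biorth_sysD R E).
Local Notation sE := (@sysE R E).
Local Notation sD := (@sysD R E).
Local Notation FE := (FT (@sysE R E) (@prD R E)).
Implicit Types (f : E -> R[i]) (b : PS -> R[i]) (z g : PS).

Variables (m : PS -> R) (Cm : R) (N : nat).
Hypothesis m0 : forall z, 0 < m z.
Hypothesis mP : forall z w, m z <= Cm * jb (z - w) ^+ N * m w.
Variable a : (E -> R[i]) -> R[i].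
Hypothesis aT : tempered a.
Variable Xi : PS -> R[i].
Hypothesis XiS : Sch Xi.

(** The transpose of the Weyl operator with symbol [b], acting on test functions. *)
Definition weylT b f (y : E) : R[i] := IC sE (fun x => wker b (x, y) * f x).

Lemma weylT_pair_Sch b f : Sch b -> Sch f -> Sch (fun p : E * E => wker b (p.2, p.1) * f p.2).
Proof.
move=> bS fS; apply: Sch_mul_Mod; first exact: Sch_swap (wker_Sch bS).
have := Mod_pull 0 (@linear_snd R E E) (Sch_Mod fS).
by congr Mod; apply/funext => p; rewrite addr0.
Qed.

Lemma weylT_Sch b f : Sch b -> Sch f -> Sch (weylT b f).
Proof. by move=> bS fS; exact: (IC_Sch bE (weylT_pair_Sch bS fS)). Qed.

(** The distribution passes under the integral: duality between the operator and
  its transpose. *)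
Lemma tempered_weylT b f : Sch b -> Sch f ->
  a (weylT b f) = IC sE (fun x => weyl b a x * f x).
Proof.
move=> bS fS; rewrite (tempered_IC bE aT (weylT_pair_Sch bS fS)); congr IC; apply/funext => x /=.
rewrite mulrC -(tempered_scale aT); last exact: (Sch_fiber_Sch x (wker_Sch bS)).
by congr a; apply/funext => y; rewrite mulrC.
Qed.

Lemma weyl_nice b : Sch b -> exists C, niceC sE C (weyl b a).
Proof.
move=> bS; have := tempered_nice bE aT (Sch_swap (wker_Sch bS)); exact.
Qed.

Lemma wker_recenter g x y :
  recenter g (fun y => wker (translate g Xi) (x, y)) y = cis (pairing (x - g.1) g.2) * wker Xi (x - g.1, y).
Proof.
rewrite /recenter (wker_translate _ _ _ XiS) addrK mulrA -cisD; congr (cis _ * _).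
by rewrite /pairing !linearB /= linearD /=; ring.
Qed.

(** [weyl] tests [a] against the rows of the kernel, and the row through [x] is a
  wave packet at [g] of size rapidly decreasing in [x - g.1]. *)
Lemma weyl_bd k C n : microlocal_bound m a k C -> exists2 C' : R, 0 <= C' &
  forall g x, normc (weyl (translate g Xi) a x) <= C' * m g * jb (x - g.1) ^- n.
Proof.
move=> aB; have [M HM] := Sch_fiber es k k n (wker_Sch XiS).
exists `|C * M| => // g x.
have S1 := Sb_scale (cis (pairing (x - g.1) g.2)) (HM (x - g.1)).
have q : qb k (jb (x - g.1) ^- n * M) (recenter g (fun y => wker (translate g Xi) (x, y))).
  rewrite (_ : recenter _ _ = fun y => cis (pairing (x - g.1) g.2) * wker Xi (x - g.1, y)); last first.
    by apply/funext => y; exact: wker_recenter.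
  apply: (@Sb_weaken _ _ _ _ _ _ _ _ _ _ _ (jb (x - g.1) ^- n) _ _ _ _ _ S1) => // [|y|].
  - by rewrite invr_ge0 jbX_ge0.
  - by rewrite mulKf// expf_neq0 ?jb_neq0.
  - by rewrite normc_cis mul1r.
have kS : Sch (fun y => wker (translate g Xi) (x, y)).
  exact: (Sch_fiber_Sch x (wker_Sch (translate_Sch g XiS))).
rewrite (le_trans (aB _ _ _ kS q))//.
have -> : C * m g * (jb (x - g.1) ^- n * M) = C * M * (m g * jb (x - g.1) ^- n) by ring.
rewrite -[leRHS]mulrA ler_wpM2r ?ler_norm// mulr_ge0 ?(ltW (m0 _))// invr_ge0 jbX_ge0//.
Qed.

Lemma iterint_ge0 (V : vectType R) (l : seq V) (h : V -> R) x : (forall y, 0 <= h y) ->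
  (0 <= iterint l (fun y => (h y)%:E) x)%E.
Proof.
by move=> h0; elim: l x => [|v l IH] x /=; [rewrite lee_fin|apply: integral_ge0 => t _].
Qed.

Lemma microlocal_weyl k C : microlocal_bound m a k C -> exists2 C' : R, 0 < C' &
  forall g, (L2norm ebasis (weyl (translate g Xi) a) <= (C' * m g)%:E)%E.
Proof.
move=> aB; pose n := size sE.
have [C1 C10 H1] := weyl_bd n aB; have [K K0 HK] := jb_wb bE.
pose Q := C1 ^+ 2 * K * pi ^+ n.
have Q0 : 0 <= Q by rewrite !mulr_ge0 ?exprn_ge0 ?pi_ge0// ltW.
exists (Num.sqrt Q + 1) => [|g]; first by rewrite ltr_wpDl ?sqrtr_ge0.
have mg := ltW (m0 g).
have H x : `|normc (weyl (translate g Xi) a x) ^+ 2| <= (C1 ^+ 2 * K * m g ^+ 2) * wb sE (x - g.1).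
  rewrite ger0_norm ?sqr_ge0//.
  have h : normc (weyl (translate g Xi) a x) ^+ 2 <= (C1 * m g * jb (x - g.1) ^- n) ^+ 2.
    by rewrite lerXn2r ?nnegrE ?normc_ge0 ?mulr_ge0 ?invr_ge0 ?jbX_ge0.
  rewrite (le_trans h)//.
  have -> : (C1 * m g * jb (x - g.1) ^- n) ^+ 2 = (C1 ^+ 2 * m g ^+ 2) * (jb (x - g.1) ^+ (2 * n))^-1.
    by rewrite !exprMn exprVn -exprM mulnC.
  have -> : C1 ^+ 2 * K * m g ^+ 2 * wb sE (x - g.1) = (C1 ^+ 2 * m g ^+ 2) * (K * wb sE (x - g.1)) by ring.
  rewrite ler_wpM2l ?mulr_ge0 ?sqr_ge0//.
  by rewrite -[leLHS]mul1r ler_pdivrMr ?jbX_gt0//; exact: HK.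
have P0 : 0 <= C1 ^+ 2 * K * m g ^+ 2 by rewrite !mulr_ge0 ?sqr_ge0// ltW.
have := iterint_bd bE P0 H.
have := @iterint_ge0 E es (fun x => normc (weyl (translate g Xi) a x) ^+ 2) 0 (fun x => sqr_ge0 _).
rewrite /L2norm -unzip_sysE.
case: (iterint _ _ _) => [r| |] //=; rewrite !lee_fin => r0.
rewrite ger0_norm// => rQ; rewrite powR12_sqrt//.
rewrite (@le_trans _ _ (Num.sqrt (Q * m g ^+ 2)))//.
  apply: ler_wsqrtr; rewrite (le_trans rQ)// /Q -/n.
  by rewrite le_eqVlt; apply/orP; left; apply/eqP; move: (pi ^+ n) => q; ring.
by rewrite sqrtrM// sqrtr_sqr ger0_norm// ler_wpM2r// lerDl.
Qed.

(** Substitute [t + g.1] for the variable of integration. The phases of the kernel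
  and of the two recenterings combine into a constant and the twist by
  [g.2 - z.2]. *)
Lemma weylT_recenter g z f x : Sch f ->
  recenter g (weylT (translate g Xi) f) x =
  cis (- pairing (g.1 - z.1) z.2) *
    twisted (fun p : E * E => wker Xi (p.2, p.1)) (recenter z f) (g.1 - z.1) (g.2 - z.2) x.
Proof.
move=> fS; have kS := Sch_swap (wker_Sch XiS).
have rS := recenter_Sch z fS; set u := g.1 - z.1; set om := g.2 - z.2.
have [C Cn] := Sch_nice bE (Sch_fiber_Sch x (twisted_Sch u om kS rS)).
have S1 : Sch (fun t => wker (translate g Xi) (t, x + g.1) * f t).
  by apply: Sch_mul => //; exact: (Sch_fiber_Schl (x + g.1) (wker_Sch (translate_Sch g XiS))).
have [C' Cn'] := Sch_nice bE S1; have [C2 Cn2] := Sch_nice bE (Sch_shift g.1 S1).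
rewrite /recenter /weylT -(IC_shift bE (@span_sysE R E) g.1 S1) -(IC_Z bE _ Cn2) twistedE -(IC_Z bE _ Cn).
congr IC; apply/funext => t /=; rewrite (wker_translate _ _ _ XiS) !addrK.
have -> : recenter z f (t + u) = cis (pairing (t + u) z.2) * f (t + g.1) by rewrite /recenter -[t + u + z.1]addrA subrK.
have -> : cis (pairing x g.2) * (cis (pairing (t + g.1 - (x + g.1)) g.2) * wker Xi (t, x) * f (t + g.1)) =
   (cis (pairing x g.2) * cis (pairing (t + g.1 - (x + g.1)) g.2)) * (wker Xi (t, x) * f (t + g.1)) by ring.
have -> : cis (- pairing u z.2) * (wker Xi (t, x) * (cis (prD om t) * (cis (pairing (t + u) z.2) * f (t + g.1)))) =
   (cis (- pairing u z.2) * cis (prD om t) * cis (pairing (t + u) z.2)) * (wker Xi (t, x) * f (t + g.1)) by ring.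
rewrite -!cisD; congr (cis _ * _).
rewrite /prD /om /pairing add_lfunE opp_lfunE.
have -> : t + g.1 - (x + g.1) = t - x by rewrite opprD addrACA subrr addr0.
have -> : g.2 (t - x) = g.2 t - g.2 x by exact: linearB.
have -> : z.2 (t + u) = z.2 t + z.2 u by exact: linearD.
move: (z.2 u) => w; ring.
Qed.

Lemma weylT_far n l L : exists2 C : R, 0 <= C & forall g z f M, Sch f ->
  Sb es L (fun x => jb x ^+ L) M (recenter z f) ->
  Sb es n (fun x => jb x ^+ l) (C * jb (g - z) ^- L * M) (recenter g (weylT (translate g Xi) f)).
Proof.
have [C C0 HC] := twisted_bd n l L (Sch_swap (wker_Sch XiS)).
have [K K0 HK] := jb_pair E (dual E).
exists (C * K ^+ L) => [|g z f M fS fM]; first by rewrite mulr_ge0 ?exprn_ge0// ltW.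
have M0 : 0 <= M by rewrite (le_trans _ (Sb_bd fM 0))// mulr_ge0 ?jbX_ge0 ?normc_ge0.
have S1 := HC _ (g.1 - z.1) (g.2 - z.2) _ (recenter_Sch z fS) fM.
have := Sb_scale (cis (- pairing (g.1 - z.1) z.2)) S1; rewrite normc_cis mul1r.
rewrite (_ : (fun x => _ * _) = recenter g (weylT (translate g Xi) f)); last first.
  by apply/funext => x; rewrite (weylT_recenter g z x fS).
apply: Sb_mono => //; rewrite -!mulrA ler_wpM2l// !mulrA ler_wpM2r//.
have h : jb (g - z) ^+ L <= K ^+ L * (jb (g.1 - z.1) ^+ L * jb (g.2 - z.2) ^+ L).
  rewrite -!exprMn lerXn2r ?nnegrE ?mulr_ge0 ?jb_ge0 ?(ltW K0)//; exact: HK.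
rewrite ler_pdivlMr ?jbX_gt0// -invfM mulrC ler_pdivrMr ?mulr_gt0 ?jbX_gt0//.
Qed.

Section Converse.
Variable Gamma : set PS.
Hypothesis GammaL : lattice Gamma.
Hypothesis Xi1 : partition_of_unity Gamma Xi.

(** By duality [a (weylT _ f)] is the integral of the function [weyl _ a], whose
  square norm is known, against [f]. *)
Lemma weylT_near C : (forall g, Gamma g ->
    (L2norm ebasis (weyl (translate g Xi) a) <= (C * m g)%:E)%E) ->
  exists k p (S : R), 0 <= S /\ forall g f z M, Gamma g -> Sch f -> qb k M (recenter z f) ->
    normc (a (weylT (translate g Xi) f)) <= S * m z * jb (g - z) ^+ p * M.
Proof.
move=> HC; pose n := size sE; have [K K0 HK] := jb_wb bE.
pose B0 := 2 * (K * pi ^+ n).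
have B00 : 0 <= B0 by rewrite !mulr_ge0 ?exprn_ge0 ?pi_ge0// ltW.
exists (2 * n)%N, N, (`|C| * Num.sqrt B0 * `|Cm|); split; first by rewrite !mulr_ge0 ?sqrtr_ge0.
move=> g f z M Gg fS fM; have M0 := qb_ge0 fM.
have gS := translate_Sch g XiS.
rewrite (tempered_weylT gS fS).
have [C1 un] := weyl_nice gS; have [C2 fn] := Sch_nice bE fS.
have u2 := niceC_sqr un.
set I := IC _ _.
have uA : complex.Re (IC sE (fun x => real_complex R (normc (weyl (translate g Xi) a x) ^+ 2))) <= (`|C| * m g) ^+ 2.
  have := HC g Gg; rewrite /L2norm -unzip_sysE.
  have E1 : iterint (unzip1 sE) (fun x => (normc (weyl (translate g Xi) a x) ^+ 2)%:E) 0 =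
     (complex.Re (IC sE (fun x => real_complex R (normc (weyl (translate g Xi) a x) ^+ 2))))%:E.
    have c0 := niceC_ge0 u2.
    exact: (iterint_iterR (U0 := fun=> 1) 0 bE c0 (fun=> ler01) (fun _ _ _ _ => erefl) (fun _ => id) (niceC_Re u2)).
  have := @iterint_ge0 E (unzip1 sE) (fun x => normc (weyl (translate g Xi) a x) ^+ 2) 0 (fun x => sqr_ge0 _).
  rewrite E1; set r := complex.Re _; rewrite /= !lee_fin => r0; rewrite powR12_sqrt// => h.
  rewrite -(sqr_sqrtr r0) lerXn2r ?nnegrE ?sqrtr_ge0 ?mulr_ge0 ?(ltW (m0 _))//.
  by rewrite (le_trans h)// ler_wpM2r ?ler_norm ?(ltW (m0 _)).
have fB : complex.Re (IC sE (fun x => real_complex R (normc (f x) ^+ 2))) <= B0 * M ^+ 2.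
  have rS := recenter_Sch z fS; have [C3 rn] := Sch_nice bE rS.
  have fS2 : Sch (fun x => real_complex R (normc (f x) ^+ 2)).
    by have := Sch_mul fS (Sch_conj fS); congr Sch; apply/funext => x; rewrite mul_conjC_normc.
  have -> : IC sE (fun x => real_complex R (normc (f x) ^+ 2)) =
      IC sE (fun x => real_complex R (normc (recenter z f x) ^+ 2)).
    rewrite -(IC_shift bE (@span_sysE R E) z.1 fS2); congr IC; apply/funext => x.
    by rewrite /recenter normcM normc_cis mul1r.
  rewrite (le_trans (ler_norm _))// (le_trans (ler_Re_normc _))//.
  have -> : B0 * M ^+ 2 = 2 * (K * M ^+ 2 * pi ^+ n) by rewrite /B0; move: (pi ^+ n) => q; ring.
  apply: (IC_bd_size bE _ (niceC_sqr rn)) => [|x]; first by rewrite mulr_ge0 ?sqr_ge0// ltW.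
  rewrite normc_real ger0_norm ?sqr_ge0//.
  have h := Sb_bd fM x; have J1 := jbX_ge1 x (2 * n).
  have h1 : normc (recenter z f x) <= M.
    by rewrite (le_trans _ h)// -[leLHS]mul1r ler_wpM2r ?normc_ge0.
  have h3 := HK x; have w0 := wb_ge0 sE x.
  rewrite (@le_trans _ _ (K * wb sE x * jb x ^+ (2 * n) * normc (recenter z f x) ^+ 2))//.
    by rewrite -[leLHS]mul1r ler_wpM2r ?sqr_ge0.
  have -> : K * wb sE x * jb x ^+ (2 * n) * normc (recenter z f x) ^+ 2 =
    (K * wb sE x) * (jb x ^+ (2 * n) * normc (recenter z f x) * normc (recenter z f x)).
    by rewrite expr2 !mulrA.
  have -> : K * M ^+ 2 * wb sE x = (K * wb sE x) * (M * M) by ring.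
  rewrite ler_wpM2l ?mulr_ge0 ?(ltW K0)//; apply: ler_pM => //; rewrite ?mulr_ge0 ?normc_ge0 ?jbX_ge0//.
have mg := ltW (m0 g).
have CS := Cauchy_Schwarz bE un fn uA fB; rewrite -/I in CS.
have h : normc I <= `|C| * m g * (Num.sqrt B0 * M).
  rewrite -(@ler_pXn2r _ 2) ?nnegrE ?normc_ge0 ?mulr_ge0 ?sqrtr_ge0//.
  by rewrite (le_trans CS)// [leRHS]exprMn [X in _ <= _ * X]exprMn sqr_sqrtr.
rewrite (le_trans h)//.
have -> : `|C| * m g * (Num.sqrt B0 * M) = (`|C| * Num.sqrt B0 * M) * m g by ring.
have -> : `|C| * Num.sqrt B0 * `|Cm| * m z * jb (g - z) ^+ N * M =
   (`|C| * Num.sqrt B0 * M) * (`|Cm| * jb (g - z) ^+ N * m z) by ring.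
rewrite ler_wpM2l ?mulr_ge0 ?sqrtr_ge0//.
rewrite (le_trans (mP g z))// ler_wpM2r ?(ltW (m0 _))// ler_wpM2r ?ler_norm// jbX_ge0//.
Qed.

Local Notation D := (2 * \dim {:PS})%N.

(** Up to an arbitrarily small error at [rho], what is missing from the partition
  of unity is a sum over the points outside [B], to which the summable tail of
  [jb (0 - g) ^- D] applies. The power of [jb rho] is the price for measuring
  distances from 0 instead of [rho]. *)
Lemma Xi_tail (e : R) : 0 < e -> exists2 A : {fset PS}, [set` A] `<=` Gamma &
  forall B : {fset PS}, [set` A] `<=` [set` B] -> [set` B] `<=` Gamma ->
  forall rho, normc (\sum_(g <- enum_fset B) translate g Xi rho - 1) <= e * jb rho ^+ D.
Proof.
move=> e0; have [M HM] := Sch_bd D XiS; have [K K0 HK] := lattice_sum GammaL.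
have M1 : 0 < `|M| + 1 by rewrite ltr_wpDl.
have w0 (g : PS) : 0 <= jb (0 - g) ^- D by rewrite invr_ge0 jbX_ge0.
have [A AG HA] := summable_tail w0 (HK 0) (divr_gt0 e0 M1).
exists A => // B AB BG rho; apply/ler_addgt0Pr => d d0.
have [A' [A'G HA']] := Xi1 rho d0.
pose U := (B `|` A')%fset.
have UG : [set` U] `<=` Gamma by move=> g /=; rewrite inE => /orP[/BG|/A'G].
have BU : [set` B] `<=` [set` U] by move=> g /= gB; rewrite inE gB.
have A'U : [set` A'] `<=` [set` U] by move=> g /= gB; rewrite inE gB orbT.
have := HA' U A'U UG; rewrite (sum_fsetD _ BU) => hU.
have hT : normc (\sum_(g <- enum_fset (U `\` B)%fset) translate g Xi rho) <= e * jb rho ^+ D.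
  rewrite (le_trans (normc_sum _ _ _))//.
  rewrite (@le_trans _ _ (\sum_(g <- enum_fset (U `\` B)%fset) (`|M| * jb rho ^+ D) * jb (0 - g) ^- D))//.
    apply: ler_sum => g _; rewrite ler_pdivlMr ?jbX_gt0//.
    have h : jb (0 - g) ^+ D <= jb (rho - g) ^+ D * jb rho ^+ D.
      by rewrite -exprMn lerXn2r ?nnegrE ?mulr_ge0 ?jb_ge0// (_ : 0 - g = (rho - g) - rho) ?jbB// addrAC subrr.
    rewrite (le_trans (ler_wpM2l (normc_ge0 _) h))// mulrA ler_wpM2r ?jbX_ge0//.
    by rewrite mulrC (le_trans (HM _))// ler_norm.
  rewrite -mulr_sumr (le_trans (ler_wpM2l _ (HA B U AB BU UG))) ?mulr_ge0 ?jbX_ge0//.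
  have -> : `|M| * jb rho ^+ D * (e / (`|M| + 1)) = (`|M| / (`|M| + 1)) * (e * jb rho ^+ D).
    by field; rewrite gt_eqF.
  by rewrite ler_piMl ?mulr_ge0 ?jbX_ge0 ?(ltW e0)// ler_pdivrMr// mul1r lerDl.
have -> : \sum_(g <- enum_fset B) translate g Xi rho - 1 =
  (\sum_(g <- enum_fset B) translate g Xi rho + \sum_(g <- enum_fset (U `\` B)%fset) translate g Xi rho - 1)
  - \sum_(g <- enum_fset (U `\` B)%fset) translate g Xi rho by ring.
by rewrite (le_trans (normcB _ _))// addrC lerD// ltW.
Qed.

(** The weights are summed pointwise, which gives a bound independent of the
  number of terms even though no single term is small uniformly. *)
Lemma Sb_sum_weighted (V : vectType R) (s : seq V) n (w : PS -> V -> R) M (r : seq PS) (F : PS -> V -> R[i]) :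
  0 <= M -> (forall g x, 0 < w g x) -> (forall g, Sb s n (w g) M (F g)) ->
  forall K : R, (forall x, \sum_(g <- r) (w g x)^-1 <= K) ->
  Sb s n (fun=> 1) (M * K) (fun x => \sum_(g <- r) F g x).
Proof.
move=> M0 w0 + K HK; elim: n F => [|n IH] F HF; (have bd x : 1 * normc (\sum_(g <- r) F g x) <= M * K by
  rewrite mul1r (le_trans (normc_sum _ _ _))// (le_trans _ (ler_wpM2l M0 (HK x)))// mulr_sumr;
  apply: ler_sum => g _; rewrite ler_pdivlMr// mulrC; exact: (Sb_bd (HF g))).
  by split.
split=> // v vs.
have [G HG] := choice (fun g => Sb_D (HF g) vs).
exists (fun x => \sum_(g <- r) G g x); split; first by apply: isD_sum => g; exact: (HG g).1.
by apply: IH => g; exact: (HG g).2.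
Qed.

Lemma Xi_sum_bd (s : seq PS) n : exists2 M : R, 0 <= M & forall B : {fset PS}, [set` B] `<=` Gamma ->
  Sb s n (fun=> 1) M (fun rho => \sum_(g <- enum_fset B) translate g Xi rho - 1).
Proof.
have [M HM] := XiS s n D; have [K K0 HK] := lattice_sum GammaL.
exists (`|M| * K + normc (- 1 : R[i])) => [|B BG]; first by rewrite addr_ge0 ?mulr_ge0 ?normc_ge0.
apply: Sb_add => //; last exact: Sb_const.
apply: (@Sb_sum_weighted _ _ _ (fun g rho => jb (rho - g) ^+ D)) => //.
- by move=> g rho; exact: jbX_gt0.
- by move=> g; have := Sb_shift (- g) HM; apply: Sb_mono => //; exact: ler_norm.
- by move=> rho; exact: HK.
Qed.

(** [osc f y b] is the integrand in the momentum variable of the transposed Weyl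
  operator with symbol [b], applied to [f] at [y]. *)
Definition osc f y b (th : dual E) : R[i] :=
  IC sE (fun x => cis (pairing (x - y) th) * (b (2^-1 *: (x + y), th) * f x)).

Lemma osc_pair_Sch f y b : Sch b -> Sch f ->
  Sch (fun p : PS => cis (pairing (p.1 - y) p.2) * (b (2^-1 *: (p.1 + y), p.2) * f p.1)).
Proof.
move=> bS fS.
pose L (p : PS) : PS := (2^-1 *: p.1, p.2).
have lL : linear L.
  move=> c [x xi] [x' xi']; apply: injective_projections => //=.
  by rewrite scalerDr !scalerA mulrC.
pose L' (p : PS) : PS := (2 *: p.1, p.2).
have lL' : linear L'.
  move=> c [x xi] [x' xi']; apply: injective_projections => //=.
  by rewrite scalerDr !scalerA mulrC.
have LK p : L' (L p) = p by case: p => x xi; rewrite /L /L' /= scalerA mulfV ?scale1r// pnatr_eq0.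
have [C C0 HC] := affine_jb (- L' (2^-1 *: y, 0)) lL'.
have S1 : Sch (fun p : PS => b (L p + (2^-1 *: y, 0))).
  apply: (@Sch_pull _ _ _ L _ b C lL) => // p.
  have := HC (L p + (2^-1 *: y, 0)); congr (jb _ <= _).
  by rewrite (linD lL') LK addrK.
have M1 : Mod (fun p : PS => f p.1).
  by have := Mod_pull 0 (@linear_fst R E (dual E)) (Sch_Mod fS); congr Mod; apply/funext => p; rewrite addr0.
have M2 : Mod (fun p : PS => cis (- pairing y p.2)).
  have := Mod_pull 0 (@linear_snd R E (dual E)) (Mod_cisr (@prE_r R E) (- y)).
  by congr Mod; apply/funext => p; rewrite addr0 /prE /pairing linearN.
have M3 := Mod_pairing (@prE_l R E) (@prE_r R E).
have := Sch_mul_Mod S1 (Mod_mul M1 (Mod_mul M2 M3)).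
congr Sch; apply/funext => -[x th] /=.
have -> : L (x, th) + (2^-1 *: y, 0) = (2^-1 *: (x + y), th).
  by rewrite /L /= scalerDr; apply: injective_projections => //=; rewrite addr0.
rewrite -cisD mulrA [RHS]mulrC; congr (_ * cis _).
by rewrite /prE /pairing linearB addrC.
Qed.

Lemma weylT_osc f y b : Sch b -> Sch f ->
  weylT b f y = real_complex R ((2 * pi) ^- \dim {:E}) * IC sD (osc f y b).
Proof.
move=> bS fS; have pS := osc_pair_Sch y bS fS.
have [C Cn] := Sch_nice bE (IC_Sch bD pS).
rewrite /osc -(IC_Fubini bE bD pS) -(IC_Z bE _ Cn) /weylT; congr IC; apply/funext => x.
rewrite (wkerE _ bS) -mulrA; congr (_ * _).
have I1 := PF_integrand (@prE_r R E) (midpoint_diff (x, y)) bS.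
have [C1 Cn1] := Sch_nice bD I1.
rewrite mulrC /PF -(IC_Z bD _ Cn1); congr IC; apply/funext => th.
by rewrite mulrCA [f x * _]mulrC.
Qed.

Lemma osc_Sch f y b : Sch b -> Sch f -> Sch (osc f y b).
Proof.
by move=> bS fS; exact: (IC_Sch bE (Sch_swap (osc_pair_Sch y bS fS))).
Qed.

(** Integration by parts in the position variable. *)
Lemma osc_decay f y L : Sch f -> exists2 C : R, 0 <= C & forall b M th,
  Sb [seq (2^-1 *: v, 0 : dual E) | v <- es] L (fun=> 1) M b ->
  Sch (fun x => b (2^-1 *: (x + y), th) * f x) ->
  jb th ^+ L * normc (osc f y b th) <= C * M.
Proof.
move=> fS; pose q := (2 * size sE)%N.
have [C1 C10 HC] := FT_decay bE (@prD_r R E) (@prD_span R E) L.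
have [M1 HM1] := fS es L q.
exists (C1 * (2 ^+ L * `|M1|)) => [|b M th bM hS]; first by rewrite !mulr_ge0 ?exprn_ge0.
have M0 : 0 <= M by rewrite (le_trans _ (Sb_bd bM 0))// mul1r normc_ge0.
pose L0 (x : E) : PS := (2^-1 *: x, 0).
have lL : linear L0.
  move=> c x x'; rewrite /L0; apply: injective_projections => /=.
    by rewrite scalerDr !scalerA mulrC.
  by rewrite scaler0 addr0.
have S1 : Sb es L (fun=> 1) M (fun x => b (2^-1 *: (x + y), th)).
  have := Sb_pull (2^-1 *: y, th) lL bM; congr Sb; apply/funext => x.
  rewrite (_ : L0 x + _ = (2^-1 *: (x + y), th))//.
  by rewrite /L0 scalerDr; apply: injective_projections => //=; rewrite add0r.
have S2 := Sb_mul (fun=> ler01) (fun x => jbX_ge0 x q) S1 HM1.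
have S3 : Sb (unzip1 sE) L (fun x => jb x ^+ q) (2 ^+ L * `|M1| * M) (fun x => b (2^-1 *: (x + y), th) * f x).
  rewrite unzip_sysE; apply: (@Sb_weaken _ _ _ _ _ _ _ _ _ _ _ 1 _ _ _ _ _ S2) => // [x|].
    by rewrite !mul1r.
  by rewrite mul1r [M * _]mulrC mulrA ler_wpM2r// ler_wpM2l ?exprn_ge0// ler_norm.
have := HC _ _ th hS S3; rewrite (mulrA C1).
rewrite (_ : normc (FE _ _) = normc (osc f y b th))//.
have [C2 Cn] := Sch_nice bE (FT_integrand (@prD_r R E) th hS).
have -> : osc f y b th = cis (- pairing y th) * FE (fun x => b (2^-1 *: (x + y), th) * f x) th.
  rewrite /FT -(IC_Z bE _ Cn) /osc; congr IC; apply/funext => x.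
  by rewrite [RHS]mulrA -cisD; congr (cis _ * _); rewrite /prD /pairing linearB addrC.
by rewrite normcM normc_cis mul1r.
Qed.

(** Direct estimation: the decay of [f] absorbs the growth of the symbol in the
  position, and the growth in the momentum [th] is what remains. *)
Lemma osc_small f y : Sch f -> exists2 C : R, 0 <= C & forall b (e : R) th, 0 <= e ->
  (forall rho, normc (b rho) <= e * jb rho ^+ D) ->
  Sch (fun x => b (2^-1 *: (x + y), th) * f x) ->
  normc (osc f y b th) <= C * e * jb th ^+ D.
Proof.
move=> fS; pose q := (2 * size sE)%N.
have [K K0 HK] := jb_wb bE; have [K1 K10 HK1] := jb_pair E (dual E).
have [M HM] := Sch_bd (D + q) fS.
have lh : linear (fun x : E => 2^-1 *: x) by move=> c u v; rewrite scalerDr !scalerA mulrC.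
have [K2 K20 HK2] := affine_jb (2^-1 *: y) lh.
exists (2 * ((K1 * K2) ^+ D * `|M| * K * pi ^+ size sE)) => [|b e th e0 be hS].
  by rewrite !mulr_ge0 ?exprn_ge0 ?pi_ge0 ?mulr_ge0// ltW.
have gS : Sch (fun x => cis (pairing (x - y) th) * (b (2^-1 *: (x + y), th) * f x)).
  have := Sch_scale (cis (- pairing y th)) (FT_integrand (@prD_r R E) th hS).
  congr Sch; apply/funext => x.
  by rewrite mulrA -cisD; congr (cis _ * _); rewrite /prD /pairing linearB addrC.
have [C Cn] := Sch_nice bE gS.
have -> : 2 * ((K1 * K2) ^+ D * `|M| * K * pi ^+ size sE) * e * jb th ^+ D =
  2 * ((K1 * K2) ^+ D * `|M| * K * e * jb th ^+ D * pi ^+ size sE).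
  by move: (pi ^+ _) => p; ring.
apply: (IC_bd_size bE _ Cn) => [|x].
  by rewrite !mulr_ge0 ?exprn_ge0 ?mulr_ge0 ?jb_ge0// ltW.
rewrite !normcM normc_cis mul1r.
have h1 : normc (b (2^-1 *: (x + y), th)) <= e * ((K1 * K2) ^+ D * (jb x ^+ D * jb th ^+ D)).
  rewrite (le_trans (be _))// ler_wpM2l// -!exprMn lerXn2r ?nnegrE ?mulr_ge0 ?jb_ge0 ?(ltW K10) ?(ltW K20)//.
  rewrite (le_trans (HK1 _ _))// -!mulrA ler_wpM2l ?(ltW K10)// mulrA ler_wpM2r ?jb_ge0//.
  by rewrite scalerDr; exact: HK2.
have h2 : normc (f x) <= `|M| * (jb x ^+ D * jb x ^+ q)^-1.
  rewrite ler_pdivlMr ?mulr_gt0 ?jbX_gt0// mulrC -exprD (le_trans (HM x))// ler_norm//.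
rewrite (le_trans (ler_pM (normc_ge0 _) (normc_ge0 _) h1 h2))//.
have h3 : (jb x ^+ q)^-1 <= K * wb sE x.
  by rewrite -[leLHS]mul1r ler_pdivrMr ?jbX_gt0//; exact: HK.
have -> : e * ((K1 * K2) ^+ D * (jb x ^+ D * jb th ^+ D)) * (`|M| * (jb x ^+ D * jb x ^+ q)^-1) =
   ((K1 * K2) ^+ D * `|M| * e * jb th ^+ D) * (jb x ^+ q)^-1.
  have := jbX_gt0 x D; have := jbX_gt0 x q.
  move: (jb x ^+ D) (jb x ^+ q) ((K1 * K2) ^+ D) (jb th ^+ D) => A1 A2 A3 A4 p2 p1.
  by field; rewrite !gt_eqF.
have -> : (K1 * K2) ^+ D * `|M| * K * e * jb th ^+ D * wb sE x =
   ((K1 * K2) ^+ D * `|M| * e * jb th ^+ D) * (K * wb sE x).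
  by move: ((K1 * K2) ^+ D) (jb th ^+ D) => A3 A4; ring.
by rewrite ler_wpM2l// !mulr_ge0 ?exprn_ge0 ?mulr_ge0 ?jb_ge0// ltW.
Qed.

Lemma midpoint_fiber_Sch f y th b : Mod b -> Sch f -> Sch (fun x => b (2^-1 *: (x + y), th) * f x).
Proof.
move=> bM fS; pose L0 (x : E) : PS := (2^-1 *: x, 0).
have lL : linear L0.
  move=> c x x'; rewrite /L0; apply: injective_projections => /=.
    by rewrite scalerDr !scalerA mulrC.
  by rewrite scaler0 addr0.
have := Sch_mul_Mod fS (Mod_pull (2^-1 *: y, th) lL bM).
congr Sch; apply/funext => x; rewrite mulrC.
rewrite (_ : L0 x + _ = (2^-1 *: (x + y), th))//.
by rewrite /L0 scalerDr; apply: injective_projections => //=; rewrite add0r.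
Qed.

Variable G : dual E -> R[i].
Hypothesis GS : Sch G.
Hypothesis G0 : G 0 = 1.
Hypothesis cF0 : cF G != 0.

Definition cW : R[i] := real_complex R ((2 * pi) ^- \dim {:E}) * cF G.

Lemma cW_neq0 : cW != 0.
Proof.
rewrite mulf_neq0// fmorph_eq0 invr_neq0// expf_neq0// mulf_neq0// ?pnatr_eq0//.
by rewrite gt_eqF// pi_gt0.
Qed.

(** For the symbol 1 this is Fourier inversion. *)
Lemma osc1 f y : Sch f -> Sch (osc f y (fun=> 1)) /\ IC sD (osc f y (fun=> 1)) = cF G * f y.
Proof.
move=> fS; split.
  have := fourier_dual_Sch_integrand y (FE_Sch fS); congr Sch; apply/funext => th.
  have [C Cn] := Sch_nice bE (FT_integrand (@prD_r R E) th fS).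
  rewrite /FT -(IC_Z bE _ Cn) /osc; congr IC; apply/funext => x.
  by rewrite mul1r mulrA -cisD; congr (cis _ * _); rewrite /prD /pairing linearB addrC.
rewrite -(inversion GS G0 y fS); congr IC; apply/funext => th.
by rewrite /osc; congr IC; apply/funext => x; rewrite mul1r.
Qed.

Lemma osc_sum f y (r : seq PS) th : Sch f ->
  osc f y (fun rho => \sum_(g <- r) translate g Xi rho - 1) th =
  \sum_(g <- r) osc f y (translate g Xi) th - osc f y (fun=> 1) th.
Proof.
move=> fS.
have n b : Mod b -> exists C, niceC sE C (fun x => cis (pairing (x - y) th) * (b (2^-1 *: (x + y), th) * f x)).
  move=> bM; apply: (Sch_nice bE).
  have := Sch_scale (cis (- pairing y th)) (FT_integrand (@prD_r R E) th (midpoint_fiber_Sch y th bM fS)).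
  congr Sch; apply/funext => x.
  by rewrite mulrA -cisD; congr (cis _ * _); rewrite /prD /pairing linearB addrC.
have [C1 n1] := n _ (@Mod_const R PS 1).
have [C Cn] := choice (fun g => n _ (Sch_Mod (translate_Sch g XiS))).
rewrite /osc -(IC_sum bE r Cn) -(IC_B bE (niceC_sum r Cn) n1); congr IC; apply/funext => x.
rewrite mulrBl mulrBr; congr (_ - _).
by rewrite mulr_suml mulr_sumr.
Qed.

(** The symbols [\sum Xi_g - 1] have uniformly bounded derivatives and tend to
  0 locally uniformly. The first fact bounds the oscillatory integral by a high
  negative power of the momentum, the second one by a small multiple of a
  positive power; their geometric mean is small and integrable. *)
Lemma weylT_has_sum f y : Sch f ->
  has_sum Gamma (fun g => weylT (translate g Xi) f y) (cW * f y).
Proof.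
move=> fS e e0; pose n := size sD; pose L := (D + 4 * n)%N.
have [C1 C10 H1] := osc_decay y L fS; have [C2 C20 H2] := osc_small y fS.
have [M M0 HM] := Xi_sum_bd [seq (2^-1 *: v, 0 : dual E) | v <- es] L.
have [K K0 HK] := jb_wb bD.
set cd := real_complex R ((2 * pi) ^- \dim {:E}).
have [Q [Q0 QE]] : exists Q, 0 <= Q /\ Q = C1 * M * C2 by exists (C1 * M * C2); rewrite !mulr_ge0.
have [T [T0 TE]] : exists T, 0 <= T /\ T = normc cd * (2 * (K * pi ^+ n)).
  by exists (normc cd * (2 * (K * pi ^+ n))); rewrite !mulr_ge0 ?normc_ge0 ?exprn_ge0 ?pi_ge0// ltW.
pose d := (e / (T + 1)) ^+ 2 / (Q + 1).
have T1 : 0 < T + 1 by rewrite ltr_wpDl.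
have Q1 : 0 < Q + 1 by rewrite ltr_wpDl.
have d0 : 0 < d by rewrite divr_gt0// exprn_gt0// divr_gt0.
have [A AG HA] := Xi_tail d0.
exists A; split=> // B AB BG.
pose b rho := \sum_(g <- enum_fset B) translate g Xi rho - 1.
have bM : Mod b.
  have := Mod_add (Sch_Mod (Sch_sum (enum_fset B) (fun g => translate_Sch g XiS))) (@Mod_const R PS (- 1)).
  exact.
have hS th := midpoint_fiber_Sch y th bM fS.
have [oS oE] := osc1 y fS; have [Co on] := Sch_nice bD oS.
have [Cg Hg] := choice (fun g => Sch_nice bD (osc_Sch y (translate_Sch g XiS) fS)).
have hn := niceC_D (niceC_sum (enum_fset B) Hg) (niceC_N on).
have -> : \sum_(g <- enum_fset B) weylT (translate g Xi) f y - cW * f y = cd * IC sD (osc f y b).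
  rewrite /cW -mulrA -oE (eq_bigr (fun g => cd * IC sD (osc f y (translate g Xi)))); last first.
    by move=> g _; rewrite (weylT_osc y (translate_Sch g XiS) fS).
  rewrite -mulr_sumr -mulrBr -(IC_sum bD _ Hg) -(IC_B bD (niceC_sum _ Hg) on); congr (_ * IC _ _).
  by apply/funext => th; rewrite osc_sum.
rewrite normcM.
have small th : normc (osc f y b th) <= e / (T + 1) * jb th ^- (2 * n).
  have h1 := H1 b M th (HM B BG) (hS th).
  have h2 := H2 b d th (ltW d0) (HA B AB BG) (hS th).
  have r0 : 0 <= e / (T + 1) by rewrite divr_ge0 ?(ltW e0) ?(ltW T1).
  rewrite -(@ler_pXn2r _ 2) ?nnegrE ?normc_ge0//; last first.
    by rewrite mulr_ge0// invr_ge0 jbX_ge0.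
  have J1 := jbX_gt0 th D; have J2 := jbX_gt0 th (4 * n).
  have h3 : normc (osc f y b th) <= C1 * M / (jb th ^+ D * jb th ^+ (4 * n)).
    by rewrite -exprD ler_pdivlMr ?jbX_gt0// mulrC.
  have := ler_pM (normc_ge0 _) (normc_ge0 _) h3 h2; rewrite -expr2 => /le_trans; apply.
  rewrite exprMn exprVn -exprM (_ : (2 * n * 2 = 4 * n)%N); last by rewrite mulnC mulnA.
  move: J1 J2.
  move: (jb th ^+ D) (jb th ^+ (4 * n)) => a1 a2 p1 p2.
  have -> : C1 * M / (a1 * a2) * (C2 * d * a1) = Q * d / a2 by rewrite QE; field; rewrite !gt_eqF.
  rewrite ler_pM2r ?invr_gt0// /d mulrCA ler_piMr ?sqr_ge0//.
  by rewrite ler_pdivrMr// mul1r lerDl.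
have hE : (fun x => \sum_(i <- enum_fset B) osc f y (translate i Xi) x + - osc f y (fun=> 1) x) = osc f y b.
  by apply/funext => th; rewrite osc_sum.
rewrite hE in hn.
have H : normc (IC sD (osc f y b)) <= 2 * (e / (T + 1) * K * pi ^+ n).
  apply: (IC_bd_size bD _ hn) => [|th]; first by rewrite !mulr_ge0 ?invr_ge0 ?(ltW e0) ?(ltW T1) ?(ltW K0).
  rewrite (le_trans (small th))// -[leRHS]mulrA ler_wpM2l ?divr_ge0 ?(ltW e0) ?(ltW T1)//.
  by rewrite -[leLHS]mul1r ler_pdivrMr ?jbX_gt0//; exact: HK.
rewrite (le_lt_trans (ler_wpM2l (normc_ge0 _) H))//.
have -> : normc cd * (2 * (e / (T + 1) * K * pi ^+ n)) = T / (T + 1) * e.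
  by rewrite TE; move: (pi ^+ n) (normc cd) => p c; ring.
by rewrite gtr_pMl// ltr_pdivrMr// mul1r ltrDl.
Qed.

Lemma recenter0 f : recenter 0 f = f.
Proof. by apply/funext => x; rewrite /recenter /pairing lfunE /= cis0 mul1r addr0. Qed.

Lemma weylT_sum f : Sch f -> has_sum Gamma (fun g => a (weylT (translate g Xi) f)) (cW * a f).
Proof.
move=> fS; have [K K0 HK] := lattice_sum GammaL; rewrite -(tempered_scale aT _ fS).
apply: (@tempered_has_sum _ _ _ _ (fun g => jb (0 - g) ^- D) K) => //.
- by move=> g; rewrite invr_ge0 jbX_ge0.
- exact: HK.
- by move=> g; apply: weylT_Sch => //; exact: translate_Sch.
- exact: Sch_scale.
- move=> k n; pose L := (n + k + D)%N.
  have [M HM] := fS es L L; have [C C0 HC] := weylT_far n k L; have [Cu Cu0 Hu] := @unrecenter_bd R E k n.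
  exists (Cu * C * M) => g _; rewrite -(recenter0 f) in HM.
  have := Hu _ _ _ (HC g 0 f M fS HM); apply: Sb_mono => //.
  rewrite subr0 sub0r jbN /L [jb g ^+ (_ + _ + _)]exprD.
  have := jbX_gt0 g (n + k); have := jbX_gt0 g D.
  move: (jb g ^+ (n + k)) (jb g ^+ D) => a1 a2 p2 p1.
  by rewrite le_eqVlt; apply/orP; left; apply/eqP; field; rewrite !gt_eqF.
- by move=> x; exact: weylT_has_sum.
Qed.

Lemma weyl_microlocal C : (forall g, Gamma g ->
    (L2norm ebasis (weyl (translate g Xi) a) <= (C * m g)%:E)%E) ->
  exists k C', microlocal_bound m a k C'.
Proof.
move=> HC.
apply: (@absorption _ _ _ Cm N m0 mP _ aT _ Gamma (fun g _ => g) (fun g f => weylT (translate g Xi) f) cW).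
- exact: cW_neq0.
- by move=> g f fS; apply: weylT_Sch => //; exact: translate_Sch.
- exact: weylT_sum.
- have [K K0 HK] := lattice_sum GammaL; exists D, K; split=> // z A AG.
  rewrite (le_trans _ (HK z A AG))//.
  by under eq_bigr do rewrite jb_distC.
- by have [k [p [S [S0 HS]]]] := weylT_near HC; exists k, p, S; split=> // g f z M; exact: HS.
- move=> L; exists L => k Lk; have [C' _ HC'] := weylT_far k k L.
  exists C' => g f z M _ fS fM; apply: HC' => //; exact: qb_le fM.
Qed.

End Converse.

End XiSide.

Section Regulariser.
Context {R : realType} {E : vectType R}.
Local Notation PS := (E * dual E)%type.

(** Since its translates sum to 1, [Xi] is nonzero at some [rho]. Its restriction to
  the momentum fibre through [rho] is the regulariser of [inversion], and the
  restriction to the position fibre shows that the constant is nonzero. *)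
Lemma regulariser (Gamma : set PS) (Xi : PS -> R[i]) : Sch Xi -> partition_of_unity Gamma Xi ->
  exists G : dual E -> R[i], [/\ Sch G, G 0 = 1 & cF G != 0].
Proof.
move=> XiS Xi1.
have [rho r0] : exists rho, Xi rho <> 0.
  apply: contrapT => /forallNP H; have [A [AG HA]] := Xi1 0 1 ltr01.
  have := HA A (fun _ => id) AG; rewrite big1 ?sub0r ?normcN ?normc1 ?ltxx// => g _.
  by have := H (0 - g) => /contrapT.
have GS : Sch (fun eta => (Xi rho)^-1 * Xi (rho.1, eta + rho.2)).
  by apply: Sch_scale; have := Sch_shift rho.2 (Sch_fiber_Sch rho.1 XiS).
have G0 : (Xi rho)^-1 * Xi (rho.1, 0 + rho.2) = 1.
  by rewrite add0r -surjective_pairing mulVf//; apply/eqP.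
exists (fun eta => (Xi rho)^-1 * Xi (rho.1, eta + rho.2)); split=> //.
apply: (cF_neq0 GS G0 (Sch_shift rho.1 (Sch_fiber_Schl rho.2 XiS))).
by rewrite add0r -surjective_pairing.
Qed.

End Regulariser.

Theorem proposition2p4 (R : realType) (E : vectType R)
    (m : E * dual E -> R) (hm : order_function m)
    (Gamma : set (E * dual E)%type) (hGamma : lattice Gamma)
    (Xi : E * dual E -> R[i]) (hXi : schwartz Xi)
    (hXi1 : partition_of_unity Gamma Xi)
    (J : set E) (hJ : lattice J)
    (chi : E -> R[i]) (hchi : schwartz chi)
    (hchi1 : partition_of_unity J chi) :
  Stilde Gamma Xi m =
  [set a | tempered a /\ exists2 C : R, 0 < C &
    forall j, J j -> exists2 F : dual E -> R[i],
      is_function (fourier_distr (mul_distr (translate j chi) a)) F &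
      forall xs : dual E, normc (F xs) <= C * m (j, xs)].
Proof.
have [m0 [Cm _ [N mP]]] := order_function_jb hm.
have XiS := schwartz_Sch hXi; have chiS := schwartz_Sch hchi.
have [G [GS G0 cF0]] := regulariser XiS hXi1.
apply/seteqP; split=> a [aT [C C0 HC]]; split=> //.
  have [k [C' LB]] := weyl_microlocal m0 mP aT XiS hGamma hXi1 GS G0 cF0 HC.
  have [C1 C10 H1] := microlocal_local_hat m0 mP aT GS G0 chiS LB.
  by exists C1 => // j _; exact: H1.
have [k [C' LB]] := chi_microlocal m0 mP aT GS G0 chiS cF0 hJ HC hchi1.
have [C1 C10 H1] := microlocal_weyl m0 XiS LB.
by exists C1 => // g _; exact: H1.
Qed.
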